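(* Let $r>1$ and $p\ge 1$ be integers, let $X_1,X_2,\ldots\in\mathbb{R}^p$ be a fixed (non-random) sequence, let $\beta\in\mathbb{R}^{r\times p}$, and let $Y_i=\beta X_i+\varepsilon_i$ for $i\ge 1$, where $\varepsilon_1,\varepsilon_2,\ldots\in\mathbb{R}^r$ are independent random vectors with a common law $F$ having mean zero, positive definite variance-covariance matrix $\Sigma$, and finite fourth moments. For each $n>p$ let $\mathbb{X}\in\mathbb{R}^{n\times p}$ be the matrix with rows $X_1^T,\ldots,X_n^T$, and suppose that $n^{-1}\mathbb{X}^T\mathbb{X}\to\Sigma_X$ as $n\to\infty$ for some positive definite matrix $\Sigma_X$. Let $\hat\beta$ be the ordinary least squares estimator, and let $\hat\beta^{*}$ and $\widehat\Sigma^{*}$ be the residual-bootstrap estimators of $\beta$ and $\Sigma$ (all defined in the context). Then, conditional on almost all sample paths $Y_1,\ldots,Y_n$, as $n\to\infty$: (a) $\sqrt{n}\,\{\mathrm{vec}(\hat\beta^{*})-\mathrm{vec}(\hat\beta)\}$ converges in distribution to $N(0,\Sigma_X^{-1}\otimes\Sigma)$; (b) $\widehat\Sigma^{*}\to\Sigma$ in probability; (c) $\{(\mathbb{X}^T\mathbb{X})^{1/2}\otimes(\widehat\Sigma^{*})^{-1/2}\}\{\mathrm{vec}(\hat\beta^{*})-\mathrm{vec}(\hat\beta)\}$ converges in distribution to $N(0,I_{rp})$.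
   Context: $\mathrm{vec}$ stacks the columns of a matrix, so $\mathrm{vec}(\hat\beta)\in\mathbb{R}^{rp}$; $\otimes$ is the Kronecker product; $I_k$ is the $k\times k$ identity; $A^{1/2}$ denotes the symmetric square root of a positive (semi)definite matrix. Since $n^{-1}\mathbb{X}^T\mathbb{X}\to\Sigma_X>0$, $\mathbb{X}^T\mathbb{X}$ is invertible for all large $n$; only such $n$ are considered. Let $\mathbb{Y}\in\mathbb{R}^{n\times r}$ be the matrix with rows $Y_1^T,\ldots,Y_n^T$. The OLS estimator is $\hat\beta=\mathbb{Y}^T\mathbb{X}(\mathbb{X}^T\mathbb{X})^{-1}$ and the residuals are $\widehat\varepsilon_i=Y_i-\hat\beta X_i$, $i=1,\ldots,n$. Let $\widehat F_n$ be the empirical distribution of the residuals centered at their mean, i.e. the uniform distribution on $\widehat\varepsilon_i-n^{-1}\sum_{j=1}^n\widehat\varepsilon_j$, $i=1,\ldots,n$. Residual bootstrap: conditionally on $Y_1,\ldots,Y_n$, let $\varepsilon^{*}\in\mathbb{R}^{n\times r}$ be a random matrix whose rows are independent with common distribution $\widehat F_n$. Put $\mathbb{Y}^{*}=\mathbb{X}\hat\beta^T+\varepsilon^{*}$ and $\hat\beta^{*}=\mathbb{Y}^{*T}\mathbb{X}(\mathbb{X}^T\mathbb{X})^{-1}$. Let $\widehat\varepsilon^{*}=\mathbb{Y}^{*}-\mathbb{X}\hat\beta^{*T}$, with rows $\widehat\varepsilon_i^{*T}$, and $$\widehat\Sigma^{*}=n^{-1}\sum_{i=1}^n\widehat\varepsilon_i^{*}\widehat\varepsilon_i^{*T}-\Big(n^{-1}\sum_{i=1}^n\widehat\varepsilon_i^{*}\Big)\Big(n^{-1}\sum_{i=1}^n\widehat\varepsilon_i^{*}\Big)^T.$$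 ''Conditional on almost all sample paths'' means: for almost every realization of the sequence $(Y_i)_{i\ge1}$, the conditional laws given $Y_1,\ldots,Y_n$ of the bootstrap quantities converge as stated (weakly, or in conditional probability). In (c), $(\widehat\Sigma^{*})^{-1/2}$ may be defined arbitrarily when $\widehat\Sigma^{*}$ is singular. *)

(* Defs.v *)
From HB Require Import structures.
From mathcomp Require Import all_boot all_order all_algebra.
From mathcomp Require Import all_classical all_reals all_analysis.
From mathcomp Require Import measurable_realfun mxtens.

Set Implicit Arguments.
Unset Strict Implicit.
Unset Printing Implicit Defensive.

Import Order.TTheory GRing.Theory Num.Theory.
Import numFieldNormedType.Exports.

Local Open Scope classical_set_scope.
Local Open Scope ring_scope.

Definition measure_matrix_display : measure_display.
Proof. exact: default_measure_display. Qed.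

(* 'M[R]_(m, n) carries the sigma-algebra generated by the entries; this is the
   Borel sigma-algebra of R^(m * n). *)
Section measurable_matrix.
Context {R : realType} (m n : nat).

Definition mx_cylinders : set (set 'M[R]_(m, n)) :=
  [set A | exists i j (B : set R),
     measurable B /\ A = [set M : 'M[R]_(m, n) | B (M i j)]].

Let mx_set0 : <<s mx_cylinders >> set0.
Proof. exact: sigma_algebra0. Qed.

Let mx_setC A : <<s mx_cylinders >> A -> <<s mx_cylinders >> (~` A).
Proof. exact: sigma_algebraC. Qed.

Let mx_bigcup (F : (set 'M[R]_(m, n))^nat) :
  (forall i, <<s mx_cylinders >> (F i)) -> <<s mx_cylinders >> (\bigcup_i F i).
Proof. exact: sigma_algebra_bigcup. Qed.

HB.instance Definition _ :=
  @isMeasurable.Build measure_matrix_display 'M[R]_(m, n)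
    <<s mx_cylinders >> mx_set0 mx_setC mx_bigcup.

End measurable_matrix.

Section measurable_matrix_theory.
Context {R : realType} (m n : nat).

Lemma measurable_entry (i : 'I_m) (j : 'I_n) :
  measurable_fun [set: 'M[R]_(m, n)] (fun M : 'M[R]_(m, n) => M i j).
Proof.
move=> _ B mB; rewrite setTI; apply: sub_sigma_algebra.
by exists i, j, B.
Qed.

Lemma measurable_fun_mx d (T : measurableType d) (f : T -> 'M[R]_(m, n)) :
  (forall i j, measurable_fun [set: T] (fun t => f t i j)) ->
  measurable_fun [set: T] f.
Proof.
move=> mf; apply: (@measurability _ _ _ _ _ _ (@mx_cylinders R m n)) => //.
move=> _ [_ [i [j [B [mB ->]]]] <-].
exact: mf.
Qed.

End measurable_matrix_theory.

Section matrices.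
Context {R : realType}.

Definition posdef n (A : 'M[R]_n) :=
  A^T = A /\ forall v : 'cV[R]_n, v != 0 -> 0 < (v^T *m A *m v) ord0 ord0.

Definition possemidef n (A : 'M[R]_n) :=
  A^T = A /\ forall v : 'cV[R]_n, 0 <= (v^T *m A *m v) ord0 ord0.

(* A^{1/2}: the symmetric positive semidefinite B with B *m B = A (0 if there is
   none, that is, if A is not positive semidefinite). *)
Definition sqrtmx n (A : 'M[R]_n) : 'M[R]_n :=
  xget 0 [set B | possemidef B /\ B *m B = A].

(* mxvec lists a matrix row by row, so transposing first stacks the columns. *)
Definition vec m n (A : 'M[R]_(m, n)) : 'cV[R]_(n * m) := (mxvec A^T)^T.

Definition stack k (u : nat -> 'cV[R]_k) n : 'M[R]_(n, k) :=
  \matrix_(i < n, j < k) u i j ord0.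

End matrices.

Section probability.
Context {R : realType}.

Definition independent_family d (T : measurableType d) (P : probability T R)
    (I : eqType) d' (T' : measurableType d') (X : I -> T -> T') :=
  forall (J : seq I) (B : I -> set T'), uniq J ->
    (forall i, measurable (B i)) ->
    P (\bigcap_(i in [set` J]) X i @^-1` B i) =
    (\prod_(i <- J) P (X i @^-1` B i))%E.

Definition iid d (T : measurableType d) (P : probability T R)
    (I : eqType) d' (T' : measurableType d') (X : I -> T -> T')
    (F : set T' -> \bar R) :=
  [/\ forall i, measurable_fun [set: T] (X i),
      independent_family P X &
      forall i (B : set T'), measurable B -> P (X i @^-1` B) = F B].

Definition cvg_in_distribution (d : nat -> measure_display)
    (T : forall n, measurableType (d n)) (P : forall n, probability (T n) R)
    k (Z : forall n, T n -> 'cV[R]_k) (mu : probability 'cV[R]_k R) :=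
  forall f : 'cV[R]_k -> R, continuous f -> bounded_fun f ->
    (fun n => 'E_(P n)[fun t => f (Z n t)])%E @ \oo --> 'E_mu[f]%E.

Definition cvg_in_probability (d : nat -> measure_display)
    (T : forall n, measurableType (d n)) (P : forall n, probability (T n) R)
    k l (Z : forall n, T n -> 'M[R]_(k, l)) (C : 'M[R]_(k, l)) :=
  forall e : R, 0 < e ->
    (fun n => P n [set t | e <= `|Z n t - C|]) @ \oo --> 0%E.

End probability.

Section normal.
Context {R : realType}.

Definition cons_cV k (x : measurableTypeR R * 'cV[R]_k) : 'cV[R]_k.+1 :=
  col_mx (x.1)%:M x.2.

Lemma measurable_cons_cV k : measurable_fun setT (@cons_cV k).
Proof.
apply: measurable_fun_mx => i j; rewrite /cons_cV.
case: (@splitP 1 k i) => a ia.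
  rewrite (_ : (fun _ => _) = fst); first exact: measurable_fst.
  apply/funext => x; have -> : i = lshift k a by exact: val_inj.
  by apply: etrans (col_mxEu _ _ _ _) _; rewrite mxE !ord1 eqxx mulr1n.
rewrite (_ : (fun _ => _) = (fun x : measurableTypeR R * 'cV[R]_k => x.2 a j)).
  exact: (measurableT_comp (measurable_entry _ _) measurable_snd).
apply/funext => x; have -> : i = rshift 1 a by exact: val_inj.
exact: col_mxEd.
Qed.

HB.instance Definition _ k :=
  isMeasurableFun.Build _ _ _ _ (@cons_cV k) (@measurable_cons_cV k).

(* Law of a vector of k independent N(0, 1) variables: the k-fold product of
   normal_prob 0 1. *)
Fixpoint std_normal k : probability 'cV[R]_k R :=
  match k with
  | 0 => \d_(0 : 'cV[R]_0)
  | k.+1 => distribution (normal_prob (0 : R) 1 \x std_normal k)%E (@cons_cV k)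
  end.

Definition affine_sqrt k (m : 'cV[R]_k) (V : 'M[R]_k) (z : 'cV[R]_k) :=
  m + sqrtmx V *m z.

Lemma measurable_affine_sqrt k m V : measurable_fun setT (@affine_sqrt k m V).
Proof.
apply: measurable_fun_mx => i j; rewrite /affine_sqrt.
under eq_fun do rewrite !mxE.
apply: measurable_funD => //.
elim: (index_enum _) => [|l s ih].
  by under eq_fun do rewrite big_nil; exact: measurable_cst.
under eq_fun do rewrite big_cons; apply: measurable_funD => //.
by apply: measurable_funM => //; exact: measurable_entry.
Qed.

HB.instance Definition _ k m V :=
  isMeasurableFun.Build _ _ _ _ (@affine_sqrt k m V)
    (@measurable_affine_sqrt k m V).

(* N(m, V): the law of m + V^{1/2} z with z standard normal. *)
Definition mvnormal k (m : 'cV[R]_k) (V : 'M[R]_k) : probability 'cV[R]_k R :=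
  distribution (std_normal k) (affine_sqrt m V).

End normal.

(* Here X is the design matrix and Y the response matrix; observations and
   residuals are the rows of n-row matrices. *)
Section regression.
Context {R : realType} (n r p : nat).
Implicit Types (X : 'M[R]_(n, p)) (Y E : 'M[R]_(n, r)) (b : 'M[R]_(r, p)).

Definition ols X Y : 'M[R]_(r, p) := Y^T *m X *m invmx (X^T *m X).

Definition residuals X Y : 'M[R]_(n, r) := Y - X *m (ols X Y)^T.

Definition obs E (i : 'I_n) : 'cV[R]_r := (row i E)^T.

Definition mean_obs E : 'cV[R]_r := n%:R^-1 *: \sum_(i < n) obs E i.

Definition cov_obs E : 'M[R]_r :=
  n%:R^-1 *: \sum_(i < n) obs E i *m (obs E i)^T
  - mean_obs E *m (mean_obs E)^T.

Definition empirical_centered E (A : set 'cV[R]_r) : \bar R :=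
  ((n%:R^-1)%:E * \sum_(i < n) \d_(obs E i - mean_obs E)%R A)%E.

Definition boot_response X Y E : 'M[R]_(n, r) := X *m (ols X Y)^T + E.

Definition boot_ols X Y E : 'M[R]_(r, p) := ols X (boot_response X Y E).

Definition boot_cov X Y E : 'M[R]_r :=
  cov_obs (residuals X (boot_response X Y E)).

End regression.

(* Main.v *)
(* Fix a path of the errors. The strong law (second moments along the squares, then
   interpolation) gives averages of eps, X eps and eps eps^T, and small truncated second
   moments; hence the centered residuals have empirical covariance tending to Sigma and
   satisfy a Lindeberg condition. Bootstrap expectations reduce to sums over resampling
   maps s : {ffun 'I_n -> 'I_n}, and sqrt n (betahat* - betahat) becomes a sum of
   independent terms whose cosine transforms converge to the Gaussian ones by Lindeberg's
   estimate. Levy continuity is proved by approximating bounded continuous functions by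
   trigonometric polynomials on large cubes. Chebyshev's inequality gives Sigmahat* ->
   Sigma, and (c) follows by Slutsky's argument and continuity of the matrix square root. *)

Require Import Defs.
From mathcomp Require Import spectral complex mxred.
From mathcomp Require Import all_boot all_order all_algebra.
From mathcomp Require Import all_classical all_reals all_analysis.
From mathcomp Require Import measurable_realfun mxtens ring lra.

Set Implicit Arguments.
Unset Strict Implicit.
Unset Printing Implicit Defensive.

Import Order.TTheory GRing.Theory Num.Theory.
Import numFieldNormedType.Exports.

Local Open Scope classical_set_scope.
Local Open Scope ring_scope.

(** * Cosine transform of the normal law *)

(** The conclusion must hold on one almost sure event for every choice of bootstrap probability
    spaces. The randomness of the errors is therefore confined to a few limits of averages, and
    everything after them is deterministic in the path. A bootstrap space enters only through a
    finite sum of products of uniform weights. Characteristic functions appear as the real functions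
    cos (th + t.x) with arbitrary phase th: the phase carries the sine part, the span of these
    functions is closed under products, and the phase absorbs one coordinate at a time in
    inductions. The fourth moments are spent on square integrability of products of two error
    coordinates, which makes a second-moment strong law sufficient. The design need not contain an
    intercept, so residual means do not vanish; the mean of the design is only bounded, but it is
    multiplied by an estimation error that tends to zero. Studentization needs continuity of the
    matrix square root only at a positive definite limit, which a Lipschitz bound provides. *)

Section normal_integrals.
Context {R : realType}.
Local Notation mu := (@lebesgue_measure R).
Local Notation p := (normal_pdf (0 : R) 1).

(** The Radon-Nikodym derivative agrees almost everywhere with [normal_pdf], because both integrate
    to [normal_prob] on every measurable set. *)
Lemma integral_normal_prob (f : R -> \bar R) :
  measurable_fun setT f ->
  (\int[normal_prob (0 : R) 1]_x `|f x| < +oo)%E ->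
  (\int[normal_prob (0 : R) 1]_x f x = \int[mu]_x (f x * (p x)%:E))%E.
Proof.
move=> mf finf.
have dom := @normal_prob_dominates R 0 1.
rewrite -(Radon_Nikodym_change_of_variables dom)//=; last first.
  by apply/integrableP; split.
apply: ae_eq_integral => //.
- by apply: emeasurable_funM => //; apply: (measurable_int mu).
- apply: emeasurable_funM => //=; apply/measurableT_comp => //=.
  exact: measurable_normal_pdf.
- apply: ae_eqe_mul2l => /=.
  rewrite Radon_NikodymE//=.
  case: cid => /= h [h1 h2 h3].
  apply: integral_ae_eq => //=.
  + by apply/measurableT_comp =>//; exact: measurable_normal_pdf.
  + by move=> E E01 mE; rewrite -h3.
Qed.

Lemma normal_pdf01E (x : R) : p x = normal_peak 1 * expR (- (x * x) / 2).
Proof.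
by rewrite normal_pdfE ?oner_neq0// /normal_fun subr0 expr1n expr2.
Qed.

Lemma is_derive_normal_pdf (x : R) : is_derive x 1 p (- x * p x).
Proof.
have -> : p = (cst (normal_peak 1) * (expR \o (cst (- 2^-1) * (id * id))))%R.
  apply/funext => y; rewrite normal_pdf01E !fctE /=.
  by congr (_ * expR _); field.
apply: is_derive_eq.
by rewrite !fctE /= /GRing.scale /=; field.
Qed.

Lemma cvg_integral_itv_nat (f : R -> R) : mu.-integrable setT (EFin \o f) ->
  (\int[mu]_(x in `[(- n%:R)%R, n%:R%R]) (f x)%:E)%E @[n --> \oo] -->
  (\int[mu]_x (f x)%:E)%E.
Proof.
move=> fi; have mf := measurable_int _ fi.
pose f_ n := (EFin \o f) \_ `[- n%:R : R, n%:R]%classic.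
have [] := @dominated_convergence _ _ _ mu setT measurableT f_ (EFin \o f)
  (abse \o (EFin \o f)).
- move=> n; apply/(measurable_restrictT _ _).1 => //; exact: measurable_funTS.
- exact: mf.
- apply: aeW => x _; apply: cvg_near_cst; near=> n.
  rewrite /f_ patchE mem_set//= in_itv/= -ler_norml.
  by near: n; exact: nbhs_infty_ger.
- exact: integrable_abse.
- apply: aeW => x n _; rewrite /f_ patchE; case: ifP => //= _.
  by rewrite normr0 lee_fin.
move=> _ _; apply: cvg_trans; apply: near_eq_cvg; near=> n.
by rewrite integral_mkcond.
Unshelve. all: by end_near. Qed.

(** Since |x| <= 1 + x^2/4 <= exp (x^2/4), a factor |x| is paid for by passing from variance 1 to
    variance 2. This yields an integrable majorant without computing a moment. *)
Lemma normal_pdf_dominated (x : R) : `|x| * p x <=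
  normal_peak 1 / normal_peak (Num.sqrt 2) * normal_pdf 0 (Num.sqrt 2) x.
Proof.
have s2 : Num.sqrt 2 != 0 :> R by rewrite gt_eqF// sqrtr_gt0.
rewrite normal_pdf01E normal_pdfE// mulrA divfK ?gt_eqF ?normal_peak_gt0//.
rewrite mulrCA ler_wpM2l ?normal_peak_ge0// /normal_fun subr0 sqr_sqrtr//.
have -> : - x ^+ 2 / (2 *+ 2) = - (x * x) / 2 + x ^+ 2 / 4 by field.
rewrite expRD mulrC ler_wpM2l ?expR_ge0//.
apply: le_trans (expR_ge1Dx _).
rewrite -(real_normK (num_real x)); have := sqr_ge0 (`|x| / 2 - 1); nra.
Qed.

Lemma integrable_bounded_mul_pdf (c : R) (f : R -> R) : measurable_fun setT f ->
  (forall x, `|f x| <= c * (1 + `|x|)) ->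
  mu.-integrable setT (fun x => (f x * p x)%:E).
Proof.
move=> mf fb.
pose G x := (c * p x) + c * (normal_peak 1 / normal_peak (Num.sqrt 2) *
  normal_pdf 0 (Num.sqrt 2) x).
have iG : mu.-integrable setT (EFin \o G).
  rewrite /G /comp; under eq_fun do rewrite EFinD !EFinM.
  apply: integrableD => //; apply: integrableZl => //.
    exact: integrable_normal_pdf.
  by rewrite -EFinM; apply: integrableZl => //; exact: integrable_normal_pdf.
apply: le_integrable iG => //.
  apply/measurable_EFinP/measurable_funM => //; exact: measurable_normal_pdf.
have c0 : 0 <= c.
  by have := fb 0; rewrite normr0 addr0 mulr1; apply: le_trans.
move=> x _; rewrite lee_fin /=.
rewrite [leRHS]ger0_norm; last first.
  rewrite addr_ge0// !mulr_ge0// ?normal_pdf_ge0 ?normal_peak_ge0//.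
  by rewrite invr_ge0 normal_peak_ge0.
rewrite normrM (ger0_norm (normal_pdf_ge0 _ _ _)).
apply: (@le_trans _ _ (c * (1 + `|x|) * p x)).
  by rewrite ler_wpM2r// normal_pdf_ge0.
by rewrite mulrDr mulr1 mulrDl lerD2l -mulrA ler_wpM2l// normal_pdf_dominated.
Qed.

Lemma measurable_cos_lin (th s : R) :
  measurable_fun [set: R] (fun x => cos (th + s * x)).
Proof.
apply: (measurableT_comp (continuous_measurable_fun (@continuous_cos R))).
by apply: measurable_funD => //; exact: measurable_funM.
Qed.

Lemma measurable_sin_lin (th s : R) :
  measurable_fun [set: R] (fun x => sin (th + s * x)).
Proof.
apply: (measurableT_comp (continuous_measurable_fun (@continuous_sin R))).
by apply: measurable_funD => //; exact: measurable_funM.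
Qed.

Lemma integrable_cos_pdf (th s : R) :
  mu.-integrable setT (EFin \o (fun x => cos (th + s * x) * p x)).
Proof.
apply: (@integrable_bounded_mul_pdf 1); first exact: measurable_cos_lin.
by move=> x; rewrite mul1r (le_trans (cos_max _))// lerDl.
Qed.

Lemma integrable_id_sin_pdf (th s : R) :
  mu.-integrable setT (EFin \o (fun x => x * sin (th + s * x) * p x)).
Proof.
apply: (@integrable_bounded_mul_pdf 1).
  by apply: measurable_funM => //; exact: measurable_sin_lin.
move=> x; rewrite mul1r normrM (le_trans (ler_piMr _ (sin_max _)))//.
by rewrite lerDr.
Qed.

Lemma is_derive_affine (a b x : R) : is_derive x 1 (cst a + cst b * id)%R b.
Proof.
apply: (is_derive_eq (is_deriveD (is_derive_cst a x 1)
  (is_deriveM (is_derive_cst b x 1) (is_derive_id x 1)))).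
by rewrite /GRing.scale /= mulr1 mulr0 addr0 add0r.
Qed.

Lemma is_derive_cos_affine (a b x : R) :
  is_derive x 1 (fun x => cos (a + b * x)) (- sin (a + b * x) * b).
Proof. exact: (is_derive1_comp (is_derive_cos _) (is_derive_affine a b x)). Qed.

Lemma is_derive_sin_affine (a b x : R) :
  is_derive x 1 (fun x => sin (a + b * x)) (cos (a + b * x) * b).
Proof. exact: (is_derive1_comp (is_derive_sin _) (is_derive_affine a b x)). Qed.

Lemma is_derive_cos_pdf (th s x : R) :
  is_derive s 1 (fun s => cos (th + s * x) * p x)
    (- (x * sin (th + s * x) * p x)).
Proof.
under eq_fun do rewrite [_ * x]mulrC.
apply: (is_derive_eq (is_deriveM (is_derive_cos_affine th x s)
  (is_derive_cst (p x) s 1))).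
by rewrite /GRing.scale /= mulr0 add0r [s * x]mulrC; ring.
Qed.

(** The derivative in [s] is at most |x| p(x) for every [s], so [normal_pdf_dominated] permits
    differentiation under the integral. *)
Lemma is_derive_normal_cos (th s : R) :
  is_derive s (1 : R) (fun s => \int[mu]_x (cos (th + s * x) * p x))
    (- \int[mu]_x (x * sin (th + s * x) * p x)).
Proof.
pose g s x := cos (th + s * x) * p x.
have d1E s' x : partial1of2 g s' x = - (x * sin (th + s' * x) * p x).
  by rewrite partial1of2E; have [_ ->] := is_derive_cos_pdf th s' x.
have h1 : `](s - 1), (s + 1)[%classic s.
  by rewrite /= in_itv /=; apply/andP; split; lra.
pose G x : R := normal_peak 1 / normal_peak (Num.sqrt 2) *
  normal_pdf 0 (Num.sqrt 2) x.
have G0 x : 0 <= G x.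
  by rewrite !mulr_ge0 ?normal_pdf_ge0 ?normal_peak_ge0// invr_ge0 normal_peak_ge0.
have iG : mu.-integrable setT (EFin \o G).
  rewrite /G /comp; under eq_fun do rewrite EFinM.
  by apply: integrableZl => //; exact: integrable_normal_pdf.
have der1 x y : `](s - 1), (s + 1)[%classic x -> setT y ->
    derivable (g^~ y) x 1 by move=> _ _; case: (is_derive_cos_pdf th x y).
have Gub x y : `](s - 1), (s + 1)[%classic x -> setT y ->
    `|partial1of2 g x y| <= G y.
  move=> _ _; rewrite d1E normrN !normrM (ger0_norm (normal_pdf_ge0 _ _ _)).
  apply: le_trans (normal_pdf_dominated y).
  by rewrite ler_wpM2r ?normal_pdf_ge0// ler_piMr// sin_max.
have int1 x : `](s - 1), (s + 1)[%classic x -> mu.-integrable setT (EFin \o g x).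
  by move=> _; exact: integrable_cos_pdf.
apply: DeriveDef.
  exact: (derivable_under_integral measurableT h1 int1 der1 G0 iG Gub).
rewrite -derive1E.
rewrite (differentiation_under_integral measurableT h1 int1 der1 G0 iG Gub).
rewrite -mulN1r -RintegralZl//; last exact: integrable_id_sin_pdf.
by apply: eq_Rintegral => x _; rewrite mulN1r; exact: d1E.
Qed.

Lemma normal_pdf_cvg0 : p n%:R @[n --> \oo] --> (0 : R).
Proof.
have h : (normal_peak 1 / normal_peak (Num.sqrt 2) * normal_peak (Num.sqrt 2)) *
   n%:R^-1 @[n --> \oo] --> (0 : R).
  by rewrite -[X in _ --> X](mulr0 (normal_peak 1 / normal_peak (Num.sqrt 2) *
    normal_peak (Num.sqrt 2))); apply: cvgM; [exact: cvg_cst|];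
    apply/gtr0_cvgV0; [near=> n; rewrite ltr0n; near: n; exact: nbhs_infty_gt
    | exact: cvgr_idn].
apply: (squeeze_cvgr _ (cvg_cst (0 : R)) h).
near=> n.
have n0 : (0 < n)%N by near: n; exact: nbhs_infty_gt.
rewrite normal_pdf_ge0/= ler_pdivlMr ?ltr0n// mulrC.
rewrite -{1}(ger0_norm (ler0n R n)); apply: le_trans (normal_pdf_dominated _) _.
rewrite ler_wpM2l//; last by rewrite normal_pdf_ub// gt_eqF// sqrtr_gt0.
by rewrite divr_ge0// normal_peak_ge0.
Unshelve. all: by end_near. Qed.

(** Integration by parts: [f] is the derivative of [F], so its integral over [-n, n] is a boundary
    term of size at most 2 p(n), which vanishes. *)
Lemma stein_sin (th s : R) : \int[mu]_x (x * sin (th + s * x) * p x) =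
  s * \int[mu]_x (cos (th + s * x) * p x).
Proof.
pose F x := sin (th + s * x) * p x.
pose f x := s * (cos (th + s * x) * p x) - x * sin (th + s * x) * p x.
have dF (x : R) : is_derive x 1 F (f x).
  apply: (is_derive_eq (is_deriveM (is_derive_sin_affine th s x)
    (is_derive_normal_pdf x))).
  by rewrite /GRing.scale /= /f; ring.
have if1 : mu.-integrable setT (EFin \o (fun x => s * (cos (th + s * x) * p x))).
  rewrite /comp; under eq_fun do rewrite EFinM.
  by apply: integrableZl => //; exact: integrable_cos_pdf.
have if_ : mu.-integrable setT (EFin \o f).
  rewrite /f /comp; under eq_fun do rewrite EFinB.
  by apply: integrableB => //; exact: integrable_id_sin_pdf.
rewrite -RintegralZl//; last exact: integrable_cos_pdf.
apply/esym/eqP; rewrite -subr_eq0 -RintegralB//; last exact: integrable_id_sin_pdf.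
rewrite -/f; apply/eqP.
have cf : continuous f.
  have cp : continuous p by apply: continuous_normal_pdf; rewrite oner_neq0.
  have cl x : {for x, continuous (fun x => th + s * x)}.
    by apply: cvgD; [exact: cvg_cst|apply: cvgM; [exact: cvg_cst|exact: cvg_id]].
  move=> x; apply: cvgB.
    apply: cvgM; [exact: cvg_cst|apply: cvgM; last exact: cp].
    by apply: continuous_comp; [exact: cl|exact: continuous_cos].
  apply: cvgM; last exact: cp.
  apply: cvgM; first exact: cvg_id.
  by apply: continuous_comp; [exact: cl|exact: continuous_sin].
have cF : continuous F.
  move=> x; apply/differentiable_continuous/derivable1_diffP.
  by have [] := dF x.
have FTC (n : nat) : (0 < n)%N ->
    (\int[mu]_(x in `[(- n%:R)%R, n%:R%R]) (f x)%:E =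
     (F n%:R)%:E - (F (- n%:R))%:E)%E.
  move=> n0; apply: continuous_FTC2.
  - by rewrite gtrN// ltr0n.
  - exact: continuous_subspaceT.
  - split=> [x _||]; first by have [] := dF x.
      by apply: cvg_at_right_filter; exact: cF.
    by apply: cvg_at_left_filter; exact: cF.
  - by move=> x _; rewrite derive1E; have [_ ->] := dF x.
have lim1 := cvg_integral_itv_nat if_.
have F0 : F n%:R - F (- n%:R) @[n --> \oo] --> (0 : R).
  have h : (2 * p n%:R) @[n --> \oo] --> (0 : R).
    by rewrite -[X in _ --> X](mulr0 2); apply: cvgM; [exact: cvg_cst|exact: normal_pdf_cvg0].
  apply: norm_cvg0; apply: (squeeze_cvgr _ (cvg_cst (0 : R)) h).
  near=> n; rewrite normr_ge0/= (le_trans (ler_normB _ _))//.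
  have pN : p (- n%:R) = p n%:R by rewrite !normal_pdf01E mulrNN.
  rewrite /F pN mulr2n mulrDl !mul1r !normrM (ger0_norm (normal_pdf_ge0 _ _ _)).
  by rewrite lerD// ler_piMl ?normal_pdf_ge0 ?sin_max.
have lim2 : (\int[mu]_(x in `[(- n%:R)%R, n%:R%R]) (f x)%:E)%E @[n --> \oo] --> 0%E.
  have : (F n%:R - F (- n%:R))%:E @[n --> \oo] --> 0%E by apply: cvg_EFin => //; exact: nearW.
  apply: cvg_trans; apply: near_eq_cvg; near=> n.
  by rewrite FTC// ?EFinB//; near: n; exact: nbhs_infty_gt.
by rewrite /Rintegral (cvg_unique _ lim1 lim2).
Unshelve. all: by end_near. Qed.

(** By [stein_sin] the transform solves phi' = - s phi, so phi exp (s^2/2) is constant and can be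
    read off at s = 0. *)
Lemma normal_cos (th s : R) :
  \int[mu]_x (cos (th + s * x) * p x) = cos th * expR (- (s * s) / 2).
Proof.
pose phi s := \int[mu]_x (cos (th + s * x) * p x).
pose psi s := phi s * expR (s * s / 2).
have dpsi s' : is_derive s' (1 : R) psi 0.
  have d1 : is_derive s' (1 : R) phi (- (s' * phi s')).
    by rewrite -stein_sin; exact: is_derive_normal_cos.
  have d2 : is_derive s' (1 : R) (expR \o (cst (2^-1) * (id * id)))%R
      (expR (s' * s' / 2) * s').
    apply: is_derive_eq.
    by rewrite !fctE /= /GRing.scale /= [2^-1 * _]mulrC; field.
  have -> : psi = (phi * (expR \o (cst (2^-1) * (id * id))))%R.
    by apply/funext => y; rewrite /psi !fctE/= [2^-1 * _]mulrC.
  apply: (is_derive_eq (is_deriveM d1 d2)).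
  by rewrite !fctE /= /GRing.scale /= [2^-1 * _]mulrC; ring.
have e0 : psi s = psi 0 by exact: is_derive_0_is_cst.
have p0 : psi 0 = cos th.
  rewrite /psi mul0r mul0r expR0 mulr1 /phi.
  under eq_Rintegral do rewrite mul0r addr0.
  rewrite RintegralZl//; last exact: integrable_normal_pdf.
  by rewrite /Rintegral integral_normal_pdf/= mulr1.
rewrite -p0 -e0 /psi -[phi s * _ * _]mulrA -expRD.
have -> : s * s / 2 + - (s * s) / 2 = 0 by field.
by rewrite expR0 mulr1.
Qed.

Lemma expectation_normal_cos (th s : R) :
  (\int[normal_prob (0 : R) 1]_x (cos (th + s * x))%:E =
   (cos th * expR (- (s * s) / 2))%:E)%E.
Proof.
rewrite integral_normal_prob.
- under eq_integral do rewrite -EFinM.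
  rewrite -normal_cos -[LHS]fineK//.
  by apply: integrable_fin_num => //; exact: integrable_cos_pdf.
- by apply/measurable_EFinP; exact: measurable_cos_lin.
- apply: (@le_lt_trans _ _ (\int[normal_prob (0 : R) 1]_x (cst 1 x))%E).
    apply: ge0_le_integral => //.
      by apply: measurableT_comp => //; apply/measurable_EFinP; exact: measurable_cos_lin.
    by move=> x _; rewrite lee_fin cos_max.
  rewrite integral_cst// mul1e.
  by rewrite -ge0_fin_numE//; exact: fin_num_measure.
Qed.

End normal_integrals.

Section gaussian_vectors.
Context {R : realType}.

Definition dotc k (t x : 'cV[R]_k) : R := \sum_i t i ord0 * x i ord0.

Lemma dotcE k (t x : 'cV[R]_k) : dotc t x = (t^T *m x) ord0 ord0.
Proof. by rewrite mxE; apply: eq_bigr => i _; rewrite mxE. Qed.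

Lemma measurable_dotc k (t : 'cV[R]_k) : measurable_fun setT (dotc t).
Proof.
apply: measurable_sum => i; apply: measurable_funM => //.
exact: measurable_entry.
Qed.

Lemma measurable_cos_dotc k (th : R) (t : 'cV[R]_k) :
  measurable_fun setT (fun x => cos (th + dotc t x)).
Proof.
apply: (measurableT_comp (continuous_measurable_fun (@continuous_cos R))).
by apply: measurable_funD => //; exact: measurable_dotc.
Qed.

Lemma bounded_integrable d (T : measurableType d) (P : probability T R)
  (f : T -> R) (c : R) : measurable_fun setT f -> (forall x, `|f x| <= c) ->
  P.-integrable setT (EFin \o f).
Proof.
move=> mf fb; apply: measurable_bounded_integrable => //.
  by rewrite -ge0_fin_numE//; exact: fin_num_measure.
exists c; split; first exact: num_real.
by move=> y cy x _ /=; exact: le_trans (fb _) (ltW cy).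
Qed.

(** Fubini splits off the first coordinate, and its contribution [t0 * x] joins the phase; this is
    why the induction must range over all [th]. *)
Lemma std_normal_cos k (th : R) (t : 'cV[R]_k) :
  (\int[@std_normal R k]_x (cos (th + dotc t x))%:E =
   (cos th * expR (- dotc t t / 2))%:E)%E.
Proof.
elim: k th t => [|k IH] th t.
  rewrite /= integral_dirac// ?diracT ?mul1e; last first.
    by apply/measurable_EFinP; exact: measurable_cos_dotc.
  by rewrite /dotc !big_ord0 oppr0 mul0r expR0 mulr1 addr0.
pose t0 := t ord0 ord0.
pose t1 : 'cV[R]_k := \col_i t (rshift 1 i) ord0.
have dotE x : dotc t (cons_cV x) = t0 * x.1 + dotc t1 x.2.
  rewrite /dotc big_ord_recl; congr (_ * _ + _).
    rewrite /cons_cV (_ : ord0 = lshift k (ord0 : 'I_1)); last exact: val_inj.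
    by apply: etrans (col_mxEu _ _ _ _) _; rewrite mxE !ord1 eqxx mulr1n.
  apply: eq_bigr => i _.
  rewrite (_ : lift ord0 i = rshift 1 i); last exact: val_inj.
  by rewrite -[RHS]/(t1 i ord0 * x.2 i ord0) [t1 _ _]mxE; congr (_ * _);
    exact: (etrans (col_mxEd _ _ _ _)).
have dottE : dotc t t = t0 * t0 + dotc t1 t1.
  rewrite /dotc big_ord_recl; congr (_ + _); apply: eq_bigr => i _.
  by rewrite mxE (_ : lift ord0 i = rshift 1 i)//; exact: val_inj.
have mc := measurable_cos_dotc th t.
have ic : (normal_prob 0 1 \x std_normal k)%E.-integrable setT
    (EFin \o (fun x => cos (th + dotc t (@cons_cV R k x)))).
  apply: (@bounded_integrable _ _ _ _ 1); last by move=> x; exact: cos_max.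
  exact: (measurableT_comp mc (@measurable_cons_cV R k)).
rewrite /= integral_distribution//; last exact/measurable_EFinP.
rewrite -integral12_prod_meas1//=.
transitivity (\int[normal_prob (0 : R) 1]_x
  ((cos (th + t0 * x))%:E * (expR (- dotc t1 t1 / 2))%:E))%E.
  apply: eq_integral => x _; rewrite -EFinM -IH /fubini_F/=.
  by apply: eq_integral => y _; rewrite dotE/= addrA.
rewrite integralZr//; last first.
  apply: (@bounded_integrable _ _ _ _ 1); last by move=> x; exact: cos_max.
  exact: measurable_cos_lin.
rewrite expectation_normal_cos -EFinM -mulrA -expRD dottE.
by congr (_ * expR _)%:E; field.
Qed.

Lemma dotcD k (t x y : 'cV[R]_k) : dotc t (x + y) = dotc t x + dotc t y.
Proof. by rewrite !dotcE mulmxDr mxE. Qed.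

Lemma dotc_mulmx k l (t : 'cV[R]_k) (A : 'M[R]_(k, l)) x :
  dotc t (A *m x) = dotc (A^T *m t) x.
Proof. by rewrite !dotcE trmx_mul trmxK mulmxA. Qed.

Lemma mvnormal_cos k (V : 'M[R]_k) (th : R) (t : 'cV[R]_k) :
  (sqrtmx V)^T = sqrtmx V -> sqrtmx V *m sqrtmx V = V ->
  (\int[mvnormal 0 V]_x (cos (th + dotc t x))%:E =
   (cos th * expR (- dotc t (V *m t) / 2))%:E)%E.
Proof.
move=> sV qV; have mc := measurable_cos_dotc th t.
rewrite integral_distribution//; first last.
- apply: (@bounded_integrable _ _ _ (fun x => cos (th + dotc t (affine_sqrt 0 V x))) 1).
    exact: (measurableT_comp mc (@measurable_affine_sqrt R k 0 V)).
  by move=> x; exact: cos_max.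
- exact/measurable_EFinP.
under eq_integral do rewrite /= /affine_sqrt add0r dotc_mulmx.
by rewrite std_normal_cos -dotc_mulmx sV mulmxA qV.
Qed.

End gaussian_vectors.

(** * Limits and square roots of matrices *)

Section cvg_matrix.
Context {R : realType}.

Lemma le_mx_norm m n (M : 'M[R]_(m, n)) i j : `|M i j| <= `|M|.
Proof.
rewrite [leRHS]/Num.norm/= mx_normrE.
by apply: (le_bigmax _ (fun ij => `|M ij.1 ij.2|) (i, j)).
Qed.

Lemma mx_norm_le m n (M : 'M[R]_(m, n)) (e : R) : 0 <= e ->
  (forall i j, `|M i j| <= e) -> `|M| <= e.
Proof.
move=> e0 h; rewrite [leLHS]/Num.norm/= mx_normrE.
by apply/bigmax_leP; split => // -[i j] _.
Qed.

Context {T : Type} {F : set_system T} {FF : Filter F}.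

Lemma cvg_mx m n (f : T -> 'M[R]_(m, n)) (C : 'M[R]_(m, n)) :
  (forall i j, f x i j @[x --> F] --> C i j) -> f x @[x --> F] --> C.
Proof.
move=> h; apply/cvgrPdist_le => /= e e0.
have : \forall x \near F, forall ij : 'I_m * 'I_n,
    `|C ij.1 ij.2 - f x ij.1 ij.2| <= e.
  by apply: filter_forall => -[i j]; have /cvgrPdist_le := h i j; exact.
apply: filterS => x hx; apply: mx_norm_le; first exact: ltW.
by move=> i j; have := hx (i, j); rewrite !mxE.
Qed.

Lemma cvg_mx_entry m n (f : T -> 'M[R]_(m, n)) (C : 'M[R]_(m, n)) i j :
  f x @[x --> F] --> C -> f x i j @[x --> F] --> C i j.
Proof. by move=> h; apply: (cvg_comp f (fun M : 'M[R]_(m, n) => M i j) h); exact: coord_continuous. Qed.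

Lemma cvg_sumr I (s : seq I) (P : pred I) (f : I -> T -> R) (l : I -> R) :
  (forall i, P i -> f i x @[x --> F] --> l i) ->
  \sum_(i <- s | P i) f i x @[x --> F] --> \sum_(i <- s | P i) l i.
Proof. by move=> h; apply: cvg_big => // -[x y]; exact: add_continuous. Qed.

Lemma cvg_prodr I (s : seq I) (P : pred I) (f : I -> T -> R) (l : I -> R) :
  (forall i, P i -> f i x @[x --> F] --> l i) ->
  \prod_(i <- s | P i) f i x @[x --> F] --> \prod_(i <- s | P i) l i.
Proof. by move=> h; apply: cvg_big => // -[x y]; exact: mul_continuous. Qed.

Lemma cvg_mulmx m n p (f : T -> 'M[R]_(m, n)) (g : T -> 'M[R]_(n, p))
    (A : 'M[R]_(m, n)) (B : 'M[R]_(n, p)) :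
  f x @[x --> F] --> A -> g x @[x --> F] --> B ->
  f x *m g x @[x --> F] --> A *m B.
Proof.
move=> fA gB; apply: cvg_mx => i j; under eq_fun do rewrite mxE.
rewrite mxE; apply: cvg_sumr => k _.
by apply: cvgM; exact: cvg_mx_entry.
Qed.

Lemma cvg_trmx m n (f : T -> 'M[R]_(m, n)) (A : 'M[R]_(m, n)) :
  f x @[x --> F] --> A -> (f x)^T @[x --> F] --> A^T.
Proof.
move=> fA; apply: cvg_mx => i j; under eq_fun do rewrite mxE.
by rewrite mxE; exact: cvg_mx_entry.
Qed.

Lemma cvg_tensmx m n p q (f : T -> 'M[R]_(m, n)) (g : T -> 'M[R]_(p, q))
    (A : 'M[R]_(m, n)) (B : 'M[R]_(p, q)) :
  f x @[x --> F] --> A -> g x @[x --> F] --> B ->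
  f x *t g x @[x --> F] --> A *t B.
Proof.
move=> fA gB; apply: cvg_mx => i j; under eq_fun do rewrite mxE.
by rewrite mxE; apply: cvgM; exact: cvg_mx_entry.
Qed.

Lemma cvg_det n (f : T -> 'M[R]_n) (A : 'M[R]_n) :
  f x @[x --> F] --> A -> \det (f x) @[x --> F] --> \det A.
Proof.
move=> fA; apply: cvg_sumr => s _; apply: cvgM; first exact: cvg_cst.
by apply: cvg_prodr => i _; exact: cvg_mx_entry.
Qed.

Lemma cvg_adj n (f : T -> 'M[R]_n) (A : 'M[R]_n) :
  f x @[x --> F] --> A -> \adj (f x) @[x --> F] --> \adj A.
Proof.
move=> fA; apply: cvg_mx => i j; under eq_fun do rewrite mxE.
rewrite mxE; apply: cvgM; first exact: cvg_cst.
apply: cvg_det; apply: cvg_mx => k l; under eq_fun do rewrite !mxE.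
by rewrite !mxE; exact: cvg_mx_entry.
Qed.

Lemma near_unitmx n (f : T -> 'M[R]_n) (A : 'M[R]_n) : f x @[x --> F] --> A ->
  A \in unitmx -> \forall x \near F, f x \in unitmx.
Proof.
move=> fA; rewrite unitmxE unitfE => dA.
have := cvg_det fA => /cvgrPdist_lt /(_ `|\det A|).
rewrite normr_gt0 => /(_ dA); apply: filterS => x h.
rewrite unitmxE unitfE; apply: contraTneq h => ->.
by rewrite subr0 ltxx.
Qed.

(** Cramer's rule: adjugate and determinant are polynomial in the entries, and near the limit
    [invmx] takes its invertible branch. *)
Lemma cvg_invmx n (f : T -> 'M[R]_n) (A : 'M[R]_n) : f x @[x --> F] --> A ->
  A \in unitmx -> invmx (f x) @[x --> F] --> invmx A.
Proof.
move=> fA uA.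
have : (\det (f x))^-1 *: \adj (f x) @[x --> F] --> (\det A)^-1 *: \adj A.
  apply: cvgZ; last exact: cvg_adj.
  apply: cvgV; last exact: cvg_det.
  by move: uA; rewrite unitmxE unitfE.
rewrite /invmx uA; apply: cvg_trans; apply: near_eq_cvg.
by have := near_unitmx fA uA; apply: filterS => x ->.
Qed.

End cvg_matrix.

(** * Square roots of positive semidefinite matrices *)

Section matrix_sqrt.
Context {R : realType}.

(** The spectral theorem over R[i] gives a unitary diagonalization with real eigenvalues, and
    [real_similar] brings the similarity down to R. The price is that [Q] is only known to be
    invertible, not orthogonal. *)
Lemma symmetric_diagonalizable n (A : 'M[R]_n) : A^T = A ->
  exists Q d, Q \in unitmx /\ Q *m A = diag_mx d *m Q.
Proof.
move=> sA; pose toC m1 m2 := @map_mx _ _ (real_complex R) m1 m2.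
have rC m1 m2 (M : 'M[R]_(m1, m2)) : toC _ _ M \is a mxOver Num.real.
  by apply/mxOverP => i j; rewrite mxE; apply/complex_realP; eexists.
pose A' : 'M[R[i]]_n := toC _ _ A.
have sA' : A' \is symmetricmx.
  apply/is_hermitianmxP; rewrite expr0 scale1r map_mx_id//.
  by rewrite /A' /toC map_trmx sA.
have hA' : A' \is hermsymmx by apply: realsym_hermsym => //; exact: rC.
pose P := spectralmx A'; pose d' := spectral_diag A'.
have dE : P *m A' = diag_mx d' *m P.
  have /orthomx_spectralP := hermitian_normalmx hA'.
  by move=> {1}->; rewrite !mulmxA mulmxV ?mul1mx// spectral_unit.
have rd : d' \is a mxOver Num.real := hermitian_spectral_diag_real hA'.
have rD : diag_mx d' \is a mxOver Num.real.
  apply/mxOverP => i j; rewrite mxE; case: eqP => _.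
    by rewrite mulr1n; exact: (mxOverP rd).
  by rewrite mulr0n.
have [] := @real_similar _ _ A' (diag_mx d') _ (rC _ _ _) rD.
  exists P; first exact: spectral_unit.
  by apply/similarP => //; exact: spectral_unit.
move=> Q' /andP[rQ uQ] /(similarP uQ) QE.
have RK m1 m2 (M : 'M[R[i]]_(m1, m2)) : M \is a mxOver Num.real ->
    toC _ _ (map_mx (@complex.Re R) M) = M.
  by move=> /mxOverP rM; apply/matrixP => i j; rewrite !mxE RRe_real.
exists (map_mx (@complex.Re R) Q'), (map_mx (@complex.Re R) d'); split.
  by rewrite -(map_unitmx (real_complex R)) [X in X \in _]RK.
suff h : toC _ _ (map_mx (@complex.Re R) Q' *m A) =
    toC _ _ (diag_mx (map_mx (@complex.Re R) d') *m map_mx (@complex.Re R) Q').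
  apply/matrixP => i j; apply: (@complexI R); move/matrixP: h => /(_ i j).
  by rewrite mxE [RHS]mxE.
rewrite /toC.
by rewrite !map_mxM map_diag_mx [map_mx _ (map_mx _ Q')]RK// [map_mx _ (map_mx _ d')]RK.
Qed.

Lemma mulmx_tr_ge0 n (v : 'cV[R]_n) : 0 <= (v^T *m v) ord0 ord0.
Proof. by rewrite mxE sumr_ge0// => i _; rewrite mxE -expr2 sqr_ge0. Qed.

Lemma mulmx_tr_gt0 n (v : 'cV[R]_n) : v != 0 -> 0 < (v^T *m v) ord0 ord0.
Proof.
move=> v0; rewrite lt_neqAle mulmx_tr_ge0 andbT eq_sym mxE.
apply: contra v0; rewrite psumr_eq0; last first.
  by move=> i _; rewrite mxE -expr2 sqr_ge0.
move=> /allP h; apply/eqP/matrixP => i j; rewrite ord1 mxE.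
have /(_ (mem_index_enum i)) := h i.
by rewrite mxE -expr2 sqrf_eq0 => /eqP.
Qed.

(** Orthogonality of [Q] is replaced by the Gram matrix G = Q Q^T. Symmetry of [A] makes G commute
    with [diag_mx d], so G_ij (d_i - d_j) = 0; hence G commutes with any function of [d] as well. *)
Lemma sym_diag_fun n (A Q : 'M[R]_n) (d : 'rV[R]_n) (f : R -> R) : A^T = A ->
  Q \in unitmx -> Q *m A = diag_mx d *m Q ->
  (invmx Q *m diag_mx (map_mx f d) *m Q)^T =
  invmx Q *m diag_mx (map_mx f d) *m Q.
Proof.
move=> sA uQ QA.
pose G := Q *m Q^T; have uQT : Q^T \in unitmx by rewrite unitmx_tr.
have GD : diag_mx d *m G = G *m diag_mx d.
  rewrite /G mulmxA -QA -(mulmxA Q A) -[A in LHS]sA -trmx_mul QA trmx_mul.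
  by rewrite tr_diag_mx mulmxA.
have GF : diag_mx (map_mx f d) *m G = G *m diag_mx (map_mx f d).
  apply/matrixP => i j; move/matrixP: GD => /(_ i j).
  rewrite !mul_diag_mx !mul_mx_diag !mxE.
  set g := \sum_(k < n) _ => /eqP; rewrite mulrC -subr_eq0 -mulrBr mulf_eq0.
  move=> /orP[/eqP ->|]; first by rewrite mulr0 mul0r.
  by rewrite subr_eq0 => /eqP ->; rewrite mulrC.
rewrite !trmx_mul tr_diag_mx trmx_inv.
apply: (can_inj (mulKmx uQ)); apply: (can_inj (mulmxK uQT)).
rewrite !mulmxA mulmxV// mul1mx -[in RHS]mulmxA -/G GF /G.
by rewrite mulmxKV.
Qed.

Lemma possemidef_sqrt_exists n (A : 'M[R]_n) : possemidef A ->
  exists B, possemidef B /\ B *m B = A.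
Proof.
move=> [sA pA]; have [Q [d [uQ QA]]] := symmetric_diagonalizable sA.
have AE : A = invmx Q *m diag_mx d *m Q by rewrite -mulmxA -QA mulKmx.
(* Row i of [Q] is a nonzero left eigenvector, and the quadratic form of [A] at it equals d_i times
   its squared length. *)
have d0 i : 0 <= d ord0 i.
  pose q := (row i Q)^T.
  have qA : q^T *m A = d ord0 i *: q^T.
    rewrite /q trmxK -row_mul QA; apply/rowP => j.
    by rewrite mxE mul_diag_mx !mxE.
  have q0 : q != 0.
    apply: contraTneq uQ => /(congr1 trmx); rewrite /q trmxK trmx0 => q0.
    apply/negP => uQ; have := congr1 (row i) (mulmxV uQ).
    rewrite row_mul q0 mul0mx => /rowP/(_ i); rewrite !mxE eqxx => /eqP.
    by rewrite eq_sym oner_eq0.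
  have := pA q; rewrite qA -scalemxAl mxE.
  by rewrite pmulr_lge0// mulmx_tr_gt0.
pose S f := invmx Q *m diag_mx (map_mx f d) *m Q.
have SM f g : S f *m S g = S (fun x => f x * g x).
  rewrite /S -!mulmxA (mulmxA Q) mulmxV// mul1mx !mulmxA; congr (_ *m _).
  rewrite -!mulmxA; congr (_ *m _); apply/matrixP => i j.
  by rewrite mul_diag_mx !mxE mulrnAr.
have sS f : (S f)^T = S f by exact: sym_diag_fun QA.
have SS f : (forall i, 0 <= f (d ord0 i)) ->
    S (fun x => Num.sqrt (f x)) *m S (fun x => Num.sqrt (f x)) = S f.
  move=> f0; rewrite SM /S; congr (_ *m diag_mx _ *m _); apply/rowP => i.
  by rewrite !mxE -expr2 sqr_sqrtr.
exists (S Num.sqrt); split; last first.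
  rewrite (SS id)// [RHS]AE /S; congr (_ *m diag_mx _ *m _).
  by apply/rowP => i; rewrite mxE.
(* The root is itself the square of a symmetric matrix, built from fourth roots of the eigenvalues,
   hence positive semidefinite. *)
split=> // v; rewrite -(SS Num.sqrt); last by move=> i; rewrite sqrtr_ge0.
set K := S _; have : 0 <= ((K *m v)^T *m (K *m v)) ord0 ord0 := mulmx_tr_ge0 _.
by rewrite trmx_mul sS !mulmxA.
Qed.

Lemma sqrtmxP n (A : 'M[R]_n) : possemidef A ->
  possemidef (sqrtmx A) /\ sqrtmx A *m sqrtmx A = A.
Proof.
move=> pA; rewrite /sqrtmx.
case: xgetP => [B -> //|h]; have [B hB] := possemidef_sqrt_exists pA.
by exfalso; apply: (h B).
Qed.

Lemma posdef_possemidef n (A : 'M[R]_n) : posdef A -> possemidef A.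
Proof.
move=> [sA pA]; split=> // v; have [->|v0] := eqVneq v 0.
  by rewrite mulmx0 mxE.
exact/ltW/pA.
Qed.

Lemma posdef_unitmx n (A : 'M[R]_n) : posdef A -> A \in unitmx.
Proof.
move=> [sA pA]; rewrite -row_free_unit -kermx_eq0; apply/negPn/negP => k0.
have /rowV0Pn[v vk v0] := k0.
have := pA v^T; rewrite trmxK (sub_kermxP vk) mul0mx mxE ltxx.
by rewrite trmx_eq0 v0 => /(_ isT).
Qed.

Lemma possemidef_unit_posdef n (A : 'M[R]_n) :
  possemidef A -> A \in unitmx -> posdef A.
Proof.
move=> pA uA; have [sA _] := pA; split=> // v v0.
have [[sB _] BB] := sqrtmxP pA.
have -> : (v^T *m A *m v) ord0 ord0 =
    ((sqrtmx A *m v)^T *m (sqrtmx A *m v)) ord0 ord0.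
  by rewrite trmx_mul sB -!mulmxA (mulmxA (sqrtmx A)) BB.
apply: mulmx_tr_gt0; apply: contra v0 => /eqP Bv.
by rewrite -(mulKmx uA v) -BB -mulmxA Bv !mulmx0.
Qed.

Lemma sqrtmx_unitmx n (A : 'M[R]_n) : posdef A -> sqrtmx A \in unitmx.
Proof.
move=> pA; have [_ BB] := sqrtmxP (posdef_possemidef pA).
by have := posdef_unitmx pA; rewrite -[in X in X -> _]BB unitmx_mul => /andP[].
Qed.

Lemma sqrtmx_posdef n (A : 'M[R]_n) : posdef A -> posdef (sqrtmx A).
Proof.
move=> pA; apply: possemidef_unit_posdef; last exact: sqrtmx_unitmx.
exact: (sqrtmxP (posdef_possemidef pA)).1.
Qed.

Lemma sum_mulmx_le n m (A : 'M[R]_(n, m)) (v : 'cV[R]_m) :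
  ((A *m v)^T *m (A *m v)) ord0 ord0 <=
  n%:R * (m%:R * `|A|) ^+ 2 * (v^T *m v) ord0 ord0.
Proof.
rewrite mxE -mulrA mulr_natl -[X in _ <= _ *+ X](card_ord n) -sumr_const.
apply: ler_sum => i _; rewrite mxE -expr2.
have v2 k : v k ord0 ^+ 2 <= (v^T *m v) ord0 ord0.
  rewrite mxE (bigD1 k)//= mxE -expr2 lerDl.
  by apply: sumr_ge0 => j _; rewrite mxE -expr2 sqr_ge0.
have vs k : `|v k ord0| <= Num.sqrt ((v^T *m v) ord0 ord0).
  by rewrite -sqrtr_sqr ler_wsqrtr.
have -> : (m%:R * `|A|) ^+ 2 * (v^T *m v) ord0 ord0 =
    (m%:R * `|A| * Num.sqrt ((v^T *m v) ord0 ord0)) ^+ 2.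
  by rewrite [RHS]exprMn sqr_sqrtr// mulmx_tr_ge0.
rewrite -real_normK ?num_real// lerXn2r ?nnegrE ?mulr_ge0 ?sqrtr_ge0//.
rewrite mxE (le_trans (ler_norm_sum _ _ _))//.
rewrite -mulrA mulr_natl -[X in _ <= _ *+ X](card_ord m) -sumr_const.
by apply: ler_sum => k _; rewrite normrM ler_pM// le_mx_norm.
Qed.

(** Writing v as A^(-1/2) A^(1/2) v bounds |v|^2 by [K] times the quadratic form. Taking [K + 1]
    keeps the constant meaningful when [K] is 0, as for n = 0. *)
Lemma posdef_lower_bound n (A : 'M[R]_n) : posdef A ->
  exists2 c : R, 0 < c & forall v : 'cV[R]_n,
    c * (v^T *m v) ord0 ord0 <= (v^T *m A *m v) ord0 ord0.
Proof.
move=> pA; have [[sB _] BB] := sqrtmxP (posdef_possemidef pA).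
pose K : R := n%:R * (n%:R * `|invmx (sqrtmx A)|) ^+ 2.
have K0 : 0 <= K by rewrite mulr_ge0// sqr_ge0.
exists (K + 1)^-1; first by rewrite invr_gt0 ltr_wpDl.
move=> v; rewrite ler_pdivrMl; last by rewrite ltr_wpDl.
have -> : (v^T *m A *m v) ord0 ord0 =
    ((sqrtmx A *m v)^T *m (sqrtmx A *m v)) ord0 ord0.
  by rewrite trmx_mul sB -!mulmxA (mulmxA (sqrtmx A)) BB.
rewrite -{1 2}(mulKmx (sqrtmx_unitmx pA) v).
apply: le_trans (sum_mulmx_le _ _) _.
by rewrite -/K ler_wpM2r ?mulmx_tr_ge0// lerDl.
Qed.

(* With D = B - C, the trace of D (B D + D C) = D (B^2 - C^2) is
   tr(D^T B D) + tr(D^T C D) >= c |D|^2. *)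
Lemma sqrt_lipschitz n (B C : 'M[R]_n) (c : R) : 0 < c ->
  possemidef B -> C^T = C ->
  (forall v : 'cV[R]_n, c * (v^T *m v) ord0 ord0 <= (v^T *m C *m v) ord0 ord0) ->
  `|B - C| <= c^-1 * (n * n)%:R * `|B *m B - C *m C|.
Proof.
move=> c0 [sB pB] sC pC; set D := B - C; set E := B *m B - C *m C.
have sD : D^T = D by rewrite /D linearB/= sB sC.
have DE : B *m D + D *m C = E.
  by rewrite /D /E mulmxBr mulmxBl addrA subrK.
clearbody D E.
have trq (M : 'M[R]_n) : \tr (D^T *m M *m D) =
    \sum_j ((col j D)^T *m M *m col j D) ord0 ord0.
  by apply: eq_bigr => j _; rewrite !mxE; apply: eq_bigr => k _; rewrite !mxE;
    congr (_ * _); apply: eq_bigr => l _; rewrite !mxE.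
have tr1 : \tr (D *m E) = \tr (D^T *m B *m D) + \tr (D^T *m C *m D).
  rewrite -DE mulmxDr linearD/= sD -!mulmxA; congr (_ + _).
  by rewrite mxtrace_mulC -mulmxA.
have trD i j : c * D i j ^+ 2 <= \tr (D *m E).
  rewrite tr1 -[leLHS]add0r lerD//.
    by rewrite trq sumr_ge0.
  rewrite trq (bigD1 j)//= -[leLHS]addr0 lerD//; last first.
    by apply: sumr_ge0 => k _; apply: le_trans (pC _);
      rewrite mulr_ge0 ?mulmx_tr_ge0// ltW.
  apply: le_trans (pC _); apply: ler_wpM2l; first exact: ltW.
  rewrite mxE (bigD1 i)//= !mxE -expr2 lerDl.
  by apply: sumr_ge0 => k _; rewrite !mxE -expr2 sqr_ge0.
have trE : \tr (D *m E) <= (n * n)%:R * (`|D| * `|E|).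
  rewrite (le_trans (ler_norm _))// (le_trans (ler_norm_sum _ _ _))//.
  rewrite natrM -mulrA mulr_natl -[X in _ <= _ *+ X](card_ord n) -sumr_const.
  apply: ler_sum => i _; rewrite mxE (le_trans (ler_norm_sum _ _ _))//.
  rewrite mulr_natl -[X in _ <= _ *+ X](card_ord n) -sumr_const.
  by apply: ler_sum => j _; rewrite normrM ler_pM// le_mx_norm.
have [D0|D0] := eqVneq `|D| 0.
  by rewrite D0 !mulr_ge0// invr_ge0 ltW.
have Dp : 0 < `|D| by rewrite lt_neqAle eq_sym D0/=.
have cD : c * `|D| ^+ 2 <= (n * n)%:R * (`|D| * `|E|).
  have [[i j]] := mx_norm_neq0 D0; rewrite -[mx_norm D]/(`|D|) => {1}->.
  by rewrite real_normK ?num_real// (le_trans (trD i j)).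
rewrite -mulrA ler_pdivlMl// -(ler_pM2r Dp) -mulrA -expr2.
by rewrite (le_trans cD)// mulrCA mulrC -mulrA.
Qed.

(** In [sqrt_lipschitz] the lower bound is demanded of one root only. It is taken for the limit, so
    the approximating matrices may be singular. *)
Lemma cvg_sqrtmx T (F : set_system T) (FF : Filter F) n (f : T -> 'M[R]_n)
    (A : 'M[R]_n) : posdef A -> (forall x, possemidef (f x)) ->
  f x @[x --> F] --> A -> sqrtmx (f x) @[x --> F] --> sqrtmx A.
Proof.
move=> pA pf fA.
have [c c0 hc] := posdef_lower_bound (sqrtmx_posdef pA).
have [[sA _] AA] := sqrtmxP (posdef_possemidef pA).
pose K : R := c^-1 * (n * n)%:R.
have h : K * `|f x - A| @[x --> F] --> (0 : R).
  rewrite -[X in _ --> X](mulr0 K); apply: cvgM; first exact: cvg_cst.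
  rewrite -(normr0 'M[R]_n); apply: cvg_norm; rewrite -(subrr A).
  by apply: cvgB => //; exact: cvg_cst.
apply/cvgrPdist_le => e e0; have /cvgrPdist_le/(_ _ e0) := h.
apply: filterS => x; rewrite sub0r normrN => hx.
rewrite distrC (le_trans _ (le_trans (ler_norm _) hx))//.
have [pS SS] := sqrtmxP (pf x).
by have := sqrt_lipschitz c0 pS sA hc; rewrite SS AA.
Qed.

(** The Lipschitz estimate between two roots of the same matrix has right-hand side zero. Hence the
    choice made by [xget] is immaterial here. *)
Lemma sqrtmx_unique n (A B : 'M[R]_n) : posdef A -> possemidef B ->
  B *m B = A -> sqrtmx A = B.
Proof.
move=> pA pB BB.
have [c c0 hc] := posdef_lower_bound (sqrtmx_posdef pA).
have [[sA _] AA] := sqrtmxP (posdef_possemidef pA).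
have := sqrt_lipschitz c0 pB sA hc; rewrite BB AA subrr normr0 mulr0 normr_le0.
by rewrite subr_eq0 => /eqP.
Qed.

End matrix_sqrt.

(** * Expectations over finite weighted spaces *)

Section finite_expectation.
Context {R : realType}.

Definition wexp (T : finType) (W f : T -> R) : R := \sum_x W x * f x.

Definition prodw (I T : finType) (w : I -> T -> R) (s : {ffun I -> T}) : R :=
  \prod_i w i (s i).

Section wexp_theory.
Context (T : finType) (W : T -> R).
Hypothesis (W_ge0 : forall x, 0 <= W x) (W_sum1 : \sum_x W x = 1).

Lemma wexp_cst c : wexp W (fun=> c) = c.
Proof. by rewrite /wexp -mulr_suml W_sum1 mul1r. Qed.

Lemma wexpD f g : wexp W (fun x => f x + g x) = wexp W f + wexp W g.
Proof. by rewrite /wexp -big_split; apply: eq_bigr => x _; rewrite mulrDr. Qed.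

Lemma wexpZl c f : wexp W (fun x => c * f x) = c * wexp W f.
Proof. by rewrite /wexp mulr_sumr; apply: eq_bigr => x _; rewrite mulrCA. Qed.

Lemma wexpB f g : wexp W (fun x => f x - g x) = wexp W f - wexp W g.
Proof.
rewrite wexpD; congr (_ + _); rewrite -mulN1r -wexpZl.
by apply: eq_bigr => x _; rewrite mulN1r.
Qed.

Lemma wexp_sum (J : Type) (s : seq J) (P : pred J) (f : J -> T -> R) :
  wexp W (fun x => \sum_(j <- s | P j) f j x) = \sum_(j <- s | P j) wexp W (f j).
Proof.
rewrite /wexp exchange_big/=; apply: eq_bigr => x _.
by rewrite mulr_sumr.
Qed.

Lemma le_wexp f g : (forall x, f x <= g x) -> wexp W f <= wexp W g.
Proof. by move=> h; apply: ler_sum => x _; rewrite ler_wpM2l. Qed.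

Lemma wexp_ge0 f : (forall x, 0 <= f x) -> 0 <= wexp W f.
Proof. by move=> h; apply: sumr_ge0 => x _; rewrite mulr_ge0. Qed.

Lemma ler_norm_wexp f : `|wexp W f| <= wexp W (fun x => `|f x|).
Proof.
rewrite (le_trans (ler_norm_sum _ _ _))//; apply: ler_sum => x _.
by rewrite normrM (ger0_norm (W_ge0 x)).
Qed.

Lemma wexp_dist_le f g h : (forall x, `|f x - g x| <= h x) ->
  `|wexp W f - wexp W g| <= wexp W h.
Proof. by move=> fgh; rewrite -wexpB (le_trans (ler_norm_wexp _))// le_wexp. Qed.

Lemma eq_wexp f g : f =1 g -> wexp W f = wexp W g.
Proof. by move=> fg; apply: eq_bigr => x _; rewrite fg. Qed.

End wexp_theory.

Section product_weights.
Context (I T : finType) (w : I -> T -> R).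
Hypothesis w_ge0 : forall i j, 0 <= w i j.
Hypothesis w_sum1 : forall i, \sum_j w i j = 1.

Lemma prodw_ge0 s : 0 <= prodw w s.
Proof. exact: prodr_ge0. Qed.

Lemma wexp_prod (S : comPzRingType) (v : I -> T -> S) :
  \sum_(s : {ffun I -> T}) \prod_i v i (s i) = \prod_i \sum_j v i j.
Proof. by rewrite bigA_distr_bigA. Qed.

Lemma prodw_sum1 : \sum_s prodw w s = 1.
Proof. by rewrite wexp_prod big1. Qed.

Lemma wexp_coord i (g : T -> R) :
  wexp (prodw w) (fun s => g (s i)) = \sum_j w i j * g j.
Proof.
pose v k j := w k j * (if k == i then g j else 1).
transitivity (\sum_(s : {ffun I -> T}) \prod_k v k (s k)).
  apply: eq_bigr => s _; rewrite /prodw /v big_split/=; congr (_ * _).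
  by rewrite (bigD1 i)//= eqxx big1 ?mulr1// => k /negbTE ->.
rewrite wexp_prod (bigD1 i)//= [X in _ * X]big1 ?mulr1.
  by apply: eq_bigr => j _; rewrite /v eqxx.
move=> k /negbTE ki; rewrite -[RHS](w_sum1 k); apply: eq_bigr => j _.
by rewrite /v ki mulr1.
Qed.

Lemma wexp_coord2 i k (g h : T -> R) : i != k ->
  wexp (prodw w) (fun s => g (s i) * h (s k)) =
  (\sum_j w i j * g j) * (\sum_j w k j * h j).
Proof.
move=> ik; have ki : k == i = false by rewrite eq_sym (negbTE ik).
pose v l j := w l j * (if l == i then g j else if l == k then h j else 1).
transitivity (\sum_(s : {ffun I -> T}) \prod_k v k (s k)).
  apply: eq_bigr => s _; rewrite /prodw /v big_split/=; congr (_ * _).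
  rewrite (bigD1 i)//= eqxx; congr (_ * _).
  rewrite (bigD1 k) ?ki//= eqxx.
  by rewrite big1 ?mulr1// => l /andP[/negbTE -> /negbTE ->].
rewrite wexp_prod (bigD1 i)//= (bigD1 k) ?ki//= mulrA.
rewrite [X in _ * X]big1 ?mulr1.
  congr (_ * _); apply: eq_bigr => j _; rewrite /v ?eqxx//.
  by rewrite ki.
move=> l /andP[/negbTE li /negbTE lk].
rewrite -[RHS](w_sum1 l); apply: eq_bigr => j _.
by rewrite /v li lk mulr1.
Qed.

(** Distinct coordinates are independent and the summands are centered, so only the diagonal terms
    survive. *)
Lemma wexp_sum_sqr (x : I -> T -> R) :
  (forall i, \sum_j w i j * x i j = 0) ->
  wexp (prodw w) (fun s => (\sum_i x i (s i)) ^+ 2) =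
  \sum_i \sum_j w i j * x i j ^+ 2.
Proof.
move=> x0.
rewrite (eq_wexp _ (g := fun s : {ffun I -> T} => \sum_i \sum_k x i (s i) * x k (s k))); last first.
  by move=> s; rewrite expr2 mulr_suml; apply: eq_bigr => i _; rewrite mulr_sumr.
rewrite wexp_sum; apply: eq_bigr => i _; rewrite wexp_sum (bigD1 i)//=.
rewrite (wexp_coord i (fun j => x i j * x i j)) [X in _ + X]big1 ?addr0.
  by apply: eq_bigr => j _; rewrite expr2.
by move=> k ki; rewrite (wexp_coord2 (x i) (x k)) 1?eq_sym// x0 mul0r.
Qed.

End product_weights.
End finite_expectation.

(** * Levy continuity *)

Section trigonometric_polynomials.
Context {R : realType} (k : nat).
Implicit Types (h : 'cV[R]_k -> R).

Definition trigpoly h := exists s : seq (R * R * 'cV[R]_k),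
  forall x, h x = \sum_(a <- s) a.1.1 * cos (a.1.2 + dotc a.2 x).

Lemma trigpoly_ext h h' : h =1 h' -> trigpoly h -> trigpoly h'.
Proof. by move=> hh' [s hs]; exists s => x; rewrite -hh'. Qed.

Lemma trigpoly_cos th (t : 'cV[R]_k) : trigpoly (fun x => cos (th + dotc t x)).
Proof. by exists [:: (1, th, t)] => x; rewrite big_seq1 mul1r. Qed.

Lemma dotc0l (x : 'cV[R]_k) : dotc 0 x = 0.
Proof. by rewrite /dotc big1// => i _; rewrite mxE mul0r. Qed.

Lemma dotcDl (s t x : 'cV[R]_k) : dotc (s + t) x = dotc s x + dotc t x.
Proof. by rewrite /dotc -big_split; apply: eq_bigr => i _; rewrite mxE mulrDl. Qed.

Lemma dotcNl (t x : 'cV[R]_k) : dotc (- t) x = - dotc t x.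
Proof. by rewrite /dotc -sumrN; apply: eq_bigr => i _; rewrite mxE mulNr. Qed.

Lemma trigpolyD h h' : trigpoly h -> trigpoly h' -> trigpoly (fun x => h x + h' x).
Proof. by move=> [s hs] [s' hs']; exists (s ++ s') => x; rewrite big_cat hs hs'. Qed.

Lemma trigpolyZ c h : trigpoly h -> trigpoly (fun x => c * h x).
Proof.
move=> [s hs]; exists [seq (c * a.1.1, a.1.2, a.2) | a <- s] => x.
by rewrite big_map hs mulr_sumr; apply: eq_bigr => a _; rewrite mulrA.
Qed.

Lemma trigpoly_cst c : trigpoly (fun=> c).
Proof.
apply: trigpoly_ext (trigpolyZ c (trigpoly_cos 0 0)) => x.
by rewrite dotc0l addr0 cos0 mulr1.
Qed.

Lemma trigpoly_sum I (r : seq I) (P : pred I) (h : I -> 'cV[R]_k -> R) :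
  (forall i, trigpoly (h i)) -> trigpoly (fun x => \sum_(i <- r | P i) h i x).
Proof.
move=> th; elim: r => [|i r IH].
  by apply: trigpoly_ext (trigpoly_cst 0) => x; rewrite big_nil.
case Pi : (P i).
  by apply: trigpoly_ext (trigpolyD (th i) IH) => x; rewrite big_cons Pi.
by apply: trigpoly_ext IH => x; rewrite big_cons Pi.
Qed.

Lemma cosM (a b : R) : cos a * cos b = 2^-1 * cos (a + b) + 2^-1 * cos (a - b).
Proof. by rewrite cosD cosB; field. Qed.

Lemma trigpolyM h h' : trigpoly h -> trigpoly h' -> trigpoly (fun x => h x * h' x).
Proof.
move=> [s hs] [s' hs'].
apply: (@trigpoly_ext (fun x => \sum_(a <- s) \sum_(b <- s')
   (a.1.1 * b.1.1) * (2^-1 * cos ((a.1.2 + b.1.2) + dotc (a.2 + b.2) x) +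
    2^-1 * cos ((a.1.2 - b.1.2) + dotc (a.2 - b.2) x)))).
  move=> x; rewrite hs hs' mulr_suml; apply: eq_bigr => a _.
  rewrite mulr_sumr; apply: eq_bigr => b _.
  rewrite !dotcDl dotcNl mulrACA cosM; congr (_ * (_ * cos _ + _ * cos _)); ring.
apply: trigpoly_sum => a; apply: trigpoly_sum => b; apply: trigpolyZ.
by apply: trigpolyD; apply: trigpolyZ; exact: trigpoly_cos.
Qed.

Lemma trigpoly_prod I (r : seq I) (P : pred I) (h : I -> 'cV[R]_k -> R) :
  (forall i, trigpoly (h i)) -> trigpoly (fun x => \prod_(i <- r | P i) h i x).
Proof.
move=> th; elim: r => [|i r IH].
  by apply: trigpoly_ext (trigpoly_cst 1) => x; rewrite big_nil.
case Pi : (P i).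
  by apply: trigpoly_ext (trigpolyM (th i) IH) => x; rewrite big_cons Pi.
by apply: trigpoly_ext IH => x; rewrite big_cons Pi.
Qed.

Lemma trigpoly_sin_coord c (i : 'I_k) : trigpoly (fun x => sin (c * x i ord0)).
Proof.
pose t : 'cV[R]_k := \col_j (if j == i then c else 0).
apply: trigpoly_ext (trigpoly_cos (- (pi / 2)) t) => x.
have -> : dotc t x = c * x i ord0.
  rewrite /dotc (bigD1 i)//= mxE eqxx big1 ?addr0// => j ji.
  by rewrite mxE (negbTE ji) mul0r.
by rewrite addrC cosB cos_pihalf sin_pihalf mulr0 add0r mulr1.
Qed.

Lemma measurable_trigpoly h : trigpoly h -> measurable_fun setT h.
Proof.
move=> [s hs].
rewrite (_ : h = fun x => \sum_(a <- s) a.1.1 * cos (a.1.2 + dotc a.2 x)); last exact/funext.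
apply: measurable_sum => a; apply: measurable_funM => //.
exact: measurable_cos_dotc.
Qed.

End trigonometric_polynomials.

(** Around each point of [A] a ball is chosen on which [g] varies by at most e/2; half its radius
    serves to locate x, the other half to reach z, so z may leave [A]. *)
Lemma compact_uniform_continuous {R : realType} {V : normedModType R}
    (g : V -> R) (A : set V) (e : R) : compact A -> continuous g -> 0 < e ->
  exists2 d : R, 0 < d &
    forall x z, A x -> `|x - z| < d -> `|g x - g z| <= e.
Proof.
move=> /compact_near_coveringP cA cg e0.
have := cA R (0^'+) (fun d x => forall z, `|x - z| < d -> `|g x - g z| <= e) _.
case.
  move=> x Ax; have e2 : 0 < e / 2 by rewrite divr_gt0.
  have /cvgrPdist_le/(_ _ e2) := cg x.
  move=> /nbhs_ballP[r /= r0 hr].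
  have r2 : 0 < r / 2 by rewrite divr_gt0.
  exists (ball x (r / 2), [set d | d < r / 2]).
    split; first exact: nbhsx_ballx.
    by apply: nbhs_right_lt.
  move=> [y d] [/= xy dr] z yz.
  have h1 : `|g x - g y| <= e / 2.
    by apply: hr; apply: le_ball xy; lra.
  have h2 : `|g x - g z| <= e / 2.
    apply: hr; rewrite -ball_normE /= (splitr r).
    rewrite (le_lt_trans (ler_distD y _ _))// ltrD//.
      by move: xy; rewrite -ball_normE.
    exact: lt_trans yz dr.
  rewrite (le_trans (ler_distD (g x) _ _))// (splitr e) lerD// distrC.
  by [].
move=> d /= d0 hd.
exists (d / 2); first by rewrite divr_gt0.
move=> x z Ax xz; apply: (hd (d / 2)) => //=.
  rewrite sub0r normrN gtr0_norm ?divr_gt0// ltr_pdivrMr// ltr_pMr// ltr1n//.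
by rewrite divr_gt0.
Qed.

(** * Uniform approximation on cubes by bounded trigonometric polynomials *)

Section trigonometric_approximation.
Context {R : realType} (k : nat).

Let q : R := pi / 4.
Let s : R := sin q.

Lemma pi4_itv : q \in `[- (pi / 2), pi / 2] /\ 0 < q.
Proof. by have := @pi_gt0 R; rewrite /q in_itv/= => ?; split; [apply/andP; split|]; lra. Qed.

Lemma sin_pi4_bounds : 0 < s < 1.
Proof.
have [qi q0] := pi4_itv; have p0 := @pi_gt0 R; rewrite /s; apply/andP; split.
  by apply: sin_gt0_pi; rewrite q0/= /q; lra.
rewrite -sin_pihalf ltr_sin//; first by rewrite /q; lra.
by rewrite in_itv/=; apply/andP; split; lra.
Qed.

(** Inverse of u -> (1 + sin u)/2 on [-pi/4, pi/4]. Clamping at the values of the sine there keeps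
    the argument of [asin] away from -1 and 1, so the extension is continuous on the whole line. *)
Definition clampasin (y : R) : R :=
  asin (Num.max (- s) (Num.min s (2 * y - 1))).

Lemma continuous_clampasin : continuous clampasin.
Proof.
have /andP[s0 s1] := sin_pi4_bounds.
pose c (y : R) : R := Num.max (- s) (Num.min s (2 * y - 1)).
move=> y; apply: (@continuous_comp _ _ _ c asin y); last first.
  apply: continuous_asin; rewrite lt_max gt_max gt_min ltrNl opprK s1/=.
  by rewrite (lt_trans _ s1) // ?andbT; lra.
apply: continuous_max; first exact: cvg_cst.
apply: continuous_min; first exact: cvg_cst.
by apply: cvgB; [apply: cvgM; [exact: cvg_cst|exact: cvg_id]|exact: cvg_cst].
Qed.

Lemma clampasinK (u : R) : `|u| <= q -> clampasin ((1 + sin u) / 2) = u.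
Proof.
move=> uq; have p0 := @pi_gt0 R.
have [qi q0] := pi4_itv.
have ui : u \in `[- (pi / 2), pi / 2].
  by move: uq; rewrite ler_norml in_itv/= /q => /andP[? ?]; apply/andP; split; lra.
have nqi : - q \in `[- (pi / 2), pi / 2].
  by rewrite in_itv/= /q; apply/andP; split; lra.
have -> : clampasin ((1 + sin u) / 2) = asin (sin u).
  rewrite /clampasin (_ : 2 * ((1 + sin u) / 2) - 1 = sin u); last by field.
  have ler_sin (a b : R) : a \in `[- (pi / 2), pi / 2] ->
      b \in `[- (pi / 2), pi / 2] -> a <= b -> sin a <= sin b.
    move=> ai bi; rewrite !le_eqVlt => /orP[/eqP->|ab]; first by rewrite eqxx.
    by rewrite ltr_sin// ab orbT.
  have h1 : sin u <= s.
    by apply: ler_sin => //; move: uq; rewrite ler_norml => /andP[].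
  have h2 : - s <= sin u.
    by rewrite /s -sinN; apply: ler_sin => //; move: uq; rewrite ler_norml => /andP[].
  by rewrite (min_r h1) (max_r h2).
by rewrite sinK.
Qed.

(* Bernstein approximation on the unit cube, in the variables (1 + sin (q x_i / K)) / 2. *)
Lemma trig_approx (f : 'cV[R]_k -> R) (C K e : R) : continuous f ->
  (forall x, `|f x| <= C) -> 0 < K -> 0 < e ->
  exists h, [/\ trigpoly h, forall x, `|h x| <= C &
    forall x, `|x| <= K -> `|f x - h x| <= e].
Proof.
move=> cf fC K0 e0.
have [qi q0] := pi4_itv.
(* [node] undoes the change of variables on the cube |x| <= K, where q x_i / K stays within
   [-pi/4, pi/4]; there f x is [g] at the transformed point. *)
pose node (y : 'rV[R]_k) : 'cV[R]_k := \col_i (K / q * clampasin (y ord0 i)).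
pose g y := f (node y).
have cnode : continuous node.
  move=> y; apply: (@cvg_mx _ _ (nbhs y)) => i j; rewrite mxE; under eq_fun do rewrite mxE.
  apply: cvgM; first exact: cvg_cst.
  apply: (@cvg_comp _ _ _ (fun y : 'rV[R]_k => y ord0 i) clampasin).
    exact: coord_continuous.
  exact: continuous_clampasin.
have cg : continuous g.
  by move=> y; apply: (@continuous_comp _ _ _ node f); [exact: cnode|exact: cf].
have C0 : 0 <= C by apply: le_trans (fC 0).
have cA : compact [set y : 'rV[R]_k | forall i, `[0, 1]%classic (y ord0 i)].
  exact: (@rV_compact R k (fun=> `[0, 1]%classic) (fun=> @segment_compact R 0 1)).
have e2 : 0 < e / 2 by rewrite divr_gt0.
have [d d0 hd] := compact_uniform_continuous cA cg e2.
have cd0 : 0 <= 2 * C / d ^+ 2.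
  by apply: divr_ge0; [exact: mulr_ge0|exact: sqr_ge0].
pose y (x : 'cV[R]_k) i := (1 + sin (q / K * x i ord0)) / 2.
have y01 x i : 0 <= y x i <= 1.
  have := sin_geN1 (q / K * x i ord0); have := sin_le1 (q / K * x i ord0).
  by rewrite /y => ? ?; apply/andP; split; lra.
near \oo => n.
have n0 : (0 < n)%N by near: n; exact: nbhs_infty_gt.
have n0R : (0 : R) < n%:R by rewrite ltr0n.
(* Each coordinate i receives n independent tosses with success probability [y x i]. The mean of [g]
   at the success frequencies is the Bernstein polynomial, and as a mean it inherits the bound [C]
   for all x. *)
pose w x (il : 'I_k * 'I_n) (b : bool) := if b then y x il.1 else 1 - y x il.1.
have w0 x il b : 0 <= w x il b.
  by rewrite /w; have /andP[? ?] := y01 x il.1; case: b => //; rewrite subr_ge0.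
have w1 x il : \sum_b w x il b = 1.
  by rewrite big_bool/= /w addrC subrK.
pose m (sg : {ffun 'I_k * 'I_n -> bool}) : 'rV[R]_k :=
  \row_i (n%:R^-1 * \sum_(l < n) (sg (i, l))%:R).
pose h x := wexp (prodw (w x)) (fun sg => g (m sg)).
have W0 x := prodw_ge0 (w0 x); have W1 x := prodw_sum1 (w1 x).
exists h; split.
- apply: trigpoly_sum => sg.
  apply: (@trigpoly_ext _ _ (fun x => g (m sg) * \prod_il w x il (sg il))).
    by move=> x; rewrite mulrC.
  apply: trigpolyZ; apply: trigpoly_prod => il.
  have ty : trigpoly (fun x => y x il.1).
    apply: (@trigpoly_ext _ _ (fun x => 2^-1 * (1 + sin (q / K * x il.1 ord0)))).
      by move=> x; rewrite mulrC.
    apply: trigpolyZ; apply: trigpolyD; first exact: trigpoly_cst.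
    exact: trigpoly_sin_coord.
  rewrite /w; case: (sg il) => //.
  apply: (@trigpoly_ext _ _ (fun x => 1 + (-1) * y x il.1)).
    by move=> x; rewrite mulN1r.
  by apply: trigpolyD; [exact: trigpoly_cst|exact: trigpolyZ].
- move=> x; rewrite (le_trans (ler_norm_wexp _ _))//.
  rewrite -[leRHS](wexp_cst (W1 x)); apply: le_wexp => // sg.
  exact: fC.
move=> x xK; pose yx : 'rV[R]_k := \row_i y x i.
have fE : f x = g yx.
  congr f; apply/matrixP => i j; rewrite ord1 !mxE clampasinK.
    by rewrite mulrA mulf_div [q * K]mulrC divff ?mul1r// mulf_neq0// gt_eqF.
  rewrite normrM (ger0_norm (divr_ge0 (ltW q0) (ltW K0))).
  rewrite mulrAC ler_pdivrMr//; apply: ler_wpM2l; first exact: ltW.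
  exact: le_trans (le_mx_norm _ _ _) xK.
rewrite fE -(wexp_cst (W1 x) (g yx)).
(* If all frequencies are within [d] of their means, uniform continuity gives e/2; otherwise one
   squared deviation is at least d^2 and the second term exceeds the trivial bound 2C. *)
pose B sg := e / 2 + 2 * C / d ^+ 2 * \sum_i (m sg ord0 i - y x i) ^+ 2.
apply: le_trans (@wexp_dist_le _ _ _ (W0 x) _ _ B _) _.
  move=> sg; rewrite /B.
  have [hsm|] := boolP [forall i, `|m sg ord0 i - y x i| < d].
    rewrite (le_trans (hd _ (m sg) _ _)) ?lerDl//.
    - by move=> i /=; rewrite mxE in_itv/=.
    - rewrite distrC; move/forallP: hsm => hsm.
      rewrite -(@ltr_pM2r _ 1)// !mulr1.
      have [z0|z0] := eqVneq `|m sg - yx| 0; first by rewrite z0.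
      have [[a i]] := mx_norm_neq0 z0.
      rewrite -[mx_norm _]/(`|m sg - yx|) => -> /=.
      by rewrite ord1; have := hsm i; rewrite [(m sg - yx) _ _]mxE [(- yx) _ _]mxE [yx _ _]mxE.
    - apply: mulr_ge0 => //.
      by apply: sumr_ge0 => i _; rewrite sqr_ge0.
  rewrite negb_forall => /existsP[i +]; rewrite -leNgt => di.
  apply: (@le_trans _ _ (2 * C)).
    by rewrite (le_trans (ler_normB _ _))// mulr_natl mulr2n lerD// fC.
  rewrite -[leLHS]add0r lerD ?(ltW e2)// -mulrA ler_peMr ?mulr_ge0//.
  rewrite ler_pdivlMl ?exprn_gt0// mulr1 (bigD1 i)//=.
  rewrite -[leLHS]addr0 lerD//; last first.
    by apply: sumr_ge0 => j _; rewrite sqr_ge0.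
  by rewrite -(real_normK (num_real (_ - _))) lerXn2r ?nnegrE// ltW.
rewrite /B wexpD wexp_cst// wexpZl wexp_sum.
have pairE (G : 'I_k * 'I_n -> R) :
    \sum_il G il = \sum_i \sum_l G (i, l).
  by rewrite pair_bigA; apply: eq_bigr => -[].
(* Variance of a frequency of n tosses: y (1 - y)/n. *)
have vi i : wexp (prodw (w x)) (fun sg => (m sg ord0 i - y x i) ^+ 2) <= n%:R^-1.
  pose z (il : 'I_k * 'I_n) (b : bool) : R :=
    if il.1 == i then n%:R^-1 * (b%:R - y x i) else 0.
  rewrite (eq_wexp _ (g := fun sg : {ffun 'I_k * 'I_n -> bool} => (\sum_il z il (sg il)) ^+ 2)); last first.
    move=> sg; congr (_ ^+ 2); rewrite mxE /z.
    rewrite pairE /=.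
    rewrite [RHS](bigD1 i)//= eqxx [X in _ = _ + X]big1 ?addr0; last first.
      by move=> j /negbTE ->; rewrite big1.
    rewrite -mulr_sumr sumrB mulrBr; congr (_ - _).
    by rewrite sumr_const card_ord -[y x i *+ n]mulr_natl mulrA mulVf ?mul1r// gt_eqF.
  rewrite (wexp_sum_sqr (w1 x)); last first.
    move=> il; rewrite big_bool/= /z /w; case: eqP => [->|_]; last by rewrite !mulr0 addr0.
    by rewrite mulr1n mulr0n; ring.
  rewrite pairE /=.
  rewrite (bigD1 i)//= [X in _ + X]big1 ?addr0; last first.
    move=> j /negbTE ji; apply: big1 => l _; apply: big1 => b _.
    by rewrite /z /= ji expr0n mulr0.
  apply: (@le_trans _ _ (\sum_(l < n) n%:R^-1 ^+ 2)).
    apply: ler_sum => l _; rewrite big_bool/= /z /w/= eqxx !exprMn.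
    rewrite mulrCA [X in _ + X]mulrCA -mulrDr ler_piMr ?sqr_ge0//.
    by have /andP[? ?] := y01 x i; rewrite mulr1n mulr0n; nra.
  rewrite sumr_const card_ord -[_ ^+ 2 *+ n]mulr_natl expr2 mulrA divff ?mul1r// gt_eqF//.
have vs : \sum_i wexp (prodw (w x)) (fun sg => (m sg ord0 i - y x i) ^+ 2) <=
    k%:R / n%:R.
  apply: le_trans (ler_sum _ (fun i _ => vi i)) _.
  by rewrite sumr_const card_ord mulr_natl.
rewrite [leRHS](splitr e) lerD2l.
apply: le_trans (ler_wpM2l cd0 vs) _.
rewrite mulrA ler_pdivrMr// -ler_pdivrMl//.
near: n; exact: nbhs_infty_ger.
Unshelve. all: by end_near. Qed.

End trigonometric_approximation.

(** The sigma-algebra is generated by entries, not by open sets, so measurability is obtained from a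
    pointwise limit: trigonometric polynomials within 1/(n+1) of [f] on the cube of half-side
    n+1. *)
Lemma continuous_bounded_measurable {R : realType} k (f : 'cV[R]_k -> R) (C : R) :
  continuous f -> (forall x, `|f x| <= C) -> measurable_fun setT f.
Proof.
move=> cf fC.
have /choice[h hP] : forall n : nat, exists h, [/\ trigpoly h,
    forall x, `|h x| <= C & forall x, `|x| <= n.+1%:R -> `|f x - h x| <= n.+1%:R^-1].
  by move=> n; apply: trig_approx => //; rewrite ?invr_gt0 ltr0n.
apply: (@measurable_fun_cvg _ _ _ _ h).
  by move=> n; apply: measurable_trigpoly; have [] := hP n.
move=> x _; apply/cvgrPdist_le => e e0; near=> n.
have [_ _ hx] := hP n; apply: le_trans (hx _ _) _.
  apply: (@le_trans _ _ n%:R); last by rewrite ler_nat.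
  by near: n; exact: nbhs_infty_ger.
rewrite invf_ple ?posrE ?ltr0n//; apply: (@le_trans _ _ n%:R); last by rewrite ler_nat.
by near: n; exact: nbhs_infty_ger.
Unshelve. all: by end_near. Qed.

Lemma measurable_mx_norm {R : realType} m n :
  measurable_fun setT (fun x : 'M[R]_(m, n) => `|x|).
Proof.
rewrite (_ : (fun _ => _) = fun x : 'M[R]_(m, n) =>
    \big[Num.max/0]_(ij : 'I_m * 'I_n) `|x ij.1 ij.2|); last first.
  by apply/funext => x; rewrite -mx_normrE.
elim: (index_enum _) => [|ij s IH].
  by under eq_fun do rewrite big_nil; exact: measurable_cst.
under eq_fun do rewrite big_cons; apply: measurable_maxr => //.
by apply: measurableT_comp => //; exact: measurable_entry.
Qed.

(** Continuity from above along the events that the norm exceeds i, whose intersection is empty. *)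
Lemma probability_mx_norm_tight {R : realType} m n (mu : probability 'M[R]_(m, n) R)
    (e : R) : 0 < e -> exists2 K : R, 0 < K & (mu [set x | (K < `|x|)%R] <= e%:E)%E.
Proof.
move=> e0; pose A (i : nat) := [set x : 'M[R]_(m, n) | i%:R < `|x|].
have mA i : measurable (A i).
  rewrite /A -[X in measurable X]setTI.
  exact: (measurable_fun_ltr (measurable_cst _) (@measurable_mx_norm R m n)).
have /= := @nonincreasing_cvg_mu _ _ _ mu A _ mA.
rewrite (_ : \bigcap_i A i = set0); last first.
  rewrite -subset0 => x /= h.
  near \oo => i; have := h i I; rewrite /A/= ltNge => /negP; apply.
  by near: i; exact: nbhs_infty_ger.
rewrite measure0; move=> h.
have {}h := h _ measurable0 _.
have : mu (A i) @[i --> \oo] --> 0%E.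
  apply: h.
    by apply: le_lt_trans (probability_le1 mu (mA 0%N)) _; rewrite ltry.
  move=> i j ij; apply/subsetPset => x /=; rewrite /A/=; apply: le_lt_trans.
  by rewrite ler_nat.
move=> /fine_cvgP[_ /cvgrPdist_le/(_ _ e0)] hA.
near \oo => i; exists i%:R; first by rewrite ltr0n; near: i; exact: nbhs_infty_gt.
have : `|0 - fine (mu (A i))| <= e by near: i.
rewrite sub0r normrN ger0_norm ?fine_ge0// => hi.
have fA : mu (A i) \is a fin_num by exact: fin_num_measure.
by rewrite -[leLHS](fineK fA) lee_fin.
Unshelve. all: by end_near. Qed.

Section levy_continuity.
Context {R : realType} (k : nat).
Variables (T : nat -> finType) (W : forall n, T n -> R).
Hypotheses (W0 : forall n x, 0 <= @W n x) (W1 : forall n, \sum_x @W n x = 1).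
Variables (Z : forall n, T n -> 'cV[R]_k) (mu : probability 'cV[R]_k R).

Let bounded_int (f : 'cV[R]_k -> R) (C : R) :
  measurable_fun setT f -> (forall x, `|f x| <= C) ->
  mu.-integrable setT (EFin \o f).
Proof. exact: bounded_integrable. Qed.

(** Tightness is a hypothesis because second moments supply it directly in the applications. It
    controls the region outside the cube, where [f] and its trigonometric approximant may differ by
    2C. *)
Lemma levy_continuity :
  (forall th (t : 'cV[R]_k),
    wexp (@W n) (fun x => cos (th + dotc t (@Z n x))) @[n --> \oo] -->
    \int[mu]_x cos (th + dotc t x)) ->
  (forall e : R, 0 < e -> exists K : R, \forall n \near \oo,
    wexp (@W n) (fun x => (K < `|@Z n x|)%R%:R) <= e) ->
  forall (f : 'cV[R]_k -> R) (C : R), continuous f -> (forall x, `|f x| <= C) ->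
    wexp (@W n) (fun x => f (@Z n x)) @[n --> \oo] --> \int[mu]_x f x.
Proof.
move=> hcos htight f C cf fC.
have trig h : trigpoly h ->
    wexp (@W n) (fun x => h (@Z n x)) @[n --> \oo] --> \int[mu]_x h x.
  move=> [s hs].
  have -> : h = fun x => \sum_(a <- s) a.1.1 * cos (a.1.2 + dotc a.2 x).
    exact/funext.
  elim: s {hs} => [|a s IH].
    rewrite (_ : (fun n => _) = fun n => 0); last first.
      by apply/funext => n; under eq_wexp do rewrite big_nil; rewrite wexp_cst.
    rewrite (_ : Rintegral _ _ _ = 0); first exact: cvg_cst.
    under eq_Rintegral do rewrite big_nil.
    by rewrite Rintegral_cst// mul0r.
  have mc : mu.-integrable setT (EFin \o (fun x => cos (a.1.2 + dotc a.2 x))).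
    by apply: (@bounded_int _ 1); [exact: measurable_cos_dotc|move=> x; exact: cos_max].
  have ms : mu.-integrable setT (EFin \o
      (fun x => \sum_(b <- s) b.1.1 * cos (b.1.2 + dotc b.2 x))).
    apply: (@bounded_int _ (\sum_(b <- s) `|b.1.1|)).
      apply: measurable_sum => b; apply: measurable_funM => //.
      exact: measurable_cos_dotc.
    move=> x; rewrite (le_trans (ler_norm_sum _ _ _))//; apply: ler_sum => b _.
    by rewrite normrM ler_piMr// cos_max.
  rewrite (_ : Rintegral _ _ _ = a.1.1 * \int[mu]_x cos (a.1.2 + dotc a.2 x) +
     \int[mu]_x \sum_(b <- s) b.1.1 * cos (b.1.2 + dotc b.2 x)); last first.
    rewrite -RintegralZl// -RintegralD//.
      by apply: eq_Rintegral => x _; rewrite big_cons.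
    rewrite /comp; under eq_fun do rewrite EFinM.
    exact: integrableZl.
  rewrite (_ : (fun n => _) = fun n =>
      a.1.1 * wexp (@W n) (fun x => cos (a.1.2 + dotc a.2 (@Z n x))) +
      wexp (@W n) (fun x => \sum_(b <- s) b.1.1 * cos (b.1.2 + dotc b.2 (@Z n x)))).
    by apply: cvgD => //; apply: cvgM => //; exact: cvg_cst.
  by apply/funext => n; rewrite -wexpZl -wexpD; apply: eq_wexp => x; rewrite big_cons.
have C0 : 0 <= C by apply: le_trans (fC 0).
apply/cvgrPdist_le => /= e e0.
(* Replacing [f] by [h] costs et + 2C et under the limit law and again under the weights, and the
   convergence for [h] costs et: in total (4C + 3) et = e. *)
pose et : R := e / (4 * C + 3).
have c3 : 0 < 4 * C + 3 by rewrite ltr_wpDl// mulr_ge0.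
have et0 : 0 < et by rewrite divr_gt0.
have [K1 K10 hK1] := probability_mx_norm_tight mu et0.
have [K2 hK2] := htight _ et0.
pose K := Num.max K1 K2.
have K0 : 0 < K by rewrite lt_max K10.
have [h [th hC hK]] := trig_approx cf fC K0 et0.
have mf := continuous_bounded_measurable cf fC.
have mh := measurable_trigpoly th.
have if_ := bounded_int mf fC; have ih := bounded_int mh hC.
have dist x : `|f x - h x| <= et + 2 * C * (K < `|x|)%R%:R.
  case: (ltP K `|x|) => Kx; last by rewrite mulr0 addr0 hK.
  rewrite mulr1 (le_trans (ler_normB _ _))// ler_wpDl ?(ltW et0)//.
  by rewrite mulr_natl mulr2n lerD.
have mK : measurable [set x : 'cV[R]_k | K < `|x|].
  rewrite -[X in measurable X]setTI.
  exact: (measurable_fun_ltr (measurable_cst _) (@measurable_mx_norm R k 1)).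
have d1 : `|\int[mu]_x f x - \int[mu]_x h x| <= et + 2 * C * et.
  rewrite -RintegralB// (le_trans (le_normr_Rintegral _ _))//.
    by rewrite /comp; under eq_fun do rewrite EFinB; exact: integrableB.
  pose g x := et + 2 * C * \1_[set x : 'cV[R]_k | K < `|x|] x.
  have ind : mu.-integrable setT (EFin \o (\1_[set x : 'cV[R]_k | K < `|x|] : _ -> R)).
    apply: (@bounded_int _ 1); first exact: measurable_indic.
    by move=> x; rewrite indicE; case: (_ \in _); rewrite ?normr1 ?normr0.
  have ind2 : mu.-integrable setT (EFin \o (fun x => 2 * C * \1_[set x : 'cV[R]_k | K < `|x|] x)).
    by rewrite /comp; under eq_fun do rewrite EFinM; exact: integrableZl.
  have ic : mu.-integrable setT (EFin \o (fun=> et)).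
    by apply: (@bounded_int _ `|et|).
  apply: (@le_trans _ _ (\int[mu]_x g x)).
    apply: le_Rintegral => //.
    - by apply: (integrable_abse (f := EFin \o _)); rewrite /comp; under eq_fun do rewrite EFinB; exact: integrableB.
    - by rewrite /g /comp; under eq_fun do rewrite EFinD; exact: integrableD.
    - move=> x _; rewrite (le_trans (dist x))// /g indicE.
      by rewrite (_ : x \in _ = (K < `|x|))//; apply/idP/idP; rewrite inE.
  rewrite /g RintegralD// Rintegral_cst// (RintegralZl _ _ ind)//.
  rewrite (_ : fine (mu [set: 'cV[R]_k]) = 1) ?mulr1; last by rewrite probability_setT.
  rewrite lerD2l ler_wpM2l ?mulr_ge0// /Rintegral integral_indic// setIT.
  rewrite -lee_fin fineK ?fin_num_measure//; apply: le_trans hK1.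
  apply: le_measure; rewrite ?inE//.
    rewrite -[X in measurable X]setTI.
    exact: (measurable_fun_ltr (measurable_cst _) (@measurable_mx_norm R k 1)).
  by move=> x /=; apply: le_lt_trans; rewrite /K le_max lexx.
near=> n.
have d2 : `|wexp (@W n) (fun x => f (@Z n x)) - wexp (@W n) (fun x => h (@Z n x))|
    <= et + 2 * C * et.
  have h1 := @wexp_dist_le R (T n) (@W n) (@W0 n) (fun x => f (@Z n x))
    (fun x => h (@Z n x)) (fun x => et + 2 * C * (K < `|@Z n x|)%R%:R)
    (fun x => dist (@Z n x)).
  apply: (le_trans h1).
  rewrite wexpD wexp_cst// wexpZl lerD2l ler_wpM2l ?mulr_ge0//.
  apply: (@le_trans _ _ (wexp (@W n) (fun x => (K2 < `|@Z n x|)%R%:R))).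
    apply: le_wexp => // x; rewrite ler_nat.
    have [Kx|//] := ltP K `|@Z n x|.
    by rewrite (le_lt_trans _ Kx)// /K le_max lexx orbT.
  by near: n.
have d3 : `|\int[mu]_x h x - wexp (@W n) (fun x => h (@Z n x))| <= et.
  by near: n; have /cvgrPdist_le := trig _ th; apply.
rewrite distrC in d2.
rewrite (le_trans (ler_distD (\int[mu]_x h x) _ _))//.
rewrite (_ : e = (et + 2 * C * et) + (et + (et + 2 * C * et))); last first.
  by rewrite -[LHS](divfK (lt0r_neq0 c3)) -/et; ring.
rewrite lerD// (le_trans (ler_distD (wexp (@W n) (fun x => h (@Z n x))) _ _))//.
by rewrite lerD.
Unshelve. all: by end_near. Qed.

End levy_continuity.

(** * Strong laws of large numbers *)

Section real_valued_integrals.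
Context d (T : measurableType d) {R : realType} (P : probability T R).

Definition rintegrable (f : T -> R) := P.-integrable setT (EFin \o f).

Lemma rintegrable_measurable (f : T -> R) : rintegrable f -> measurable_fun setT f.
Proof. by move=> /measurable_int/measurable_EFinP. Qed.

Lemma rintegrable_cst c : rintegrable (fun=> c).
Proof. by apply: (@bounded_integrable R d T P (fun=> c) `|c|). Qed.

Lemma rintegrableD (f g : T -> R) : rintegrable f -> rintegrable g ->
  rintegrable (fun x => f x + g x).
Proof.
by move=> fi gi; rewrite /rintegrable /comp; under eq_fun do rewrite EFinD; exact: integrableD.
Qed.

Lemma rintegrableZ c (f : T -> R) : rintegrable f -> rintegrable (fun x => c * f x).
Proof.
by move=> fi; rewrite /rintegrable /comp; under eq_fun do rewrite EFinM; exact: integrableZl.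
Qed.

Lemma rintegrableB (f g : T -> R) : rintegrable f -> rintegrable g ->
  rintegrable (fun x => f x - g x).
Proof.
by move=> fi gi; rewrite /rintegrable /comp; under eq_fun do rewrite EFinB; exact: integrableB.
Qed.

Lemma rintegrable_sum I (s : seq I) (Q : pred I) (f : I -> T -> R) :
  (forall i, Q i -> rintegrable (f i)) ->
  rintegrable (fun x => \sum_(i <- s | Q i) f i x).
Proof.
move=> fi; rewrite /rintegrable /comp; under eq_fun do rewrite -sumEFin.
exact: integrable_sum.
Qed.

Lemma Rintegral_sum I (s : seq I) (f : I -> T -> R) :
  (forall i, rintegrable (f i)) ->
  \int[P]_x (\sum_(i <- s) f i x) = \sum_(i <- s) \int[P]_x f i x.
Proof.
move=> fi; elim: s => [|i s IH].
  by under eq_Rintegral do rewrite big_nil; rewrite big_nil Rintegral_cst// mul0r.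
under eq_Rintegral do rewrite big_cons.
rewrite big_cons -IH RintegralD//; first exact: fi.
by apply: (@rintegrable_sum _ s xpredT).
Qed.

Lemma rintegral_add (f g : T -> R) : rintegrable f -> rintegrable g ->
  \int[P]_x (f x + g x) = \int[P]_x f x + \int[P]_x g x.
Proof. by move=> fi gi; rewrite RintegralD. Qed.

Lemma rintegral_scale c (f : T -> R) : rintegrable f ->
  \int[P]_x (c * f x) = c * \int[P]_x f x.
Proof. by move=> fi; rewrite RintegralZl. Qed.

Lemma le_rintegrable (f g : T -> R) : measurable_fun setT f ->
  (forall x, `|f x| <= g x) -> rintegrable g -> rintegrable f.
Proof.
move=> mf fg gi; apply: le_integrable gi => //; first exact/measurable_EFinP.
by move=> x _; rewrite lee_fin (le_trans (fg x))// ler_norm.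
Qed.

Lemma rintegrableM (f g : T -> R) : measurable_fun setT f -> measurable_fun setT g ->
  rintegrable (fun x => f x ^+ 2) -> rintegrable (fun x => g x ^+ 2) ->
  rintegrable (fun x => f x * g x).
Proof.
move=> mf mg fi gi.
apply: (@le_rintegrable _ (fun x => f x ^+ 2 + g x ^+ 2)).
- exact: measurable_funM.
- move=> x; rewrite normrM -(real_normK (num_real (f x))) -(real_normK (num_real (g x))).
  by have := normr_ge0 (f x); have := normr_ge0 (g x); nra.
- exact: rintegrableD.
Qed.

Lemma rintegrable_L2 (f : T -> R) : measurable_fun setT f ->
  rintegrable (fun x => f x ^+ 2) -> rintegrable f.
Proof.
move=> mf fi; apply: (@le_rintegrable _ (fun x => 1 + f x ^+ 2)) => //.
  by move=> x; rewrite -(real_normK (num_real (f x))); have := normr_ge0 (f x); nra.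
by apply: rintegrableD => //; exact: rintegrable_cst.
Qed.

Lemma Rintegral_cst1 (c : R) : \int[P]_x c = c.
Proof.
rewrite Rintegral_cst// (_ : fine (P [set: T]) = 1) ?mulr1//.
by rewrite probability_setT.
Qed.

End real_valued_integrals.

Section iid_integrals.
Context d (T : measurableType d) d' (T' : measurableType d') {R : realType}.
Variables (P : probability T R) (eps : nat -> T -> T') (F : probability T' R).
Hypothesis heps : iid P eps F.

Let meps i : measurable_fun setT (eps i).
Proof. by case: heps. Qed.

Lemma iid_law i (f : T' -> \bar R) :
  (\int[pushforward P (eps i)]_x f x = \int[F]_x f x)%E.
Proof.
by apply: eq_measure_integral => /= A mA _; case: heps => _ _; exact.
Qed.

Lemma iid_rintegrable i (g : T' -> R) : rintegrable F g -> rintegrable P (g \o eps i).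
Proof.
move=> gi; have mg := rintegrable_measurable gi.
apply/integrableP; split.
  by apply/measurable_EFinP; exact: measurableT_comp.
have /integrableP[_] := gi; rewrite -(iid_law i).
rewrite ge0_integral_pushforward//.
exact/measurableT_comp/measurable_EFinP.
Qed.

Lemma iid_Rintegral i (g : T' -> R) : rintegrable F g ->
  \int[P]_x g (eps i x) = \int[F]_x g x.
Proof.
move=> gi; have mg := rintegrable_measurable gi; congr fine.
rewrite -(iid_law i) integral_pushforward//; first exact/measurable_EFinP.
exact: iid_rintegrable.
Qed.

(** Independence for the two-element list of indices fixes the joint law on rectangles, and a
    product measure is determined by rectangles. *)
Lemma iid_pair_law i k (f : T' * T' -> \bar R) : i != k ->
  (\int[pushforward P (fun x => (eps i x, eps k x))]_z f z =
   \int[F \x F]_z f z)%E.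
Proof.
move=> ik; have mp : measurable_fun setT (fun x => (eps i x, eps k x)).
  exact/measurable_fun_pair.
apply: eq_measure_integral => /= A mA _; apply/esym.
pose m' := pushforward P (fun x => (eps i x, eps k x)).
have -> // : forall X, measurable X -> (F \x F)%E X = m' X.
apply: product_measure_unique => B C mB mC.
case: heps => _ ind law.
have uJ : uniq [:: i; k] by rewrite /= inE ik.
have := ind [:: i; k] (fun l => if l == i then B else C) uJ.
rewrite big_cons big_seq1 eqxx eq_sym (negbTE ik) !law//.
move=> <-; last by move=> l; case: ifP.
rewrite /m' /pushforward; congr (P _); apply/seteqP; split => x /=.
  move=> [Bx Cx] l; rewrite /= !inE => /orP[/eqP ->|/eqP ->]; rewrite ?eqxx//.
  by rewrite eq_sym (negbTE ik).
move=> h; split; first by have := h i; rewrite /= mem_head eqxx; exact.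
by have := h k; rewrite /= !inE eqxx orbT eq_sym (negbTE ik); exact.
Qed.

Lemma iid_Rintegral_mul i k (g h : T' -> R) : i != k ->
  measurable_fun setT g -> measurable_fun setT h ->
  rintegrable F (fun x => g x ^+ 2) -> rintegrable F (fun x => h x ^+ 2) ->
  \int[P]_x (g (eps i x) * h (eps k x)) = (\int[F]_x g x) * (\int[F]_x h x).
Proof.
move=> ik mg mh g2 h2.
have mp : measurable_fun setT (fun x => (eps i x, eps k x)).
  exact/measurable_fun_pair.
have mgh : measurable_fun setT (fun z : T' * T' => g z.1 * h z.2).
  by apply: measurable_funM; apply: measurableT_comp => //; exact: measurable_fst || exact: measurable_snd.
have gi := rintegrable_L2 mg g2; have hi := rintegrable_L2 mh h2.
have igh : rintegrable P (fun x => g (eps i x) * h (eps k x)).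
  apply: rintegrableM; [exact: measurableT_comp| exact: measurableT_comp | |].
    exact: (iid_rintegrable i g2).
  exact: (iid_rintegrable k h2).
have ipr : (F \x F)%E.-integrable setT (EFin \o (fun z : T' * T' => g z.1 * h z.2)).
  apply/integrableP; split; first exact/measurable_EFinP.
  rewrite -(iid_pair_law _ ik) ge0_integral_pushforward//.
    by have /integrableP[_] := igh.
  exact/measurableT_comp/measurable_EFinP.
rewrite /Rintegral -fineM; last 2 first.
- exact: integrable_fin_num.
- exact: integrable_fin_num.
congr fine; transitivity
  (\int[pushforward P (fun x => (eps i x, eps k x))]_z (g z.1 * h z.2)%:E)%E.
  by rewrite integral_pushforward//; exact/measurable_EFinP.
rewrite iid_pair_law// -(integral12_prod_meas1 ipr).
transitivity (\int[F]_x ((g x)%:E * \int[F]_y (h y)%:E))%E.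
  apply: eq_integral => x _; rewrite /fubini_F/= -integralZl//.
have hf : (\int[F]_y (h y)%:E \is a fin_num)%E by exact: integrable_fin_num.
by rewrite -(fineK hf) integralZr.
Qed.

End iid_integrals.

(** The sum of the U_m^2 has finite integral by monotone convergence, hence is almost surely finite,
    and the terms of a convergent series vanish. *)
Lemma ae_cvg0_summable_L2 d (T : measurableType d) {R : realType}
    (P : probability T R) (U : nat -> T -> R) (c : R) :
  (forall m, measurable_fun setT (U m)) ->
  (forall m, rintegrable P (fun x => U m x ^+ 2)) ->
  (forall m, \int[P]_x (U m x ^+ 2) <= c * m.+1%:R^-1 ^+ 2) ->
  {ae P, forall x, U m x @[m --> \oo] --> 0}.
Proof.
move=> mU U2 Uc.
pose f m x := (U m x ^+ 2)%:E.
have f0 m x : (0 <= f m x)%E by rewrite lee_fin sqr_ge0.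
have mf m : measurable_fun setT (f m) by exact: measurable_int (U2 m).
have c0 : 0 <= c.
  have := Uc 0%N; rewrite invr1 expr1n mulr1; apply: le_trans.
  by apply: Rintegral_ge0 => x _; rewrite sqr_ge0.
(* Telescoping: 1/(n+2)^2 is at most 1/(n+1) - 1/(n+2), which leaves the bound 2 - 1/(n+1). *)
have sumle n : \sum_(0 <= m < n) (m.+1%:R : R)^-1 ^+ 2 <= 2.
  case: n => [|n]; first by rewrite big_nil.
  suff : \sum_(0 <= m < n.+1) (m.+1%:R : R)^-1 ^+ 2 <= 2 - n.+1%:R^-1.
    by move=> h; apply: le_trans h _; rewrite gerBl invr_ge0.
  elim: n => [|n IH]; first by rewrite big_nat1 invr1 expr1n; lra.
  rewrite big_nat_recr//= (le_trans (lerD IH (lexx _)))//.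
  have n1 : 0 < n.+1%:R :> R by rewrite ltr0n.
  have n2 : 0 < n.+2%:R :> R by rewrite ltr0n.
  have e1 : n.+1%:R^-1 - n.+2%:R^-1 = n.+1%:R^-1 * n.+2%:R^-1 :> R.
    have n2E : n.+2%:R = n.+1%:R + 1 :> R by rewrite natr1.
    by move: n1 n2; rewrite n2E; move: (n.+1%:R) => x x0 x1; field; rewrite !gt_eqF.
  have e2 : n.+2%:R^-1 ^+ 2 <= n.+1%:R^-1 * n.+2%:R^-1 :> R.
    by rewrite expr2 ler_wpM2r ?invr_ge0 ?ltW// ltf_pV2 ?posrE// ltr_nat.
  move: e2; rewrite -e1; move: (n.+1%:R^-1) (n.+2%:R^-1) => x y; lra.
have intS : (\int[P]_x (\sum_(0 <= m <oo) f m x) <= (c * 2)%:E)%E.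
  rewrite integral_nneseries//.
  apply: lime_le.
    by apply: is_cvg_nneseries => n _ _; exact: integral_ge0.
  apply: nearW => n.
  apply: (@le_trans _ _ (\sum_(0 <= m < n) (c * m.+1%:R^-1 ^+ 2)%:E)%E).
    apply: lee_sum => m _; have fin : (\int[P]_x f m x \is a fin_num)%E.
      exact: integrable_fin_num (U2 m).
    by rewrite -(fineK fin) lee_fin; exact: Uc.
  rewrite sumEFin lee_fin -mulr_sumr ler_wpM2l// sumle.
have mS : measurable_fun setT (fun x => \sum_(0 <= m <oo) f m x)%E.
  exact: ge0_emeasurable_sum.
have iS : P.-integrable setT (fun x => \sum_(0 <= m <oo) f m x)%E.
  apply/integrableP; split => //.
  rewrite (eq_integral (fun x => \sum_(0 <= m <oo) f m x)%E); last first.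
    by move=> x _; rewrite gee0_abs// nneseries_ge0.
  by apply: le_lt_trans intS _; rewrite ltry.
have := integrable_ae measurableT iS; apply: filterS => x /(_ I) fx.
have : cvgn (series (fun m => U m x ^+ 2)).
  apply: nondecreasing_is_cvgn.
    apply/nondecreasing_seqP => n; rewrite /series/= big_nat_recr//= lerDl.
    exact: sqr_ge0.
  exists (fine (\sum_(0 <= m <oo) f m x)%E) => _ [n _ <-].
  rewrite -lee_fin fineK// /series/= -sumEFin.
  exact: (@nneseries_lim_ge R (fun m => f m x) xpredT 0 n (fun k _ _ => f0 k x)).
move=> /cvg_series_cvg_0 h; apply/cvgrPdist_le => e e0.
have e2 : 0 < e ^+ 2 by rewrite exprn_gt0.
have /cvgrPdist_le/(_ _ e2) := h; apply: filterS => m.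
rewrite !sub0r !normrN (ger0_norm (sqr_ge0 _)) -(real_normK (num_real (U m x))).
by rewrite ler_sqr ?nnegrE// ltW.
Qed.

Lemma cauchy_schwarz_sum {R : realFieldType} I (r : seq I) (Q : pred I) (f g : I -> R) :
  (\sum_(i <- r | Q i) f i * g i) ^+ 2 <=
  (\sum_(i <- r | Q i) f i ^+ 2) * (\sum_(i <- r | Q i) g i ^+ 2).
Proof.
set A := \sum_(i <- r | Q i) f i * g i.
set X := \sum_(i <- r | Q i) f i ^+ 2.
set Y := \sum_(i <- r | Q i) g i ^+ 2.
have Y0 : 0 <= Y by apply: sumr_ge0 => i _; exact: sqr_ge0.
have key (t s : R) : 0 <= t ^+ 2 * X - 2 * t * s * A + s ^+ 2 * Y.
  have -> : t ^+ 2 * X - 2 * t * s * A + s ^+ 2 * Y =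
      \sum_(i <- r | Q i) (t * f i - s * g i) ^+ 2.
    rewrite /X /A /Y !mulr_sumr -sumrB -big_split/=.
    by apply: eq_bigr => i _; ring.
  by apply: sumr_ge0 => i _; exact: sqr_ge0.
have [Yp|Yn] := ltP 0 Y.
  have := key Y A.
  have -> : Y ^+ 2 * X - 2 * Y * A * A + A ^+ 2 * Y = Y * (X * Y - A ^+ 2) by ring.
  by rewrite pmulr_rge0// subr_ge0.
have {Yn} Ye : Y = 0 by apply/eqP; rewrite eq_le Yn Y0.
have [->|A0] := eqVneq A 0; first by rewrite expr0n Ye mulr0.
(* With Y = 0 the form [key] is affine in s, and for nonzero A this s makes it equal to -1. *)
have := key 1 ((X + 1) / (2 * A)); rewrite Ye mulr0 addr0 expr1n mul1r.
have -> : X - 2 * 1 * ((X + 1) / (2 * A)) * A = -1 by field.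
by rewrite oppr_ge0 ler10.
Qed.

(** * From averages along squares to averages along all integers *)

Section square_interpolation.
Context {R : realType}.

Lemma nat_sqrt_exists (n : nat) : (0 < n)%N ->
  exists m, (m.+1 ^ 2 <= n < m.+2 ^ 2)%N.
Proof.
case: n => // n _; elim: n => [|n [m /andP[h1 h2]]]; first by exists 0%N.
have [h|h] := ltnP n.+2 (m.+2 ^ 2)%N.
  by exists m; rewrite h andbT (leq_trans h1).
exists m.+1; rewrite h/= (@leq_ltn_trans (m.+2 ^ 2)%N)//.
by rewrite ltn_exp2r.
Qed.

(** [m.+1] is the integer square root of n and grows with n, so a bound uniform over each block
    between consecutive squares holds for all large n. *)
Lemma near_sqrt (Q : nat -> nat -> Prop) :
  (\forall m \near \oo, forall n, (m.+1 ^ 2 <= n < m.+2 ^ 2)%N -> Q m n) ->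
  \forall n \near \oo, exists2 m, (m.+1 ^ 2 <= n < m.+2 ^ 2)%N & Q m n.
Proof.
move=> [M _ hM]; exists (M.+1 ^ 2)%N => // n /= Mn.
have n0 : (0 < n)%N by apply: leq_trans Mn; rewrite expn_gt0.
have [m /andP[h1 h2]] := nat_sqrt_exists n0.
exists m; first by rewrite h1.
apply: hM; last by rewrite h1.
by rewrite /= -2!ltnS -(@ltn_exp2r _ _ 2)// (leq_ltn_trans Mn).
Qed.

Lemma cvg_ratio_sqr :
  (m.+2%:R / m.+1%:R : R) ^+ 2 @[m --> \oo] --> (1 : R).
Proof.
have h : 1 + m.+1%:R^-1 @[m --> \oo] --> (1 : R).
  by rewrite -[X in _ --> X]addr0; apply: cvgD; [exact: cvg_cst|exact: cvg_harmonic].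
have h2 : (1 + m.+1%:R^-1) * (1 + m.+1%:R^-1) @[m --> \oo] --> (1 * 1 : R).
  exact: cvgM.
rewrite mulr1 in h2; apply: cvg_trans h2; apply: near_eq_cvg; apply: nearW => m.
by rewrite [RHS]expr2 -[m.+2%:R]natr1 [(_ + 1) / _]mulrDl divff// mul1r.
Qed.

(** Partial sums are monotone, so inside a block the average lies between the two neighbouring
    square averages, corrected by the ratio [rho] of consecutive squares, which tends to 1. *)
Lemma interpolate_nonneg (b : nat -> R) (l : R) : (forall i, 0 <= b i) ->
  (m.+1 ^ 2)%:R^-1 * \sum_(i < m.+1 ^ 2) b i @[m --> \oo] --> l ->
  n%:R^-1 * \sum_(i < n) b i @[n --> \oo] --> l.
Proof.
move=> b0 hl; pose a m := (m.+1 ^ 2)%:R^-1 * \sum_(i < m.+1 ^ 2) b i.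
pose rho m : R := (m.+2%:R / m.+1%:R) ^+ 2.
have rho0 m : 0 < rho m by rewrite exprn_gt0// divr_gt0// ltr0n.
have hlow : a m / rho m @[m --> \oo] --> l.
  rewrite -[l]mulr1 -[1]invr1; apply: cvgM => //.
  by apply: cvgV => //; exact: cvg_ratio_sqr.
have hup : a m.+1 * rho m @[m --> \oo] --> l.
  rewrite -[l]mulr1; apply: cvgM; last exact: cvg_ratio_sqr.
  by have := hl; rewrite -(cvg_shiftS a).
have mono (p q : nat) : (p <= q)%N -> \sum_(i < p) b i <= \sum_(i < q) b i.
  move=> pq; rewrite -!(big_mkord xpredT b) [leRHS](big_cat_nat _ pq)//= lerDl.
  by rewrite sumr_ge0.
have E1 (x y : nat) (S : R) : (y.+1%:R ^+ 2)^-1 * S / (x.+1%:R / y.+1%:R) ^+ 2 =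
    (x.+1%:R ^+ 2)^-1 * S.
  by field; rewrite !nat1r !pnatr_eq0.
have E2 (x y : nat) (S : R) : (y.+1%:R ^+ 2)^-1 * S =
    (x.+1%:R ^+ 2)^-1 * S * (x.+1%:R / y.+1%:R) ^+ 2.
  by field; rewrite !nat1r !pnatr_eq0.
apply/cvgrPdist_le => /= e e0.
have : \forall m \near \oo, forall n, (m.+1 ^ 2 <= n < m.+2 ^ 2)%N ->
    `|l - n%:R^-1 * \sum_(i < n) b i| <= e.
  near=> m; move=> n /andP[mn nm].
  have n0 : 0 < n%:R :> R by rewrite ltr0n (leq_trans _ mn)// expn_gt0.
  have hx : a m / rho m <= n%:R^-1 * \sum_(i < n) b i.
    apply: (@le_trans _ _ ((m.+2 ^ 2)%:R^-1 * \sum_(i < m.+1 ^ 2) b i)).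
      rewrite le_eqVlt; apply/orP; left; apply/eqP.
      by rewrite /a /rho !natrX; apply: E1.
    apply: ler_pM; rewrite ?invr_ge0 ?sumr_ge0 ?mono//.
    by rewrite lef_pV2 ?posrE// ?ler_nat ?(ltnW nm)// ltr0n expn_gt0.
  have hy : n%:R^-1 * \sum_(i < n) b i <= a m.+1 * rho m.
    apply: (@le_trans _ _ ((m.+1 ^ 2)%:R^-1 * \sum_(i < m.+2 ^ 2) b i)); last first.
      rewrite le_eqVlt; apply/orP; left; apply/eqP.
      by rewrite /a /rho !natrX; apply: E2.
    apply: ler_pM; rewrite ?invr_ge0 ?sumr_ge0 ?mono ?(ltnW nm)//.
    by rewrite lef_pV2 ?posrE// ?ler_nat// ltr0n expn_gt0.
  have h1 : `|l - a m / rho m| <= e.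
    by near: m; have /cvgrPdist_le := hlow; apply.
  have h2 : `|l - a m.+1 * rho m| <= e.
    by near: m; have /cvgrPdist_le := hup; apply.
  move: h1 h2; rewrite !ler_norml => /andP[? ?] /andP[? ?]; apply/andP; split; lra.
by move=> /near_sqrt; apply: filterS => n [].
Unshelve. all: by end_near. Qed.

(* Between consecutive squares the sum is controlled by Cauchy-Schwarz, because the
   block of squares y_i^2 has vanishing average. *)
Lemma interpolate_weighted (x y : nat -> R) (C l : R) :
  (forall n, \sum_(i < n) x i ^+ 2 <= C * n%:R) ->
  n%:R^-1 * \sum_(i < n) y i ^+ 2 @[n --> \oo] --> l ->
  (m.+1 ^ 2)%:R^-1 * \sum_(i < m.+1 ^ 2) x i * y i @[m --> \oo] --> (0 : R) ->
  n%:R^-1 * \sum_(i < n) x i * y i @[n --> \oo] --> (0 : R).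
Proof.
move=> xC yl hs.
pose q m := (m.+1 ^ 2)%:R^-1 * \sum_(i < m.+1 ^ 2) y i ^+ 2.
pose rho m : R := (m.+2%:R / m.+1%:R) ^+ 2.
have ql : q m @[m --> \oo] --> l.
  have sq : (m.+1 ^ 2)%N @[m --> \oo] --> \oo.
    move=> A [N _ NA]; exists N => // m /= Nm; apply: NA => /=.
    by rewrite (leq_trans Nm)// (leq_trans (leqnSn _))// -[X in (X <= _)%N]expn1 leq_pexp2l.
  exact: (cvg_comp _ _ sq yl).
(* This is the Cauchy-Schwarz bound for the square of the partial block sum [D], normalized by
   (m+1)^2: the factor for x stays bounded, and the factor for y is a difference of two quantities
   with the same limit. *)
have E0 : C * rho m * (q m.+1 * rho m - q m) @[m --> \oo] --> (0 : R).
  rewrite (_ : 0 = C * 1 * (l * 1 - l)); last by rewrite !mulr1 subrr mulr0.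
  apply: cvgM; first by apply: cvgM; [exact: cvg_cst|exact: cvg_ratio_sqr].
  apply: cvgB => //; apply: cvgM; last exact: cvg_ratio_sqr.
  by rewrite (cvg_shiftS q).
apply/cvgrPdist_le => /= e e0.
have e2 : 0 < e / 2 by rewrite divr_gt0.
have : \forall m \near \oo, forall n, (m.+1 ^ 2 <= n < m.+2 ^ 2)%N ->
    `|0 - n%:R^-1 * \sum_(i < n) x i * y i| <= e.
  near=> m; move=> n /andP[mn nm].
  have m0 : 0 < (m.+1 ^ 2)%:R :> R by rewrite ltr0n expn_gt0.
  have n0 : 0 < n%:R :> R by rewrite ltr0n (leq_trans _ mn)// expn_gt0.
  rewrite sub0r normrN normrM ger0_norm ?invr_ge0 ?(ltW n0)//.
  apply: (@le_trans _ _ ((m.+1 ^ 2)%:R^-1 * `|\sum_(i < n) x i * y i|)).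
    by rewrite ler_wpM2r// lef_pV2 ?posrE// ler_nat.
  pose D := \sum_(m.+1 ^ 2 <= i < n) x i * y i.
  have -> : \sum_(i < n) x i * y i = \sum_(i < m.+1 ^ 2) x i * y i + D.
    by rewrite -!(big_mkord xpredT (fun i => x i * y i)) (big_cat_nat _ mn).
  rewrite (splitr e) (le_trans (ler_wpM2l _ (ler_normD _ _))) ?invr_ge0 ?(ltW m0)//.
  rewrite mulrDr lerD//.
    have : `|0 - (m.+1 ^ 2)%:R^-1 * \sum_(i < m.+1 ^ 2) x i * y i| <= e / 2.
      by near: m; have /cvgrPdist_le := hs; apply.
    by rewrite sub0r normrN normrM ger0_norm// invr_ge0 ltW.
  have hE : `|0 - C * rho m * (q m.+1 * rho m - q m)| <= (e / 2) ^+ 2.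
    by near: m; have /cvgrPdist_le := E0; apply; rewrite exprn_gt0.
  rewrite -ler_sqr ?nnegrE; [|by rewrite mulr_ge0// invr_ge0 ltW|exact: ltW].
  rewrite exprMn real_normK ?num_real//.
  apply: le_trans hE; rewrite sub0r normrN.
  apply: (@le_trans _ _ (C * rho m * (q m.+1 * rho m - q m))); last exact: ler_norm.
  have sub_nat (f : nat -> R) (a b c : nat) : (forall i, 0 <= f i) ->
      (a <= b)%N -> (b <= c)%N ->
      \sum_(a <= i < b) f i <= \sum_(i < c) f i - \sum_(i < a) f i.
    move=> f0 ab bc; rewrite -!(big_mkord xpredT f).
    rewrite (big_cat_nat _ (leq_trans ab bc))//= [leRHS]addrC addKr.
    by rewrite (big_cat_nat ab bc)//= lerDl sumr_ge0.
  have h1 : \sum_(m.+1 ^ 2 <= i < n) x i ^+ 2 <= C * (m.+2 ^ 2)%:R.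
    have := sub_nat (fun i => x i ^+ 2) _ _ _ (fun i => sqr_ge0 _) mn (ltnW nm).
    move=> h; apply: (le_trans h); apply: le_trans (xC _).
    by rewrite gerBl sumr_ge0// => i _; exact: sqr_ge0.
  have h2 : \sum_(m.+1 ^ 2 <= i < n) y i ^+ 2 <=
      (m.+2 ^ 2)%:R * q m.+1 - (m.+1 ^ 2)%:R * q m.
    have := sub_nat (fun i => y i ^+ 2) _ _ _ (fun i => sqr_ge0 _) mn (ltnW nm).
    by rewrite /q !mulrA !divff ?mul1r// pnatr_eq0 expn_eq0.
  have h3 : D ^+ 2 <= C * (m.+2 ^ 2)%:R * ((m.+2 ^ 2)%:R * q m.+1 - (m.+1 ^ 2)%:R * q m).
    apply: le_trans (cauchy_schwarz_sum _ _ _ _) _.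
    by apply: ler_pM => //; apply: sumr_ge0 => i _; exact: sqr_ge0.
  apply: (le_trans (ler_wpM2l (sqr_ge0 _) h3)).
  rewrite le_eqVlt; apply/orP; left; apply/eqP.
  rewrite /rho !natrX; move: (q m.+1) (q m) => a b.
  by field; rewrite !nat1r !pnatr_eq0.
by move=> /near_sqrt; apply: filterS => n [].
Unshelve. all: by end_near. Qed.

End square_interpolation.

(** * Second-moment strong law for weighted sums of functions of the errors *)

Section strong_law.
Context d (T : measurableType d) d' (T' : measurableType d') {R : realType}.
Variables (P : probability T R) (eps : nat -> T -> T') (F : probability T' R).
Hypothesis heps : iid P eps F.
Variable g : T' -> R.
Hypotheses (mg : measurable_fun setT g) (g2 : rintegrable F (fun x => g x ^+ 2)).

Let mu := \int[F]_x g x.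
Let v := \int[F]_x ((g x - mu) ^+ 2).

Let meps i : measurable_fun setT (eps i).
Proof. by case: heps. Qed.

Let mgc : measurable_fun setT (fun x => g x - mu).
Proof. exact: measurable_funB. Qed.

Let gi : rintegrable F g.
Proof. exact: rintegrable_L2. Qed.

Let gc2 : rintegrable F (fun x => (g x - mu) ^+ 2).
Proof.
rewrite (_ : (fun _ => _) = fun x => g x ^+ 2 + (- 2 * mu) * g x + mu ^+ 2); last first.
  by apply/funext => x; ring.
apply: rintegrableD; last exact: rintegrable_cst.
by apply: rintegrableD => //; exact: rintegrableZ.
Qed.

Let int_gc : \int[F]_x (g x - mu) = 0.
Proof. by rewrite RintegralB// ?Rintegral_cst1 ?subrr//; exact: rintegrable_cst. Qed.

Let mVV i k : rintegrable P (fun x => (g (eps i x) - mu) * (g (eps k x) - mu)).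
Proof.
apply: rintegrableM.
- exact: (measurableT_comp mgc (meps i)).
- exact: (measurableT_comp mgc (meps k)).
- exact: (iid_rintegrable heps i gc2).
- exact: (iid_rintegrable heps k gc2).
Qed.

Lemma iid_second_moment (x : nat -> R) n :
  rintegrable P (fun w => (\sum_(i < n) x i * (g (eps i w) - mu)) ^+ 2) /\
  \int[P]_w ((\sum_(i < n) x i * (g (eps i w) - mu)) ^+ 2) =
  v * \sum_(i < n) x i ^+ 2.
Proof.
pose V i k w := x i * x k * ((g (eps i w) - mu) * (g (eps k w) - mu)).
have E w : (\sum_(i < n) x i * (g (eps i w) - mu)) ^+ 2 =
    \sum_(i < n) \sum_(k < n) V i k w.
  rewrite expr2 mulr_suml; apply: eq_bigr => i _; rewrite mulr_sumr.
  by apply: eq_bigr => k _; rewrite mulrACA.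
have VI (i k : nat) : rintegrable P (V i k) by apply: rintegrableZ; exact: mVV.
split.
  rewrite (funext E : (fun _ => _) = _).
  by apply: rintegrable_sum => i _; apply: rintegrable_sum => k _; exact: VI.
under eq_Rintegral do rewrite E.
rewrite Rintegral_sum; last by move=> i; apply: rintegrable_sum => k _; exact: VI.
rewrite mulr_sumr; apply: eq_bigr => i _.
rewrite Rintegral_sum; last by move=> k; exact: VI.
rewrite (bigD1 i)//= [X in _ + X]big1 ?addr0; last first.
  move=> k ki; rewrite /V RintegralZl//; last exact: mVV.
  rewrite (iid_Rintegral_mul heps _ mgc mgc gc2 gc2) ?int_gc ?mul0r ?mulr0//.
  by rewrite eq_sym.
rewrite /V RintegralZl//; last exact: mVV.
rewrite -expr2 mulrC; congr (_ * _).
transitivity (\int[P]_w ((g (eps i w) - mu) ^+ 2)).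
  by apply: eq_Rintegral => w _; rewrite expr2.
exact: (iid_Rintegral heps i gc2).
Qed.

(** At N = (m+1)^2 the average has mean square at most v C / N. This is summable over m, whereas the
    same bound over all sample sizes would be harmonic. *)
Lemma slln_squares (x : nat -> R) (C : R) :
  (forall n, \sum_(i < n) x i ^+ 2 <= C * n%:R) ->
  {ae P, forall w, (m.+1 ^ 2)%:R^-1 *
    \sum_(i < m.+1 ^ 2) x i * (g (eps i w) - mu) @[m --> \oo] --> 0}.
Proof.
move=> xC.
have v0 : 0 <= v by apply: Rintegral_ge0 => y _; exact: sqr_ge0.
apply: (@ae_cvg0_summable_L2 _ _ _ _ (fun m w => (m.+1 ^ 2)%:R^-1 *
    \sum_(i < m.+1 ^ 2) x i * (g (eps i w) - mu)) (v * C)).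
- move=> m; apply: measurable_funM => //; apply: measurable_sum => i.
  apply: measurable_funM => //; exact: (measurableT_comp mgc (meps i)).
- move=> m; rewrite (_ : (fun _ => _) = fun w => (m.+1 ^ 2)%:R^-1 ^+ 2 *
     (\sum_(i < m.+1 ^ 2) x i * (g (eps i w) - mu)) ^+ 2); last first.
    by apply/funext => w; rewrite exprMn.
  by apply: rintegrableZ; exact: (iid_second_moment x _).1.
- move=> m; under eq_Rintegral do rewrite exprMn.
  have [i1 i2] := iid_second_moment x (m.+1 ^ 2).
  rewrite RintegralZl// i2 mulrCA -[leRHS]mulrA ler_wpM2l//.
  rewrite -ler_pdivlMl ?exprn_gt0 ?invr_gt0 ?ltr0n ?expn_gt0//.
  apply: le_trans (xC _) _.
  rewrite le_eqVlt; apply/orP; left; apply/eqP.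
  by rewrite natrX; field; rewrite nat1r pnatr_eq0.
Qed.

End strong_law.

Section strong_laws.
Context d (T : measurableType d) d' (T' : measurableType d') {R : realType}.
Variables (P : probability T R) (eps : nat -> T -> T') (F : probability T' R).
Hypothesis heps : iid P eps F.

Lemma slln_nonneg (g : T' -> R) : measurable_fun setT g ->
  rintegrable F (fun x => g x ^+ 2) -> (forall x, 0 <= g x) ->
  {ae P, forall w, n%:R^-1 * \sum_(i < n) g (eps i w) @[n --> \oo] -->
    \int[F]_x g x}.
Proof.
move=> mg g2 g0.
have h1 n : \sum_(i < n) (1 : R) ^+ 2 <= 1 * n%:R.
  by rewrite sumr_const card_ord expr1n mul1r.
have := slln_squares heps mg g2 (x := fun=> 1) (C := 1) h1; apply: filterS => w hw.
apply: (@interpolate_nonneg _ (fun i => g (eps i w))) => // {h1}.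
rewrite -[X in _ --> X]add0r.
have h : (m.+1 ^ 2)%:R^-1 * \sum_(i < m.+1 ^ 2) 1 * (g (eps i w) - \int[F]_x g x)
    + \int[F]_x g x @[m --> \oo] --> 0 + \int[F]_x g x.
  by apply: cvgD => //; exact: cvg_cst.
apply: cvg_trans h; apply: near_eq_cvg.
apply: nearW => m /=; under eq_bigr do rewrite mul1r.
rewrite sumrB mulrBr sumr_const card_ord -[X in _ - _ * X]mulr_natl mulrA mulVf ?mul1r ?subrK//.
Qed.

(** Weighted sums have no sign, so monotonicity is replaced by [interpolate_weighted]. That lemma
    needs the averages of g^2 to converge, hence the fourth moment of [g]. *)
Lemma slln_weighted (g : T' -> R) (x : nat -> R) (C : R) : measurable_fun setT g ->
  rintegrable F (fun z => g z ^+ 4) -> \int[F]_z g z = 0 ->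
  (forall n, \sum_(i < n) x i ^+ 2 <= C * n%:R) ->
  {ae P, forall w, n%:R^-1 * \sum_(i < n) x i * g (eps i w) @[n --> \oo] --> 0}.
Proof.
move=> mg g4 gm xC.
have mg2 : measurable_fun setT (fun z => g z ^+ 2) by exact: measurable_funX.
have g22 : rintegrable F (fun z => (g z ^+ 2) ^+ 2).
  by under eq_fun do rewrite -exprM.
have g2 := rintegrable_L2 mg2 g22.
have h1 := slln_nonneg mg2 g22 (fun z => sqr_ge0 _).
have h2 := slln_squares heps mg g2 xC.
apply: filterS2 h1 h2 => w h1 h2.
apply: (@interpolate_weighted _ x (fun i => g (eps i w)) _ _ xC h1).
by apply: cvg_trans h2; apply: near_eq_cvg; apply: nearW => m /=;
  congr (_ * _); apply: eq_bigr => i _; rewrite gm subr0.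
Qed.

End strong_laws.

(** * The law of the bootstrap sample *)

Section bootstrap_law.
Context {R : realType} (n r : nat).
Variable E : 'M[R]_(n, r).

Definition centered (j : 'I_n) : 'cV[R]_r := obs E j - mean_obs E.

Definition resample (s : {ffun 'I_n -> 'I_n}) : 'M[R]_(n, r) :=
  \matrix_(i, j) centered (s i) j ord0.

Definition unifw (_ _ : 'I_n) : R := n%:R^-1.

Lemma unifw_ge0 i j : 0 <= unifw i j.
Proof. by rewrite invr_ge0. Qed.

Lemma unifw_sum1 i : \sum_j unifw i j = 1.
Proof.
rewrite sumr_const card_ord /unifw -[_ *+ n]mulr_natl divff// pnatr_eq0 -lt0n.
exact: leq_ltn_trans (ltn_ord i).
Qed.

Lemma obs_resample s i : obs (resample s) i = centered (s i).
Proof. by apply/matrixP => a b; rewrite ord1 !mxE. Qed.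

Lemma obs_inj (A B : 'M[R]_(n, r)) : obs A =1 obs B -> A = B.
Proof.
move=> h; apply/matrixP => i j.
by have /matrixP/(_ j ord0) := h i; rewrite !mxE.
Qed.

Lemma measurable_mx_set1 m k (v : 'M[R]_(m, k)) : measurable [set v].
Proof.
have mf : measurable_fun setT (fun x : 'M[R]_(m, k) => `|x - v|).
  apply: (measurableT_comp (@measurable_mx_norm R m k)).
  apply: measurable_fun_mx => i j; under eq_fun do rewrite !mxE.
  by apply: measurable_funB => //; exact: measurable_entry.
rewrite (_ : [set v] = setT `&` (fun x : 'M[R]_(m, k) => `|x - v|) @^-1` [set 0]).
  exact: mf.
rewrite setTI; apply/seteqP; split => x /=; first by move=> ->; rewrite subrr normr0.
by move/normr0_eq0/eqP; rewrite subr_eq0 => /eqP.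
Qed.

Context d (T : measurableType d) (P : probability T R).
Variable epsB : T -> 'M[R]_(n, r).
Hypothesis hB : iid P (fun i t => obs (epsB t) i) (empirical_centered E).

Let mult (j : 'I_n) : R := \sum_k (centered k == centered j)%:R.

Let mult_gt0 j : 0 < mult j.
Proof.
rewrite /mult (bigD1 j)//= eqxx ltr_pwDl// sumr_ge0//.
Qed.

(* Distinct s may resample the same matrix when residuals are tied; the division by
   the multiplicities splits the event of that matrix evenly among them. *)
Let K (s : {ffun 'I_n -> 'I_n}) (t : T) : R :=
  \prod_i ((mult (s i))^-1 * (obs (epsB t) i == centered (s i))%:R).

Let K_ge0 s t : 0 <= K s t.
Proof. by apply: prodr_ge0 => i _; rewrite mulr_ge0// invr_ge0 ltW. Qed.

Let K_neq0 s t : K s t != 0 -> epsB t = resample s.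
Proof.
move=> K0; apply: obs_inj => i; rewrite obs_resample; apply/eqP.
apply: contraNT K0 => h; rewrite /K (bigD1 i)//= (negbTE h).
by rewrite mulr0 mul0r.
Qed.

(** The sum over [s] factors over rows, and the factor of row i is 1 if the row is one of the
    centered residuals and 0 otherwise. So [K] is a partition of unity on the event that all rows
    are attained values. *)
Let K_sum t : (\sum_s K s t = 0) \/ (\sum_s K s t = 1).
Proof.
rewrite /K (wexp_prod (fun i j => (mult j)^-1 * (obs (epsB t) i == centered j)%:R)).
have h i : (\sum_j (mult j)^-1 * (obs (epsB t) i == centered j)%:R = 0) \/
    (\sum_j (mult j)^-1 * (obs (epsB t) i == centered j)%:R = 1 :> R).
  have [/existsP[j /eqP hj]|hn] := boolP [exists j, obs (epsB t) i == centered j].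
    right; rewrite hj.
    transitivity (\sum_k (mult j)^-1 * (centered k == centered j)%:R).
      apply: eq_bigr => k _; rewrite eq_sym; case: eqP => [kj|_]; last by rewrite !mulr0.
      by rewrite /mult kj.
    by rewrite -mulr_sumr mulVf// gt_eqF.
  left; apply: big1 => j _.
  move: hn; rewrite negb_exists => /forallP/(_ j)/negbTE ->.
  by rewrite mulr0.
have [/existsP[i /eqP h0]|hn] :=
    boolP [exists i, \sum_j (mult j)^-1 * (obs (epsB t) i == centered j)%:R == 0].
  by left; rewrite (bigD1 i)//= h0 mul0r.
right; apply: big1 => i _; have [h0|//] := h i.
by move: hn; rewrite negb_exists => /forallP/(_ i); rewrite h0 eqxx.
Qed.

Let mobs i : measurable_fun setT (fun t => obs (epsB t) i).
Proof. by case: hB. Qed.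

Let obs_set i j : measurable [set t | obs (epsB t) i = centered j].
Proof.
rewrite -[X in measurable X]setTI.
exact: (mobs i measurableT (measurable_mx_set1 (centered j))).
Qed.

Let K_indic s t : K s t = (\prod_i (mult (s i))^-1) *
  \1_(\bigcap_(i in [set` enum 'I_n]) [set t | obs (epsB t) i = centered (s i)]) t.
Proof.
rewrite /K big_split/=; congr (_ * _); rewrite indicE.
case: (boolP (t \in _)) => [|h].
  rewrite inE /= => h; apply: big1 => i _; rewrite h ?eqxx//=.
  by rewrite mem_enum.
have [/forallP hall|] := boolP [forall i, obs (epsB t) i == centered (s i)].
  by exfalso; move/negP: h; apply; rewrite inE => i _; exact/eqP.
rewrite negb_forall => /existsP[i hi].
by rewrite (bigD1 i)//= (negbTE hi) mul0r.
Qed.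

Let mB s : measurable
  (\bigcap_(i in [set` enum 'I_n]) [set t | obs (epsB t) i = centered (s i)]).
Proof.
apply: fin_bigcap_measurable; first exact: finite_seq.
by move=> i _; exact: obs_set.
Qed.

(** A row equals a given centered residual with probability its multiplicity over n; the
    multiplicities cancel and the uniform weight of [s] remains. *)
Let K_int s : rintegrable P (K s) /\ \int[P]_t K s t = prodw unifw s.
Proof.
have -> : K s = fun t => (\prod_i (mult (s i))^-1) *
  \1_(\bigcap_(i in [set` enum 'I_n]) [set t | obs (epsB t) i = centered (s i)]) t.
  by apply/funext => t; exact: K_indic.
have ii : rintegrable P (\1_(\bigcap_(i in [set` enum 'I_n])
    [set t | obs (epsB t) i = centered (s i)])).
  apply: (@bounded_integrable _ _ _ _ _ 1); first exact: measurable_indic.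
  by move=> t; rewrite indicE; case: (_ \in _); rewrite ?normr1 ?normr0.
split; first exact: rintegrableZ.
rewrite RintegralZl// /Rintegral integral_indic// setIT.
case: hB => _ ind law.
have := ind (enum 'I_n) (fun i => [set centered (s i)]) (enum_uniq _).
rewrite /preimage/= => ->; last by move=> i; exact: measurable_mx_set1.
have pE i : P [set t | obs (epsB t) i = centered (s i)] = (n%:R^-1 * mult (s i))%:E.
  have := law i _ (measurable_mx_set1 (centered (s i))); rewrite /preimage/= => ->.
  rewrite /empirical_centered EFinM; congr (_ * _)%E.
  rewrite /mult -sumEFin; apply: eq_bigr => k _.
  rewrite /dirac indicE -/(centered k); congr (_%:E); congr (_%:R).
  by case: eqP => [->|ne]; [rewrite mem_set|rewrite memNset].
rewrite (eq_bigr _ (fun i _ => pE i)).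
have -> : (\prod_(i <- enum 'I_n) (n%:R^-1 * mult (s i))%:E)%E =
    (\prod_i (n%:R^-1 * mult (s i)))%:E.
  rewrite -big_enum; elim: (enum _) => [|i l IH]; first by rewrite !big_nil.
  by rewrite !big_cons IH.
rewrite -big_split/=; apply: eq_bigr => i _.
by rewrite mulrCA mulVf ?mulr1// gt_eqF.
Qed.

(** Integrating against [K] carries expectations on an arbitrary bootstrap space to the finite space
    of resampling maps. The predicate [good] leaves room for statistics that are arbitrary on an
    exceptional event, such as a singular bootstrap covariance. *)
Lemma bootstrap_law (G : T -> R) (Phi : 'M[R]_(n, r) -> R)
    (good : pred 'M[R]_(n, r)) (C : R) :
  measurable_fun setT G -> (forall t, `|G t| <= C) -> (forall A, `|Phi A| <= C) ->
  (forall t, good (epsB t) -> G t = Phi (epsB t)) ->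
  `|\int[P]_t G t - wexp (prodw unifw) (fun s => Phi (resample s))| <=
  2 * C * wexp (prodw unifw) (fun s => (~~ good (resample s))%:R).
Proof.
move=> mG GC PC GP.
have C0 : 0 <= C by have := PC 0; apply: le_trans.
have iG : rintegrable P G by apply: (@bounded_integrable _ _ _ P G C).
pose Ps t := \sum_s Phi (resample s) * K s t.
have iP : rintegrable P Ps.
  by apply: rintegrable_sum => s _; apply: rintegrableZ; exact: (K_int s).1.
have PsE : \int[P]_t Ps t = wexp (prodw unifw) (fun s => Phi (resample s)).
  rewrite /Ps Rintegral_sum; last by move=> s; apply: rintegrableZ; exact: (K_int s).1.
  apply: eq_bigr => s _; rewrite RintegralZl//; last exact: (K_int s).1.
  by rewrite (K_int s).2 mulrC.
(* The first term pays for points where the kernel vanishes, and integrates to 0 because the weights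
   sum to 1; the second pays for the resamples that are not [good]. *)
pose B t := 2 * C * (1 - \sum_s K s t) +
  \sum_s (2 * C * (~~ good (resample s))%:R) * K s t.
have iS : rintegrable P (fun t => \sum_s K s t).
  by apply: rintegrable_sum => s _; exact: (K_int s).1.
have iB1 : rintegrable P (fun t => 2 * C * (1 - \sum_s K s t)).
  by apply: rintegrableZ; apply: rintegrableB => //; exact: rintegrable_cst.
have iB2 : rintegrable P (fun t => \sum_s (2 * C * (~~ good (resample s))%:R) * K s t).
  by apply: rintegrable_sum => s _; apply: rintegrableZ; exact: (K_int s).1.
have BE : \int[P]_t B t =
    2 * C * wexp (prodw unifw) (fun s => (~~ good (resample s))%:R).
  rewrite /B RintegralD// RintegralZl//; last first.
    by apply: rintegrableB => //; exact: rintegrable_cst.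
  rewrite RintegralB//; last exact: rintegrable_cst.
  rewrite Rintegral_cst1 Rintegral_sum; last by move=> s; exact: (K_int s).1.
  rewrite (eq_bigr (prodw unifw)); last by move=> s _; exact: (K_int s).2.
  rewrite (prodw_sum1 unifw_sum1) subrr mulr0 add0r.
  rewrite Rintegral_sum; last by move=> s; apply: rintegrableZ; exact: (K_int s).1.
  rewrite mulr_sumr; apply: eq_bigr => s _.
  rewrite RintegralZl//; last exact: (K_int s).1.
  by rewrite (K_int s).2; ring.
rewrite -PsE -BE -RintegralB// (le_trans (le_normr_Rintegral _ _))//.
  exact: rintegrableB.
apply: le_Rintegral => //.
- by apply: (integrable_abse (f := EFin \o _)); exact: rintegrableB.
- exact: rintegrableD.
move=> t _; rewrite /B /Ps.
have [S0|S1] := K_sum t.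
  have K0 s : K s t = 0.
    by have /psumr_eq0P := S0; apply => //.
  rewrite S0 subr0 mulr1 !big1 ?addr0 ?subr0; last 2 first.
  - by move=> s _; rewrite K0 mulr0.
  - by move=> s _; rewrite K0 mulr0.
  by rewrite (le_trans (GC t))// ler_peMl// ler1n.
rewrite S1 subrr mulr0 add0r -[G t]mulr1 -[X in G t * X]S1 mulr_sumr -sumrB.
rewrite (le_trans (ler_norm_sum _ _ _))//; apply: ler_sum => s _.
rewrite -mulrBl normrM (ger0_norm (K_ge0 s t)).
have [->|Kn] := eqVneq (K s t) 0; first by rewrite !mulr0.
rewrite ler_wpM2r// -(K_neq0 Kn).
case: (boolP (good (epsB t))) => [/GP ->|_]; first by rewrite subrr normr0 mulr0.
by rewrite mulr1 (le_trans (ler_normB _ _))// mulr_natl mulr2n lerD.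
Qed.

End bootstrap_law.

(** * The Lindeberg estimate *)

Section trigonometric_bounds.
Context {R : realType}.
Implicit Types x : R.

Lemma sin_le_id x : 0 <= x -> sin x <= x.
Proof.
rewrite le_eqVlt => /orP[/eqP <-|x0]; first by rewrite sin0.
have [c _] := @MVT R sin cos 0 x x0 (fun y _ => is_derive_sin y)
  (continuous_subspaceT (@continuous_sin R)).
by rewrite sin0 !subr0 => ->; rewrite ler_piMl ?cos_le1// ltW.
Qed.

Lemma abs_sin_le x : `|sin x| <= `|x|.
Proof.
wlog x0 : x / 0 <= x => [h|].
  have [/h//|/ltW x0] := leP 0 x.
  by rewrite -[`|sin x|]normrN -[`|x|]normrN -sinN h// oppr_ge0.
rewrite (ger0_norm x0) ler_norml sin_le_id// andbT.
move: x0; rewrite le_eqVlt => /orP[/eqP <-|x0]; first by rewrite sin0 oppr0.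
have [c' _] := @MVT R sin cos 0 x x0 (fun y _ => is_derive_sin y)
  (continuous_subspaceT (@continuous_sin R)).
rewrite sin0 !subr0 => ->; rewrite -mulN1r; apply: ler_wpM2r; first exact: ltW.
exact: cos_geN1.
Qed.

Lemma cos_lower x : 1 - cos x <= x ^+ 2 / 2.
Proof.
have -> : 1 - cos x = 2 * sin (x / 2) ^+ 2.
  rewrite {1}(_ : x = (x / 2) *+ 2); last by rewrite -mulr_natr; field.
  by rewrite cos_mulr2n sin2cos2; ring.
have h := abs_sin_le (x / 2).
have : sin (x / 2) ^+ 2 <= (x / 2) ^+ 2.
  by rewrite -(real_normK (num_real (sin _))) -(real_normK (num_real (x / 2))) ler_sqr ?nnegrE.
by rewrite expr_div_n; lra.
Qed.

Lemma sin_lower x : 0 <= x -> 0 <= x - sin x <= x ^+ 3 / 2.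
Proof.
move=> x0; rewrite subr_ge0 sin_le_id//=.
move: x0; rewrite le_eqVlt => /orP[/eqP <-|x0]; first by rewrite sin0 expr0n mul0r subr0.
have df y : y \in `](0 : R), x[ ->
    is_derive y (1 : R) (id - sin : R -> R) (1 - cos y) by move=> _; exact: is_deriveB.
have cf : {within `[0, x], continuous (id - sin : R -> R)}.
  by apply: continuous_subspaceT => y; apply: continuousB; [exact: cvg_id|exact: continuous_sin].
have [c] := @MVT R (id - sin) (fun y => 1 - cos y) 0 x x0 df cf.
rewrite in_itv/= => /andP[c0 cx]; rewrite !fctE sin0 !subr0 => ->.
apply: (@le_trans _ _ (c ^+ 2 / 2 * x)).
  by rewrite ler_wpM2r ?cos_lower// ltW.
rewrite mulrAC ler_pM2r// [x ^+ 3]exprSr; apply: ler_wpM2r; first exact: ltW.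
by apply: lerXn2r; rewrite ?nnegrE; exact: ltW.
Qed.

Lemma cos_upper x : 0 <= x -> 0 <= cos x - 1 + x ^+ 2 / 2 <= x ^+ 4 / 2.
Proof.
move=> x0; apply/andP; split; first by have := cos_lower x; lra.
move: x0; rewrite le_eqVlt => /orP[/eqP <-|x0].
  by rewrite cos0 !expr0n/= !mul0r; lra.
pose f : R -> R := fun y => cos y - 1 + y ^+ 2 / 2.
have df (y : R) : is_derive y (1 : R) f (y - sin y).
  have -> : f = (cos + (cst (-1) + cst (2^-1) * (id * id)))%R.
    by apply/funext => z; rewrite /f !fctE expr2 [2^-1 * _]mulrC addrA.
  apply: (is_derive_eq (is_deriveD (is_derive_cos y)
    (is_deriveD (is_derive_cst (-1 : R) y 1) (is_deriveM (is_derive_cst (2^-1 : R) y 1)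
    (is_deriveM (is_derive_id y 1) (is_derive_id y 1)))))).
  by rewrite !fctE /GRing.scale/=; field.
have cf : {within `[0, x], continuous f}.
  apply: continuous_subspaceT => y; apply/differentiable_continuous/derivable1_diffP.
  by have [] := df y.
have [c] := @MVT R f (fun y => y - sin y) 0 x x0 (fun y _ => df y) cf.
rewrite in_itv/= => /andP[c0 cx].
rewrite /f cos0 expr0n mul0r addr0 subrr !subr0 => ->.
apply: (@le_trans _ _ (c ^+ 3 / 2 * x)).
  by rewrite ler_wpM2r ?(ltW x0)//; have /andP[] := sin_lower (ltW c0).
rewrite mulrAC ler_pM2r// [x ^+ 4]exprSr; apply: ler_wpM2r; first exact: ltW.
by apply: lerXn2r; rewrite ?nnegrE; exact: ltW.
Qed.

(** Joint majorant, up to a constant, of the remainders of cos to second order and of sin to first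
    order: cubic near 0, quadratic at infinity. *)
Definition lind (x : R) : R := x ^+ 2 * Num.min 1 `|x|.

Lemma lind_ge0 x : 0 <= lind x.
Proof. by rewrite mulr_ge0 ?sqr_ge0// le_min ler01 normr_ge0. Qed.

Lemma lind_norm x : lind `|x| = lind x.
Proof. by rewrite /lind normr_id real_normK ?num_real. Qed.

Lemma le_lind x y : `|x| <= `|y| -> lind x <= lind y.
Proof.
move=> xy; rewrite -(lind_norm x) -(lind_norm y) /lind !normr_id ler_pM ?sqr_ge0//.
- by rewrite ler_sqr ?nnegrE.
- by rewrite le_min !ge_min lexx/= xy orbT.
Qed.

Lemma cos_lind x : `|cos x - 1 + x ^+ 2 / 2| <= lind x.
Proof.
rewrite -(lind_norm x) -(cos_norm x) -(real_normK (num_real x)).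
move: (normr_ge0 x); move: (`|x|) => y y0.
have /andP[h1 h2] := cos_upper y0; have := cos_le1 y.
rewrite (ger0_norm h1) /lind (ger0_norm y0) => h3.
have [y1|y1] := leP 1 y; first by rewrite mulr1; have := sqr_ge0 y; nra.
apply: (le_trans h2); rewrite -exprSr [y ^+ 4]exprSr -mulrA ler_piMr ?exprn_ge0//; lra.
Qed.

Lemma sin_lind x : `|sin x - x| <= 2 * lind x.
Proof.
rewrite -(lind_norm x).
have -> : `|sin x - x| = `|sin `|x| - `|x| |.
  case: (leP 0 x) => x0; rewrite ?(ger0_norm x0)// (ltr0_norm x0) sinN.
  by rewrite -normrN opprB addrC opprK.
move: (normr_ge0 x); move: (`|x|) => y y0.
have /andP[h1 h2] := sin_lower y0.
rewrite distrC (ger0_norm h1) /lind (ger0_norm y0).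
have [y1|y1] := leP 1 y.
  by rewrite mulr1; have := sin_geN1 y; nra.
apply: (le_trans h2); rewrite -exprSr; have : 0 <= y ^+ 3 by rewrite exprn_ge0.
lra.
Qed.

(** 1 - u <= exp (-u) <= 1/(1 + u) <= 1 - u + u^2. *)
Lemma expRN_bound (u : R) : 0 <= u -> `|expR (- u) - (1 - u)| <= u ^+ 2.
Proof.
move=> u0; rewrite ger0_norm ?subr_ge0 ?expR_ge1Dx//.
have : expR (- u) <= (1 + u)^-1.
  by rewrite expRN lef_pV2 ?posrE ?expR_gt0 ?expR_ge1Dx// ltr_wpDr.
move=> h; rewrite lerBlDr (le_trans h)//.
rewrite -[leLHS]mul1r ler_pdivrMr ?ltr_wpDr//.
have : 0 <= u ^+ 3 by rewrite exprn_ge0.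
rewrite exprS; nra.
Qed.

End trigonometric_bounds.

(** The factors are exchanged one at a time, while all the others have modulus at most 1. *)
Lemma norm_prod_sub_le (C : numFieldType) (I : Type) (r : seq I) (a b : I -> C) :
  (forall i, `|a i| <= 1) -> (forall i, `|b i| <= 1) ->
  `|\prod_(i <- r) a i - \prod_(i <- r) b i| <= \sum_(i <- r) `|a i - b i|.
Proof.
move=> a1 b1; elim: r => [|i r IH]; first by rewrite !big_nil subrr normr0.
rewrite !big_cons.
have -> : a i * \prod_(j <- r) a j - b i * \prod_(j <- r) b j =
    (a i - b i) * \prod_(j <- r) a j + b i * (\prod_(j <- r) a j - \prod_(j <- r) b j).
  by rewrite mulrBl mulrBr addrA subrK.
rewrite (le_trans (ler_normD _ _))// lerD// normrM.
  rewrite ler_piMr// normr_prod; elim: (r) => [|j s IHs]; first by rewrite big_nil.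
  by rewrite big_cons mulr_ile1// prodr_ge0.
by apply: le_trans IH; rewrite ler_piMl.
Qed.

Section lindeberg.
Context {R : realType} (I T : finType) (w : I -> T -> R) (xi : I -> T -> R).
Hypothesis w_ge0 : forall i j, 0 <= w i j.
Hypothesis w_sum1 : forall i, \sum_j w i j = 1.
Hypothesis xi_mean : forall i, \sum_j w i j * xi i j = 0.

Let q i := \sum_j w i j * xi i j ^+ 2.

Let cis (x : R) : R[i] := Complex (cos x) (sin x).

Let cisD x y : cis (x + y) = cis x * cis y.
Proof. by rewrite /cis cosD sinD; simpc; congr (Complex _ _); rewrite addrC mulrC. Qed.

Let cis_sum (J : Type) (r : seq J) (f : J -> R) :
  cis (\sum_(j <- r) f j) = \prod_(j <- r) cis (f j).
Proof.
elim: r => [|j r IH]; first by rewrite !big_nil /cis cos0 sin0.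
by rewrite !big_cons cisD IH.
Qed.

Let ReD (x y : R[i]) : complex.Re (x + y) = complex.Re x + complex.Re y.
Proof. by case: x; case: y. Qed.

Let Re_sum (J : Type) (r : seq J) (f : J -> R[i]) :
  complex.Re (\sum_(j <- r) f j) = \sum_(j <- r) complex.Re (f j).
Proof. by elim: r => [|j r IH]; rewrite ?big_nil// !big_cons ReD IH. Qed.

Let Im_sum (J : Type) (r : seq J) (f : J -> R[i]) :
  complex.Im (\sum_(j <- r) f j) = \sum_(j <- r) complex.Im (f j).
Proof. by elim: r => [|j r IH]; rewrite ?big_nil// !big_cons -IH; case: (f j); case: (\sum_(_ <- r) _). Qed.

(** Characteristic function of the i-th summand. Complex numbers are used only here, because
    independence turns the transform of a sum into a product only in exponential form. *)
Let z i : R[i] := \sum_j (w i j)%:C%C * cis (xi i j).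

Let Re_z i : complex.Re (z i) = \sum_j w i j * cos (xi i j).
Proof. by rewrite /z Re_sum; apply: eq_bigr => j _ /=; rewrite mul0r subr0. Qed.

Let Im_z i : complex.Im (z i) = \sum_j w i j * sin (xi i j).
Proof. by rewrite /z Im_sum; apply: eq_bigr => j _ /=; rewrite mul0r addr0. Qed.

Let norm_cis x : `|cis x| = 1.
Proof. by rewrite normc_def /= cos2Dsin2 sqrtr1. Qed.

Let norm_real (a : R) : `|a%:C%C| = (`|a|)%:C%C.
Proof. by rewrite normc_def /= expr0n addr0 sqrtr_sqr. Qed.

Let norm_z i : `|z i| <= 1.
Proof.
rewrite (le_trans (ler_norm_sum _ _ _))//.
have -> : 1 = \sum_j (w i j)%:C%C :> R[i].
  by rewrite -(rmorph_sum (real_complex R)) w_sum1.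
apply: ler_sum => j _; rewrite normrM norm_cis mulr1 norm_real.
by rewrite (ger0_norm (w_ge0 i j)).
Qed.

Let q_ge0 i : 0 <= q i.
Proof. by apply: sumr_ge0 => j _; rewrite mulr_ge0 ?sqr_ge0. Qed.

(** The real part costs one [lind], the imaginary part two, and replacing 1 - q/2 by its exponential
    costs q^2. *)
Let delta i : R := 3 * (\sum_j w i j * lind (xi i j)) + q i ^+ 2.

Let z_approx i : `|z i - (expR (- (q i / 2)))%:C%C| <= (delta i)%:C%C.
Proof.
have -> : z i - (expR (- (q i / 2)))%:C%C =
    (complex.Re (z i) - expR (- (q i / 2)))%:C%C + 'i%C * (complex.Im (z i))%:C%C.
  by case: (z i) => a b; simpc.
rewrite (le_trans (ler_normD _ _))// normrM !norm_real.
have -> : `|'i%C : R[i]| = 1 by rewrite normc_def /= expr0n expr1n add0r sqrtr1.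
rewrite mul1r -rmorphD/= lecR.
have L0 : 0 <= \sum_j w i j * lind (xi i j).
  by apply: sumr_ge0 => j _; rewrite mulr_ge0 ?lind_ge0.
have hI : `|complex.Im (z i)| <= 2 * \sum_j w i j * lind (xi i j).
  have -> : complex.Im (z i) = \sum_j w i j * (sin (xi i j) - xi i j).
    rewrite (eq_bigr (fun j => w i j * sin (xi i j) - w i j * xi i j)).
      by rewrite sumrB xi_mean subr0 Im_z.
    by move=> j _; rewrite mulrBr.
  rewrite (le_trans (ler_norm_sum _ _ _))//.
  rewrite mulr_sumr; apply: ler_sum => j _.
  by rewrite normrM (ger0_norm (w_ge0 i j)) mulrCA ler_wpM2l// sin_lind.
have hR : `|complex.Re (z i) - (1 - q i / 2)| <= \sum_j w i j * lind (xi i j).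
  have -> : complex.Re (z i) - (1 - q i / 2) =
      \sum_j w i j * (cos (xi i j) - 1 + xi i j ^+ 2 / 2).
    rewrite (eq_bigr (fun j => w i j * cos (xi i j) - w i j +
        w i j * xi i j ^+ 2 / 2)); last by move=> j _; field.
    by rewrite big_split/= sumrB -mulr_suml w_sum1 Re_z opprB addrA addrAC.
  rewrite (le_trans (ler_norm_sum _ _ _))//; apply: ler_sum => j _.
  by rewrite normrM (ger0_norm (w_ge0 i j)) ler_wpM2l// cos_lind.
have hE : `|expR (- (q i / 2)) - (1 - q i / 2)| <= q i ^+ 2.
  apply: (le_trans (expRN_bound _)); first by rewrite divr_ge0.
  by rewrite expr_div_n ler_pdivrMr//; have := sqr_ge0 (q i); rewrite expr2; nra.
rewrite distrC in hE.
apply: le_trans (lerD (ler_distD (1 - q i / 2) _ _) hI) _.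
by rewrite /delta; lra.
Qed.

Lemma lindeberg_cos (th : R) :
  `|wexp (prodw w) (fun s => cos (th + \sum_i xi i (s i)))
    - cos th * expR (- (\sum_i q i) / 2)| <=
  \sum_i (3 * (\sum_j w i j * lind (xi i j)) + q i ^+ 2).
Proof.
have prodE : \prod_i z i = \sum_(s : {ffun I -> T})
    (prodw w s)%:C%C * cis (\sum_i xi i (s i)).
  rewrite /z -wexp_prod; apply: eq_bigr => s _.
  by rewrite big_split/= cis_sum /prodw (rmorph_prod (real_complex R)).
have E1 : wexp (prodw w) (fun s => cos (th + \sum_i xi i (s i))) =
    complex.Re (cis th * \prod_i z i).
  rewrite prodE mulr_sumr Re_sum; apply: eq_bigr => s _.
  by rewrite mulrCA -cisD /= mul0r subr0.
have E2 : cos th * expR (- (\sum_i q i) / 2) =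
    complex.Re (cis th * \prod_i (expR (- (q i / 2)))%:C%C).
  rewrite -(rmorph_prod (real_complex R)) /= mulr0 subr0; congr (_ * _).
  rewrite -expR_sum; congr expR.
  by rewrite mulNr mulr_suml sumrN.
have ReB (x y : R[i]) : complex.Re x - complex.Re y = complex.Re (x - y).
  by case: x; case: y.
rewrite E1 E2 ReB -mulrBr -lecR.
apply: le_trans (normc_ge_Re _) _.
rewrite normrM norm_cis mul1r rmorph_sum.
apply: (le_trans (norm_prod_sub_le _ norm_z _)).
  move=> i; rewrite norm_real lecR ger0_norm ?expR_ge0//.
  by rewrite -expR0 ler_expR oppr_le0 divr_ge0.
by apply: ler_sum => i _; exact: z_approx.
Qed.

End lindeberg.

(** * Vectorization and the Kronecker product *)

Lemma index_allpairs (S T : eqType) (s : seq S) (t : seq T) x y :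
  x \in s -> y \in t ->
  index (x, y) [seq (a, b) | a <- s, b <- t] =
  (index x s * size t + index y t)%N.
Proof.
move=> + yt; elim: s => //= a s IH; rewrite inE index_cat size_map.
have [-> _|ax xs] := eqVneq x a.
  by rewrite map_f// index_map// => ? ? [].
rewrite IH//.
by case: mapP => [[b _ [xa _]]|_]; [rewrite xa eqxx in ax|rewrite mulSn addnA].
Qed.

(** Both indexings list pairs row by row; this lets [vec] and the Kronecker product be computed in
    the same coordinates. *)
Lemma mxvec_index_tens m n (i : 'I_m) (j : 'I_n) :
  mxvec_index i j = mxtens_index (i, j).
Proof.
apply: val_inj => /=; rewrite /enum_rank [enum_rank_in]unlock /insubd/=.
rewrite insubT /=; first by rewrite cardE index_mem mem_enum.
move=> _; rewrite enumT unlock /= /prod_enum.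
rewrite index_allpairs ?mem_enum//.
by rewrite !index_enum_ord size_enum_ord.
Qed.

Section vectorization.
Context {R : realType}.

Lemma vecE m n (A : 'M[R]_(m, n)) (a : 'I_n) (b : 'I_m) k :
  vec A (mxvec_index a b) k = A b a.
Proof. by rewrite ord1 /vec mxE mxvecE mxE. Qed.

Lemma vecP m n (u v : 'cV[R]_(n * m)) :
  (forall a b, u (mxvec_index a b) ord0 = v (mxvec_index a b) ord0) -> u = v.
Proof. by move=> h; apply/matrixP => i j; rewrite ord1; case/mxvec_indexP: i => a b. Qed.

Lemma vec_surj m n (t : 'cV[R]_(n * m)) : exists A : 'M[R]_(m, n), t = vec A.
Proof. by exists (vec_mx t^T)^T; rewrite /vec trmxK vec_mxK trmxK. Qed.

Lemma vecB m n (A B : 'M[R]_(m, n)) : vec A - vec B = vec (A - B).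
Proof. by rewrite /vec linearB/= linearB/= linearB. Qed.

Lemma vecZ m n c (A : 'M[R]_(m, n)) : c *: vec A = vec (c *: A).
Proof. by rewrite /vec linearZ/= linearZ/= linearZ. Qed.

Lemma sum_mxvec_index m n (f : 'I_(m * n) -> R) :
  \sum_i f i = \sum_a \sum_b f (mxvec_index a b).
Proof.
by rewrite pair_big/= (reindex _ (curry_mxvec_bij m n)); apply: eq_bigr => -[].
Qed.

Lemma tens_mul_vec m n k l (A : 'M[R]_(k, n)) (B : 'M[R]_(l, m))
    (C : 'M[R]_(m, n)) : (A *t B) *m vec C = vec (B *m C *m A^T).
Proof.
apply: vecP => a b; rewrite vecE !mxE sum_mxvec_index.
apply: eq_bigr => c _; rewrite !mxE mulr_suml; apply: eq_bigr => d _.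
by rewrite !mxvec_index_tens mxE !mxtens_indexK/= -!mxvec_index_tens vecE; ring.
Qed.

Lemma dotc_vec m n (A B : 'M[R]_(m, n)) :
  dotc (vec A) (vec B) = \sum_b \sum_a A b a * B b a.
Proof.
rewrite /dotc sum_mxvec_index exchange_big.
by apply: eq_bigr => b _; apply: eq_bigr => a _; rewrite !vecE.
Qed.

End vectorization.

Lemma cvg_sumr0 {R : realType} {T} {F : set_system T} {FF : Filter F} I (s : seq I)
    (P : pred I) (f : I -> T -> R) : (forall i, P i -> f i x @[x --> F] --> 0) ->
  \sum_(i <- s | P i) f i x @[x --> F] --> 0.
Proof.
by move=> /cvg_sumr => /(_ s); rewrite big1.
Qed.

(** * Convergence in probability on finite spaces *)

Section convergence_in_probability.
Context {R : realType} (T : nat -> finType) (W : forall n, T n -> R).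
Hypotheses (W0 : forall n x, 0 <= @W n x) (W1 : forall n, \sum_x @W n x = 1).

(* Convergence in probability for the weights W n, phrased as a filter on the disjoint
   union of the sample spaces so that the limit lemmas for filters apply to it. *)
Definition prob_filter : set_system {n & T n} :=
  [set Q | wexp (@W n) (fun x => (~~ `[< Q (existT T n x) >])%:R) @[n --> \oo] --> 0].

Let wexp_pred_ge0 n (b : pred (T n)) : 0 <= wexp (@W n) (fun x => (b x)%:R).
Proof. by apply: wexp_ge0. Qed.

Let squeeze0 (f g : nat -> R) : (forall n, 0 <= f n <= g n) ->
  g n @[n --> \oo] --> 0 -> f n @[n --> \oo] --> 0.
Proof.
move=> fg g0; apply: (@squeeze_cvgr _ _ _ _ (fun=> 0) g) => //.
  by near=> n.
exact: cvg_cst.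
Unshelve. all: by end_near. Qed.

#[global] Instance prob_filter_filter : Filter prob_filter.
Proof.
split.
- rewrite /prob_filter/= (_ : (fun n => _) = (fun=> 0)); first exact: cvg_cst.
  by apply/funext => n; rewrite /wexp big1// => x _; case: asboolP; rewrite ?mulr0.
- move=> A B hA hB; rewrite /prob_filter/=; apply: squeeze0.
    move=> n; rewrite wexp_pred_ge0/=.
    apply: (@le_wexp _ _ _ (@W0 n) _ (fun x => (~~ `[< A (existT T n x) >])%:R +
      (~~ `[< B (existT T n x) >])%:R)) => x.
    by do 3 case: asboolP => //=; rewrite ?addr0 ?add0r ?lerDl// => ? ? [].
  under eq_fun do rewrite wexpD.
  by rewrite -[0]addr0; exact: cvgD.
- move=> A B AB hA; apply: squeeze0 hA => n; rewrite wexp_pred_ge0/=.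
  apply: le_wexp => // x.
  case: asboolP => //= hb; case: asboolP => //= ha.
  by exfalso; apply: hb; apply: AB.
Qed.

Lemma prob_filter_near (Q : set {n & T n}) :
  (\forall n \near \oo, forall x, Q (existT T n x)) -> prob_filter Q.
Proof.
move=> h; rewrite /prob_filter/=; apply: (@cvg_near_cst) => //.
near=> n; rewrite /wexp big1// => x _.
have -> : `[< Q (existT T n x) >]; last by rewrite mulr0.
by apply/asboolP; move: x; near: n.
Unshelve. all: by end_near. Qed.

Lemma tag_prob_filter : @projT1 nat T @ prob_filter --> \oo.
Proof. by move=> A hA; apply: prob_filter_near; apply: filterS hA. Qed.

Lemma cvg_tag_prob_filter (V : topologicalType) (f : nat -> V) (l : V) :
  f n @[n --> \oo] --> l -> f (projT1 x) @[x --> prob_filter] --> l.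
Proof. by move=> h; apply: (cvg_comp _ _ tag_prob_filter h). Qed.

Lemma chebyshev_prob_filter (f : {n & T n} -> R) :
  wexp (@W n) (fun x => f (existT T n x) ^+ 2) @[n --> \oo] --> 0 ->
  f x @[x --> prob_filter] --> 0.
Proof.
move=> h; apply/cvgrPdist_le => e e0; rewrite /prop_near1 /nbhs/= /prob_filter/=.
apply: (@squeeze0 _ (fun n => (e ^+ 2)^-1 * wexp (@W n) (fun x => f (existT T n x) ^+ 2))).
  move=> n; rewrite wexp_pred_ge0/= -wexpZl; apply: le_wexp => // x.
  case: asboolP => /= [_|/negP]; first by rewrite mulr_ge0 ?invr_ge0 ?sqr_ge0.
  rewrite -ltNge sub0r normrN => he.
  rewrite mulrC ler_pdivlMr ?exprn_gt0// mul1r -(real_normK (num_real (f _))).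
  by rewrite ler_sqr ?nnegrE// ltW.
by rewrite -(mulr0 (e ^+ 2)^-1); apply: cvgM => //; exact: cvg_cst.
Qed.

(** Bounded convergence: [f] is at most e/2 off an event of small weight, and at most C on it. Using
    |C| + 1 keeps the divisor positive. *)
Lemma wexp_cvg0_prob_filter (f : {n & T n} -> R) C : (forall x, `|f x| <= C) ->
  f x @[x --> prob_filter] --> 0 ->
  wexp (@W n) (fun x => f (existT T n x)) @[n --> \oo] --> 0.
Proof.
move=> fC /cvgrPdist_le f0; apply/cvgrPdist_le => e e0.
have e20 : 0 < e / 2 by rewrite divr_gt0.
have := f0 _ e20; rewrite /prop_near1 /nbhs/= /prob_filter/= => /cvgrPdist_le.
have d0 : 0 < e / 2 / (`|C| + 1) by rewrite divr_gt0// ltr_wpDl.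
move=> /(_ _ d0); apply: filterS => n; rewrite sub0r normrN ger0_norm ?wexp_pred_ge0// => hn.
rewrite sub0r normrN (le_trans (ler_norm_wexp _ _))//.
apply: (@le_trans _ _ (wexp (@W n) (fun x => e / 2 +
  (`|C| + 1) * (~~ `[< `|0 - f (existT T n x)| <= e / 2 >])%:R))).
  apply: le_wexp => // x; case: asboolP => /= h.
    by rewrite mulr0 addr0 -normrN -sub0r.
  by rewrite mulr1; have := fC (existT T n x); have := ler_norm C; lra.
rewrite wexpD wexp_cst// [leRHS]splitr lerD2l wexpZl.
by move: hn; rewrite ler_pdivlMr ?ltr_wpDl// mulrC.
Qed.

Definition tight (f : {n & T n} -> R) := forall e : R, 0 < e -> exists K : R,
  \forall n \near \oo, wexp (@W n) (fun x => (K < `|f (existT T n x)|)%R%:R) <= e.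

Lemma moment_tight (f : {n & T n} -> R) C :
  (\forall n \near \oo, wexp (@W n) (fun x => f (existT T n x) ^+ 2) <= C) ->
  tight f.
Proof.
(* Chebyshev needs K^2 >= |C|/e; the added 1 makes K positive. *)
move=> hC e e0; exists (Num.sqrt (`|C| / e) + 1); apply: filterS hC => n hn.
set K := _ + 1; have K0 : 0 < K by rewrite ltr_wpDl.
have K2 : `|C| / e <= K ^+ 2.
  rewrite -{1}[`|C| / e]sqr_sqrtr ?divr_ge0 ?(ltW e0)//.
  by rewrite ler_sqr ?nnegrE ?sqrtr_ge0 ?(ltW K0)// /K lerDl.
apply: (@le_trans _ _ ((K ^+ 2)^-1 * wexp (@W n) (fun x => f (existT T n x) ^+ 2))).
  rewrite -wexpZl; apply: le_wexp => // x; case: ltP => h.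
    rewrite mulrC ler_pdivlMr ?exprn_gt0// mul1r -(real_normK (num_real (f _))).
    by rewrite ler_sqr ?nnegrE// ltW.
  by rewrite mulr_ge0 ?invr_ge0 ?sqr_ge0.
rewrite mulrC ler_pdivrMr ?exprn_gt0//.
by move: K2; rewrite ler_pdivrMr// mulrC => /(le_trans _); apply; apply: le_trans hn (ler_norm _).
Qed.

(** Off two events of weight h/2 one has |g| <= K and |f| <= e/(|K| + 1), so the product is at most
    e. *)
Lemma cvg0_tightM (f g : {n & T n} -> R) : f x @[x --> prob_filter] --> 0 -> tight g ->
  f x * g x @[x --> prob_filter] --> 0.
Proof.
move=> /cvgrPdist_le f0 tg; apply/cvgrPdist_le => e e0.
rewrite /prop_near1 /nbhs/= /prob_filter/=; apply/cvgrPdist_le => h h0.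
have h20 : 0 < h / 2 by rewrite divr_gt0.
have [K hK] := tg _ h20.
have K1 : 0 < `|K| + 1 by rewrite ltr_wpDl.
have := f0 (e / (`|K| + 1)); rewrite divr_gt0// => /(_ isT).
rewrite /prop_near1 /nbhs/= /prob_filter/= => /cvgrPdist_le/(_ _ h20).
move=> hf; near=> n.
have hKn : wexp (@W n) (fun x => (K < `|g (existT T n x)|)%R%:R) <= h / 2.
  by near: n.
have hn : wexp (@W n) (fun x => (~~ `[< `|0 - f (existT T n x)| <=
    e / (`|K| + 1) >])%:R) <= h / 2.
  apply: le_trans (ler_norm _) _; rewrite -normrN -sub0r; by near: n.
rewrite sub0r normrN ger0_norm ?wexp_pred_ge0//.
rewrite (splitr h); apply: le_trans (lerD hn hKn); rewrite -wexpD.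
apply: le_wexp => // x; case: asboolP => /= [_|ha].
  by rewrite addr_ge0.
case: asboolP => /= [hb|_]; last by rewrite lerDl.
rewrite add0r; case: ltP => // gK; exfalso; apply: ha.
rewrite sub0r normrN normrM; move: hb; rewrite sub0r normrN ler_pdivlMr// => hb.
apply: le_trans hb; rewrite ler_wpM2l// (le_trans gK)// (le_trans (ler_norm _))//.
by rewrite lerDl.
Unshelve. all: by end_near. Qed.

End convergence_in_probability.

Lemma wexp_prob_filter (R : realType) (T : nat -> finType) (W : forall n, T n -> R)
    (W0 : forall n x, 0 <= W n x) (Q : set {n & T n}) (b : forall n, pred (T n)) :
  prob_filter W Q ->
  (\forall n \near \oo, forall x, Q (existT T n x) -> ~~ b n x) ->
  wexp (W n) (fun x => (b n x)%:R) @[n --> \oo] --> 0.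
Proof.
move=> hQ hb; apply: (squeeze_cvgr _ (cvg_cst 0) hQ); apply: filterS hb => n hb.
rewrite wexp_ge0//=; apply: le_wexp => // x.
by case: asboolP => [/hb /negbTE ->|_] //=; case: (b n x).
Qed.

Lemma cos_lipschitz (R : realType) (x y : R) : `|cos x - cos y| <= `|x - y|.
Proof.
pose m := (x + y) / 2; pose d := (x - y) / 2.
have -> : cos x - cos y = - (2 * sin m * sin d).
  have -> : x = m + d by rewrite /m /d; field.
  by have -> : y = m - d; [rewrite /m /d; field|rewrite cosD cosB; ring].
rewrite normrN !normrM ger0_norm// -mulrA mulrC -ler_pdivlMr//.
have -> : `|x - y| / 2 = `|d| by rewrite /d normrM normfV [`|2|]ger0_norm.
have := abs_sin_le d; have : `|sin m| <= 1 by rewrite ler_norml sin_le1 sin_geN1.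
have := normr_ge0 (sin m); have := normr_ge0 (sin d); nra.
Qed.

(** * Slutsky's theorem for random matrix factors *)

Section slutsky.
Context {R : realType} (k l : nat) (T : nat -> finType) (W : forall n, T n -> R).
Hypotheses (W0 : forall n x, 0 <= @W n x) (W1 : forall n, \sum_x @W n x = 1).
Variables (S : {n & T n} -> 'cV[R]_k) (V : 'M[R]_k).
Variables (B : {n & T n} -> 'M[R]_(l, k)) (B0 : 'M[R]_(l, k)).
Hypothesis S_cos : forall th t,
  wexp (@W n) (fun x => cos (th + dotc t (S (existT T n x)))) @[n --> \oo] -->
  cos th * expR (- dotc t (V *m t) / 2).
Hypothesis S_moment : forall i, exists C, \forall n \near \oo,
  wexp (@W n) (fun x => S (existT T n x) i ord0 ^+ 2) <= C.

#[local] Instance slutsky_filter : Filter (prob_filter W) := prob_filter_filter W0.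

Hypothesis B_cvg : B x @[x --> prob_filter W] --> B0.
Hypothesis psd : possemidef (B0 *m V *m B0^T).

Let S_tight i : tight W (fun x => S x i ord0).
Proof. by have [C hC] := S_moment i; exact: moment_tight hC. Qed.

Let diff_cvg0 j : ((B x - B0) *m S x) j ord0 @[x --> prob_filter W] --> 0.
Proof.
have -> : (fun x => ((B x - B0) *m S x) j ord0) =
    (fun x => \sum_i (B x j i - B0 j i) * S x i ord0).
  by apply/funext => x; rewrite mxE; apply: eq_bigr => i _; rewrite !mxE.
apply: cvg_sumr0 => i _; apply: cvg0_tightM => //.
by rewrite -(subrr (B0 j i)); apply: cvgB; [exact: cvg_mx_entry|exact: cvg_cst].
Qed.

Let BS_tight e : 0 < e -> exists K : R, \forall n \near \oo,
  wexp (@W n) (fun x => (K < `|B (existT T n x) *m S (existT T n x)|)%R%:R) <= e.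
Proof.
(* Union bound over the k coordinates of [S] and the l coordinates of (B - B0) S; the added 1 covers
   k = l = 0. *)
move=> e0; pose e1 := e / (l%:R + k%:R + 1).
have lk : 0 < (l%:R + k%:R + 1 : R) by rewrite ltr_wpDl ?addr_ge0.
have e10 : 0 < e1 by rewrite divr_gt0.
have /boolp.choice[K hK] := fun i => @S_tight i _ e10.
have hd j : \forall n \near \oo,
    wexp (@W n) (fun x => (~~ `[< `|0 - ((B (existT T n x) - B0) *m
      S (existT T n x)) j ord0| <= 1 >])%:R) <= e1.
  have /cvgrPdist_le/(_ 1 ltr01) := diff_cvg0 j.
  rewrite /prop_near1 /nbhs/= /prob_filter/= => /cvgrPdist_le/(_ _ e10).
  apply: filterS => n; rewrite sub0r normrN; exact/le_trans/ler_norm.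
exists (`|B0| * (\sum_i `|K i|) + 1).
have hKn : \forall n \near \oo, forall i,
    wexp (@W n) (fun x => (K i < `|S (existT T n x) i ord0|)%R%:R) <= e1.
  exact: filter_forall.
have hdn : \forall n \near \oo, forall j,
    wexp (@W n) (fun x => (~~ `[< `|0 - ((B (existT T n x) - B0) *m
      S (existT T n x)) j ord0| <= 1 >])%:R) <= e1.
  exact: filter_forall.
apply: filterS2 hKn hdn => n hKn hdn.
apply: (@le_trans _ _ (wexp (@W n) (fun x =>
  \sum_i (K i < `|S (existT T n x) i ord0|)%R%:R +
  \sum_j (~~ `[< `|0 - ((B (existT T n x) - B0) *m
      S (existT T n x)) j ord0| <= 1 >])%:R))).
  apply: le_wexp => // x; set y := existT _ n x.
  have [/existsP[i hi]|] := boolP [exists i, K i < `|S y i ord0|].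
    rewrite [X in _ <= X + _](bigD1 i)//= hi -addrA.
    apply: (@le_trans _ _ 1); first by case: (_ < _).
    by rewrite lerDl addr_ge0// sumr_ge0.
  rewrite negb_exists => /forallP hS.
  have [/existsP[j hj]|] := boolP [exists j, ~~ `[< `|0 - ((B y - B0) *m S y) j ord0| <= 1 >]].
    rewrite [X in _ <= _ + X](bigD1 j)//= hj addrCA.
    apply: (@le_trans _ _ 1); first by case: (_ < _).
    by rewrite lerDl addr_ge0// sumr_ge0.
  rewrite negb_exists => /forallP hB.
  rewrite ltNge (_ : `|_| <= _) ?addr_ge0 ?sumr_ge0//.
  apply: mx_norm_le => [|j j']; first by rewrite addr_ge0// mulr_ge0 ?sumr_ge0.
  rewrite ord1 -{1}[B y](subrK B0) mulmxDl mxE addrC.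
  rewrite (le_trans (ler_normD _ _))// lerD//.
    rewrite mxE (le_trans (ler_norm_sum _ _ _))// mulr_sumr.
    apply: ler_sum => i _; rewrite normrM ler_pM// ?le_mx_norm//.
    by have := hS i; rewrite -leNgt => /le_trans; apply; exact: ler_norm.
  by have := hB j; rewrite negbK sub0r normrN => /asboolP.
rewrite wexpD !wexp_sum.
apply: (@le_trans _ _ (\sum_(i < k) e1 + \sum_(j < l) e1)).
  by apply: lerD; apply: ler_sum.
rewrite !sumr_const !card_ord -mulrnDr -[_ *+ _]mulr_natr -mulrA.
rewrite ler_piMr ?(ltW e0)// mulrC ler_pdivrMr// mul1r natrD addrC.
by rewrite lerDl.
Qed.

(** Cosine is 1-Lipschitz, so replacing [B] by [B0] inside the transform costs |t.(B - B0) S|, which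
    vanishes in probability. What remains is the transform of [S] at B0^T t. *)
Lemma slutsky_levy (f : 'cV[R]_l -> R) (C : R) :
  continuous f -> (forall x, `|f x| <= C) ->
  wexp (@W n) (fun x => f (B (existT T n x) *m S (existT T n x))) @[n --> \oo] -->
  \int[mvnormal 0 (B0 *m V *m B0^T)]_x f x.
Proof.
apply: (@levy_continuity _ _ _ _ W0 W1
  (fun n x => B (existT T n x) *m S (existT T n x))) => [th t|]; last exact: BS_tight.
have [[sq _] qq] := sqrtmxP psd.
rewrite /Rintegral mvnormal_cos//=.
rewrite -mulmxA -mulmxA dotc_mulmx.
set L := cos th * _.
have d0 : wexp (@W n) (fun x => cos (th + dotc t (B (existT T n x) *m S (existT T n x))) -
    cos (th + dotc (B0^T *m t) (S (existT T n x)))) @[n --> \oo] --> 0.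
  apply: (@wexp_cvg0_prob_filter _ _ _ W0 W1 (fun y => cos (th + dotc t (B y *m S y)) -
    cos (th + dotc (B0^T *m t) (S y))) 2).
    move=> y; rewrite (le_trans (ler_normB _ _))// (_ : 2 = 1 + 1)//.
    by rewrite lerD// ler_norml cos_le1 cos_geN1.
  have h : dotc t ((B y - B0) *m S y) @[y --> prob_filter W] --> 0.
    apply: cvg_sumr0 => j _; rewrite -(mulr0 (t j ord0)).
    by apply: cvgM => //; exact: cvg_cst.
  apply/norm_cvg0P.
  apply: (@squeeze_cvgr _ _ _ _ (fun=> 0) (fun y => `|dotc t ((B y - B0) *m S y)|)).
  - apply: nearW => y; rewrite normr_ge0/=; apply: le_trans (cos_lipschitz _ _) _.
    rewrite -dotc_mulmx -{1}[B y](subrK B0) mulmxDl dotcD.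
    by rewrite opprD addrACA subrr add0r addrK.
  - exact: cvg_cst.
  - exact/norm_cvg0P.
have h := cvgD d0 (@S_cos th (B0^T *m t)); rewrite add0r in h.
rewrite (_ : (fun n => _) = (fun n => wexp (@W n) (fun x =>
    cos (th + dotc t (B (existT T n x) *m S (existT T n x))) -
    cos (th + dotc (B0^T *m t) (S (existT T n x)))) +
  wexp (@W n) (fun x => cos (th + dotc (B0^T *m t) (S (existT T n x)))))); first exact: h.
by apply/funext => n; rewrite -wexpD; apply: eq_wexp => x; rewrite subrK.
Qed.

End slutsky.

(** * Linear statistics of the resampled residuals *)

(** The sum is at most n times its largest term in absolute value; [lind] is monotone, and that
    single term already occurs on the right. *)
Lemma lind_sum (R : realType) n (x : 'I_n -> R) :
  lind (\sum_b x b) <= \sum_b lind (n%:R * x b).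
Proof.
case: n x => [|n] x; first by rewrite !big_ord0 /lind expr0n mul0r.
have [b hb] : exists b, forall c, `|x c| <= `|x b|.
  by case: (@arg_maxP _ _ _ (ord0 : 'I_n.+1) xpredT (fun c => `|x c|)%O) => // b _ hb; exists b => c; exact: hb.
rewrite [leRHS](bigD1 b)//= -[leLHS]addr0; apply: lerD.
  apply: le_lind; rewrite normrM ger0_norm// (le_trans (ler_norm_sum _ _ _))//.
  rewrite mulr_natl -[X in _ *+ X](card_ord n.+1) -sumr_const.
  exact: ler_sum.
by apply: sumr_ge0 => c _; exact: lind_ge0.
Qed.

Section triangular_array.
Context {R : realType} (r : nat) (e : forall n, 'M[R]_(n, r)).

(** A continuous substitute for x^2 restricted to |x| > 1/a. It is adapted to [lind]: lind (c x) =
    c^2 trunc2 |c| x. *)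
Definition trunc2 (a x : R) : R := x ^+ 2 * Num.min 1 (a * `|x|).

Lemma trunc2_ge0 a x : 0 <= a -> 0 <= trunc2 a x.
Proof. by move=> a0; rewrite mulr_ge0 ?sqr_ge0// le_min ler01 mulr_ge0. Qed.

Hypothesis e_sum0 : forall n b, \sum_j e n j b = 0.
Variable Sigma : 'M[R]_r.
Hypothesis e_cov : n%:R^-1 *: ((e n)^T *m e n) @[n --> \oo] --> Sigma.
Hypothesis e_tail : forall b (eta : R), 0 < eta -> exists2 a : R, 0 < a &
  \forall n \near \oo, n%:R^-1 * \sum_j trunc2 a (e n j b) <= eta.

Let W n : {ffun 'I_n -> 'I_n} -> R := prodw (@unifw R n).

Let covE n b c : (n%:R^-1 *: ((e n)^T *m e n)) b c =
  n%:R^-1 * \sum_j e n j b * e n j c.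
Proof. by rewrite !mxE; congr (_ * _); apply: eq_bigr => j _; rewrite mxE. Qed.

Lemma resampled_moment2 n (u : 'I_n -> R) b :
  wexp (@W n) (fun s => (\sum_i u i * e n (s i) b) ^+ 2) =
  (\sum_i u i ^+ 2) * (n%:R^-1 *: ((e n)^T *m e n)) b b.
Proof.
rewrite (wexp_sum_sqr (@unifw_sum1 R n) (x := fun i j => u i * e n j b)).
  rewrite covE mulr_suml; apply: eq_bigr => i _.
  rewrite !mulr_sumr; apply: eq_bigr => j _; rewrite /unifw; ring.
by move=> i; rewrite -mulr_sumr -mulr_sumr e_sum0 !mulr0.
Qed.

Variables (u : forall n, 'M[R]_(n, r)) (G : 'M[R]_r).
Hypothesis u_small : forall eta : R, 0 < eta ->
  \forall n \near \oo, forall i b, `|u n i b| <= eta.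
Hypothesis u_gram : (u n)^T *m u n @[n --> \oo] --> G.

Let xi n (i j : 'I_n) := \sum_b u n i b * e n j b.
Let q n (i : 'I_n) := \sum_j n%:R^-1 * xi i j ^+ 2.

Let q_ge0 n (i : 'I_n) : 0 <= q i.
Proof. by apply: sumr_ge0 => j _; rewrite mulr_ge0 ?sqr_ge0 ?unifw_ge0. Qed.

Let qE n (i : 'I_n) : q i = \sum_b \sum_c u n i b * u n i c *
  (n%:R^-1 *: ((e n)^T *m e n)) b c.
Proof.
transitivity (\sum_(j < n) \sum_b \sum_c n%:R^-1 * (u n i b * u n i c * (e n j b * e n j c))).
  apply: eq_bigr => j _; rewrite /unifw expr2 /xi mulr_suml mulr_sumr.
  apply: eq_bigr => b _; rewrite !mulr_sumr; apply: eq_bigr => c _; ring.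
rewrite exchange_big; apply: eq_bigr => b _; rewrite exchange_big.
apply: eq_bigr => c _; rewrite covE -!mulr_sumr; ring.
Qed.

(** The total variance is a trace of two Gram matrices, so it converges although the individual
    [q i] need not have limits. *)
Let sum_q n : \sum_i q (n := n) i =
  \tr ((n%:R^-1 *: ((e n)^T *m e n)) *m ((u n)^T *m u n)).
Proof.
under eq_bigr do rewrite qE.
rewrite exchange_big; apply: eq_bigr => b _; rewrite exchange_big mxE.
apply: eq_bigr => c _; rewrite -mulr_suml mulrC; congr (_ * _).
by rewrite mxE; apply: eq_bigr => i _; rewrite !mxE mulrC.
Qed.

Let sum_q_cvg : \sum_i q (n := n) i @[n --> \oo] --> \tr (Sigma *m G).
Proof.
under eq_fun do rewrite sum_q.
by apply: cvg_sumr => b _; apply: cvg_mx_entry; apply: cvg_mulmx.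
Qed.

Let lind_xi n (i j : 'I_n) (a : 'I_r -> R) :
  (forall b, r%:R * `|u n i b| <= a b) ->
  lind (xi i j) <= r%:R ^+ 2 * \sum_b u n i b ^+ 2 * trunc2 (a b) (e n j b).
Proof.
move=> ha; rewrite (le_trans (lind_sum _))// mulr_sumr; apply: ler_sum => b _.
have -> : r%:R ^+ 2 * (u n i b ^+ 2 * trunc2 (a b) (e n j b)) =
    (r%:R * (u n i b * e n j b)) ^+ 2 * Num.min 1 (a b * `|e n j b|).
  by rewrite /trunc2; ring.
rewrite /lind ler_wpM2l ?sqr_ge0//.
rewrite !normrM ger0_norm// mulrA le_min ge_min lexx/= ge_min.
by rewrite ler_wpM2r ?orbT.
Qed.

Let trace_gram n : \sum_b ((u n)^T *m u n) b b = \sum_i \sum_b u n i b ^+ 2.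
Proof.
rewrite exchange_big; apply: eq_bigr => b _; rewrite mxE.
by apply: eq_bigr => i _; rewrite mxE expr2.
Qed.

Let trace_gram_cvg : \sum_i \sum_b u n i b ^+ 2 @[n --> \oo] --> \tr G.
Proof.
by under eq_fun do rewrite -trace_gram; apply: cvg_sumr => b _; exact: cvg_mx_entry.
Qed.

Let trace_bound : \forall n \near \oo, \sum_i \sum_b u n i b ^+ 2 <= `|\tr G| + 1.
Proof.
have /cvgrPdist_le/(_ 1 ltr01) := trace_gram_cvg; apply: filterS => n hn.
have := ler_norm (\tr G); move: hn; rewrite ler_norml => /andP[]; lra.
Qed.

(** Lindeberg's condition: once the weights satisfy r |u| <= a, the double sum separates into the
    bounded sum of u^2 and the small truncated averages of the residuals. *)
Let lind_cvg0 : \sum_(i < n) \sum_(j < n) n%:R^-1 * lind (xi i j) @[n --> \oo] --> 0.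
Proof.
apply/cvgrPdist_le => eps eps0.
pose D : R := (r%:R ^+ 2 + 1) * (`|\tr G| + 1).
have D0 : 0 < D by rewrite mulr_gt0// ltr_wpDl ?sqr_ge0.
have /boolp.choice[a ha] : forall b, exists a : R, 0 < a /\
    \forall n \near \oo, n%:R^-1 * \sum_j trunc2 a (e n j b) <= eps / D.
  by move=> b; have [a a0 h] := e_tail b (divr_gt0 eps0 D0); exists a.
have h1 : \forall n \near \oo, forall b, n%:R^-1 * \sum_j trunc2 (a b) (e n j b) <= eps / D.
  by apply: filter_forall => b; exact: (ha b).2.
have h2 : \forall n \near \oo, forall b i, r%:R * `|u n i b| <= a b.
  apply: filter_forall => b.
  have ab : 0 < a b / (r%:R + 1) by rewrite divr_gt0 ?ltr_wpDl// (ha b).1.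
  apply: filterS (u_small ab) => n hn i.
  have := hn i b; rewrite ler_pdivlMr ?ltr_wpDl// mulrC; apply: le_trans.
  by rewrite ler_wpM2r// lerDl.
apply: filterS3 h1 h2 trace_bound => n h1 h2 h3.
rewrite sub0r normrN ger0_norm; last first.
  by apply: sumr_ge0 => i _; apply: sumr_ge0 => j _; rewrite mulr_ge0 ?lind_ge0.
apply: (@le_trans _ _ (\sum_(i < n) \sum_(j < n) n%:R^-1 *
    (r%:R ^+ 2 * \sum_b u n i b ^+ 2 * trunc2 (a b) (e n j b)))).
  by apply: ler_sum => i _; apply: ler_sum => j _; rewrite ler_wpM2l// lind_xi.
apply: (@le_trans _ _ (\sum_(i < n) \sum_b r%:R ^+ 2 * u n i b ^+ 2 * (eps / D))).
  apply: ler_sum => i _.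
  rewrite (eq_bigr (fun j => \sum_b r%:R ^+ 2 * u n i b ^+ 2 *
      (n%:R^-1 * trunc2 (a b) (e n j b)))); last first.
    by move=> j _; rewrite !mulr_sumr; apply: eq_bigr => b _; ring.
  rewrite exchange_big; apply: ler_sum => b _; rewrite -mulr_sumr -mulr_sumr.
  by rewrite ler_wpM2l// -exprMn sqr_ge0.
rewrite (eq_bigr (fun i => r%:R ^+ 2 * (eps / D) * \sum_b u n i b ^+ 2)); last first.
  by move=> i _; rewrite mulr_sumr; apply: eq_bigr => b _; ring.
rewrite -mulr_sumr.
apply: (@le_trans _ _ ((r%:R ^+ 2 + 1) * (eps / D) * (`|\tr G| + 1))); last first.
  by rewrite /D le_eqVlt; apply/orP; left; apply/eqP; field; rewrite !gt_eqF// ltr_wpDl ?sqr_ge0.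
apply: ler_pM => //.
- by rewrite mulr_ge0 ?sqr_ge0// ltW// divr_gt0.
- by apply: sumr_ge0 => i _; apply: sumr_ge0 => b _; exact: sqr_ge0.
- by rewrite ler_wpM2r ?lerDl// ltW// divr_gt0.
Qed.

(** The sum of squares is at most the largest [q i] times the sum of all; the sum is bounded, and
    the largest vanishes because the weights are uniformly small. *)
Let sum_q2_cvg0 : \sum_i q (n := n) i ^+ 2 @[n --> \oo] --> 0.
Proof.
apply/cvgrPdist_le => eps eps0.
pose A := `|Sigma| + 1; pose Q := `|\tr (Sigma *m G)| + 1.
have A0 : 0 < A by rewrite ltr_wpDl.
have Q0 : 0 < Q by rewrite ltr_wpDl.
pose D := (r%:R ^+ 2 + 1) * A * Q.
have r0 : 0 < (r%:R ^+ 2 + 1 : R) by rewrite ltr_wpDl ?sqr_ge0.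
have D0 : 0 < D by rewrite !mulr_gt0.
have eD : 0 < Num.sqrt (eps / D) by rewrite sqrtr_gt0 divr_gt0.
have /cvgrPdist_le/(_ 1 ltr01) hS := e_cov.
have /cvgrPdist_le/(_ 1 ltr01) hQ := sum_q_cvg.
apply: filterS3 (u_small eD) hS hQ => n hu {}hS {}hQ.
rewrite sub0r normrN ger0_norm; last by apply: sumr_ge0 => i _; exact: sqr_ge0.
have {}hQ : \sum_i q (n := n) i <= Q.
  have := ler_norm (\tr (Sigma *m G)); move: hQ; rewrite ler_norml /Q => /andP[]; lra.
have {}hS b c : `|(n%:R^-1 *: ((e n)^T *m e n)) b c| <= A.
  apply: le_trans (le_mx_norm _ _ _) _.
  rewrite -[X in `|X|](subrK Sigma) addrC (le_trans (ler_normD _ _))// lerD2l.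
  by rewrite distrC.
have qle i : q (n := n) i <= (r%:R ^+ 2 + 1) * A * (eps / D).
  rewrite qE; apply: (@le_trans _ _ (\sum_(b < r) \sum_(c < r) A * (eps / D))).
    apply: ler_sum => b _; apply: ler_sum => c _; apply: le_trans (ler_norm _) _.
    rewrite normrM mulrC ler_pM// normrM -[leRHS]sqr_sqrtr; last first.
      by rewrite ltW// divr_gt0.
    by rewrite expr2; exact: ler_pM.
  rewrite sumr_const card_ord sumr_const card_ord -mulrnA -[_ *+ _]mulr_natl.
  rewrite natrM mulrA -expr2 !mulrA ler_pM2r ?invr_gt0// ler_pM2r//.
  by rewrite ler_pM2r// lerDl.
apply: (@le_trans _ _ (\sum_i (r%:R ^+ 2 + 1) * A * (eps / D) * q (n := n) i)).
  by apply: ler_sum => i _; rewrite expr2 ler_wpM2r.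
rewrite -mulr_sumr.
apply: (@le_trans _ _ ((r%:R ^+ 2 + 1) * A * (eps / D) * Q)).
  by rewrite ler_wpM2l// ltW// !(mulr_gt0, invr_gt0).
by rewrite /D le_eqVlt; apply/orP; left; apply/eqP; field; rewrite !gt_eqF.
Qed.

Lemma resampled_cos th :
  wexp (@W n) (fun s => cos (th + \sum_i \sum_b u n i b * e n (s i) b))
    @[n --> \oo] --> cos th * expR (- \tr (Sigma *m G) / 2).
Proof.
have h : \sum_(i < n) (3 * (\sum_(j < n) n%:R^-1 * lind (xi i j)) + q i ^+ 2)
    @[n --> \oo] --> 0.
  under eq_fun do rewrite big_split/= -mulr_sumr.
  have h := cvgD (cvgM (cvg_cst (3 : R)) lind_cvg0) sum_q2_cvg0.
  by rewrite mulr0 addr0 in h; exact: h.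
have h2 : cos th * expR (- (\sum_i q (n := n) i) / 2) @[n --> \oo] -->
    cos th * expR (- \tr (Sigma *m G) / 2).
  apply: cvgM; first exact: cvg_cst.
  apply: continuous_cvg; first exact: continuous_expR.
  by apply: cvgM; [exact: cvgN|exact: cvg_cst].
rewrite -[X in _ --> X]add0r; set L := cos th * _ in h2 *.
apply/cvgrPdist_le => eps eps0; rewrite add0r.
have e2 : 0 < eps / 2 by rewrite divr_gt0.
move/cvgrPdist_le/(_ _ e2): h => h; move/cvgrPdist_le/(_ _ e2): h2 => h2.
apply: filterS2 h h2 => n h h2.
have := @lindeberg_cos R 'I_n 'I_n (@unifw R n) (@xi n) (@unifw_ge0 R n)
  (@unifw_sum1 R n) _ th.
have xi0 i : \sum_j unifw i j * xi (n := n) i j = 0.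
  rewrite /unifw -mulr_sumr /xi exchange_big big1 ?mulr0// => b _.
  by rewrite -mulr_sumr e_sum0 mulr0.
move=> /(_ xi0) hl; rewrite (splitr eps).
apply: le_trans (ler_distD (cos th * expR (- (\sum_i q (n := n) i) / 2)) _ _) _.
apply: lerD => //; rewrite distrC; apply: le_trans hl _.
by apply: le_trans (ler_norm _) _; move: h; rewrite sub0r normrN.
Qed.

End triangular_array.

(** * Least squares on the resampled data *)

Lemma eq_cvg_fun (T : Type) (V : topologicalType) (F : set_system T) (f g : T -> V)
  (l : V) : f =1 g -> f x @[x --> F] --> l -> g x @[x --> F] --> l.
Proof. by move=> /funext ->. Qed.

Lemma near_cvg_fun (T : Type) (V : topologicalType) (F : set_system T)
    (FF : Filter F) (f g : T -> V) (l : V) : (\forall x \near F, f x = g x) ->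
  f x @[x --> F] --> l -> g x @[x --> F] --> l.
Proof.
by move=> fg fl; apply: cvg_trans fl; apply: near_eq_cvg; exact: filterS fg.
Qed.

Section covariance_matrix.
Context {R : realType}.

Lemma possemidef_gram n m (c : R) (C : 'M[R]_(n, m)) : 0 <= c ->
  possemidef (c *: (C^T *m C)).
Proof.
move=> c0; split; first by rewrite linearZ/= trmx_mul trmxK.
move=> v; rewrite -scalemxAr -scalemxAl mxE mulr_ge0//.
by rewrite mulmxA -trmx_mul -mulmxA mulmx_tr_ge0.
Qed.

Lemma mean_obsE n r (E : 'M[R]_(n, r)) b :
  mean_obs E b ord0 = n%:R^-1 * \sum_i E i b.
Proof.
by rewrite mxE summxE; congr (_ * _); apply: eq_bigr => i _; rewrite !mxE.
Qed.

Lemma mean_obs_mul n r (E : 'M[R]_(n, r)) :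
  mean_obs E = n%:R^-1 *: (E^T *m const_mx 1 : 'cV[R]_r).
Proof.
apply/matrixP => b j; rewrite ord1 mean_obsE !mxE; congr (_ * _).
by apply: eq_bigr => i _; rewrite !mxE mulr1.
Qed.

Lemma mean_obsB_mul n r p (E : 'M[R]_(n, r)) (X : 'M[R]_(n, p)) (A : 'M[R]_(r, p)) :
  mean_obs (E - X *m A^T) = mean_obs E - A *m mean_obs X.
Proof.
rewrite !mean_obs_mul linearB/= trmx_mul trmxK mulmxBl scalerBr.
by rewrite -scalemxAr mulmxA.
Qed.

Lemma cov_obsE n r (E : 'M[R]_(n, r)) :
  cov_obs E = n%:R^-1 *: (E^T *m E) - mean_obs E *m (mean_obs E)^T.
Proof.
congr (_ *: _ - _); apply/matrixP => b c; rewrite summxE mxE.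
by apply: eq_bigr => i _; rewrite mxE big_ord1 !mxE.
Qed.

(** The Gram form shows semidefiniteness. For n = 0 the convention that the inverse of 0 is 0 keeps
    the identity true. *)
Lemma cov_obs_centered n r (E : 'M[R]_(n, r)) :
  cov_obs E = n%:R^-1 *: ((\matrix_(i, b) (E i b - mean_obs E b ord0))^T *m
                          (\matrix_(i, b) (E i b - mean_obs E b ord0))).
Proof.
rewrite cov_obsE.
have : forall k, \sum_i E i k = n%:R * mean_obs E k ord0.
  move=> k; rewrite mean_obsE; case: n E => [|m] E; first by rewrite big_ord0 mul0r.
  by rewrite mulrA mulfV ?mul1r// pnatr_eq0.
have : forall k, n%:R = 0 :> R -> mean_obs E k ord0 = 0.
  by move=> k n0; rewrite mean_obsE n0 invr0 mul0r.
move: (mean_obs E) => m m0 sumE.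
apply/matrixP => b c; rewrite !mxE big_ord1.
under eq_bigr do rewrite mxE; under [in RHS]eq_bigr do rewrite !mxE.
rewrite mxE.
have -> : \sum_i (E i b - m b ord0) * (E i c - m c ord0) =
    \sum_i E i b * E i c - n%:R * (m b ord0 * m c ord0).
  rewrite (eq_bigr (fun i => E i b * E i c - m c ord0 * E i b - m b ord0 * E i c
      + m b ord0 * m c ord0)); last by move=> i _; ring.
  rewrite big_split/= !sumrB -!mulr_sumr !sumE sumr_const card_ord -mulr_natl; ring.
rewrite mulrBr; congr (_ - _).
have [n0|n0] := eqVneq (n%:R : R) 0; last by rewrite mulKf.
by rewrite (m0 b n0) mul0r !mulr0.
Qed.

Lemma possemidef_cov_obs n r (E : 'M[R]_(n, r)) : possemidef (cov_obs E).
Proof. by rewrite cov_obs_centered; apply: possemidef_gram; rewrite invr_ge0. Qed.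

End covariance_matrix.

Section least_squares.
Context {R : realType} (n r p : nat) (X : 'M[R]_(n, p)).
Hypothesis uX : X^T *m X \in unitmx.
Implicit Types (b : 'M[R]_(r, p)) (E : 'M[R]_(n, r)).

Lemma ols_affine b E : ols X (X *m b^T + E) = b + E^T *m X *m invmx (X^T *m X).
Proof.
by rewrite /ols linearD/= trmx_mul trmxK mulmxDl mulmxDl -[b *m _ *m X]mulmxA mulmxK.
Qed.

Lemma residuals_affine b E : residuals X (X *m b^T + E) =
  E - X *m (E^T *m X *m invmx (X^T *m X))^T.
Proof.
rewrite /residuals ols_affine linearD/= mulmxDr opprD addrACA subrr add0r.
by [].
Qed.

(** The normal equations E^T X = A (X^T X) make one cross term cancel against the quadratic term in
    the residual Gram matrix. *)
Lemma cov_obs_residual E : let A := E^T *m X *m invmx (X^T *m X) in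
  cov_obs (E - X *m A^T) =
  n%:R^-1 *: (E^T *m E) - A *m (n%:R^-1 *: (X^T *m X)) *m A^T -
    (mean_obs E - A *m mean_obs X) *m (mean_obs E - A *m mean_obs X)^T.
Proof.
move=> A; have EX : E^T *m X = A *m (X^T *m X) by rewrite /A mulmxKV.
rewrite cov_obsE mean_obsB_mul; congr (_ - _).
rewrite -scalemxAr -scalemxAl -scalerBr; congr (_ *: _).
have -> : (E - X *m A^T)^T = E^T - A *m X^T.
  by move: A {EX} => A; rewrite linearB/= trmx_mul trmxK.
rewrite mulmxBl !mulmxBr.
rewrite [E^T *m (_ *m _)]mulmxA EX.
have -> : A *m X^T *m E = (E^T *m X *m A^T)^T by rewrite !trmx_mul !trmxK mulmxA.
by rewrite EX !trmx_mul !trmxK !mulmxA subrr subr0.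
Qed.

End least_squares.

Section residual_covariance_limit.
Context {R : realType} (r p : nat) {T : Type} {F : set_system T} {FF : Filter F}.
Variables (nn : T -> nat) (X : forall n, 'M[R]_(n, p)) (E : forall y, 'M[R]_(nn y, r)).
Variables (SigmaX : 'M[R]_p) (Sigma : 'M[R]_r).
Hypothesis X_cvg : (nn y)%:R^-1 *: ((X (nn y))^T *m X (nn y)) @[y --> F] --> SigmaX.

(** From |x| <= 1 + x^2, column means of the design are bounded by 1 plus a diagonal entry of the
    normalized Gram matrix; they are not assumed to converge. *)
Lemma cvg0_mul_mean (A : T -> 'M[R]_(r, p)) : A y @[y --> F] --> (0 : 'M[R]_(r, p)) ->
  A y *m mean_obs (X (nn y)) @[y --> F] --> (0 : 'cV[R]_r).
Proof.
move=> A0; apply: cvg_mx => b j; rewrite ord1 mxE.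
apply: (@eq_cvg_fun _ _ _ (fun y => \sum_k A y b k * mean_obs (X (nn y)) k ord0)).
  by move=> y; rewrite [RHS]mxE.
apply: cvg_sumr0 => k _; pose S y := (nn y)%:R^-1 *: ((X (nn y))^T *m X (nn y)).
have h : `|A y b k| * (1 + S y k k) @[y --> F] --> 0.
  rewrite -(mul0r (1 + SigmaX k k)); apply: cvgM.
    apply/norm_cvg0P; have h := cvg_mx_entry (i := b) (j := k) A0.
    by rewrite mxE in h; exact: h.
  by apply: cvgD; [exact: cvg_cst|exact: cvg_mx_entry].
apply/norm_cvg0P; apply: (squeeze_cvgr _ (cvg_cst 0) h).
apply: nearW => y; rewrite normr_ge0 normrM ler_wpM2l//.
rewrite /S; move: (nn y) => n; rewrite mean_obsE !mxE.
apply: (@le_trans _ _ (n%:R^-1 * \sum_(i < n) (1 + (X n)^T k i * X n i k))).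
  rewrite normrM ger0_norm ?invr_ge0// ler_wpM2l ?invr_ge0//.
  apply: le_trans (ler_norm_sum _ _ _) _; apply: ler_sum => i _; rewrite mxE -expr2.
  rewrite -(real_normK (num_real (X n i k))); have := sqr_ge0 (`|X n i k| - 1); nra.
rewrite big_split/= mulrDr lerD2r sumr_const card_ord.
have [->|n0] := eqVneq (n%:R : R) 0; first by rewrite invr0 mul0r.
by rewrite mulVf.
Qed.

Lemma near_gram_unitmx : SigmaX \in unitmx ->
  \forall y \near F, (X (nn y))^T *m X (nn y) \in unitmx.
Proof.
move=> uX; apply: filterS (near_unitmx X_cvg uX) => y.
by rewrite -mul_scalar_mx unitmx_mul => /andP[].
Qed.

(** Stated along an arbitrary filter with sample size [nn y], so that it serves twice: with n
    tending to infinity for the original residuals, and along [prob_filter] for the bootstrap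
    ones. *)
Lemma cvg_cov_residual : SigmaX \in unitmx ->
  (nn y)%:R^-1 *: ((E y)^T *m E y) @[y --> F] --> Sigma ->
  mean_obs (E y) @[y --> F] --> (0 : 'cV[R]_r) ->
  (E y)^T *m X (nn y) *m invmx ((X (nn y))^T *m X (nn y)) @[y --> F] -->
    (0 : 'M[R]_(r, p)) ->
  cov_obs (E y - X (nn y) *m
    ((E y)^T *m X (nn y) *m invmx ((X (nn y))^T *m X (nn y)))^T) @[y --> F] --> Sigma.
Proof.
move=> uX h1 h2; set A := fun y => _ => A0.
have h3 : A y *m ((nn y)%:R^-1 *: ((X (nn y))^T *m X (nn y))) *m (A y)^T
    @[y --> F] --> (0 : 'M[R]_r).
  have := cvg_mulmx (cvg_mulmx A0 X_cvg) (cvg_trmx A0).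
  by rewrite mul0mx mul0mx; apply.
have h4 := cvgB (FF := FF) h2 (cvg0_mul_mean A0); rewrite subrr in h4.
pose f y : 'M[R]_r :=
  (nn y)%:R^-1 *: ((E y)^T *m E y) -
    A y *m ((nn y)%:R^-1 *: ((X (nn y))^T *m X (nn y))) *m (A y)^T -
    (mean_obs (E y) - A y *m mean_obs (X (nn y))) *m
    (mean_obs (E y) - A y *m mean_obs (X (nn y)))^T.
have h5 : f y @[y --> F] --> Sigma.
  have := cvgB (cvgB h1 h3) (cvg_mulmx h4 (cvg_trmx h4)).
  by rewrite mul0mx !subr0; apply.
apply: (@near_cvg_fun _ _ _ FF f _ _ _ h5).
by apply: filterS (near_gram_unitmx uX) => y uXy; rewrite cov_obs_residual.
Qed.

End residual_covariance_limit.

Lemma invmx_sqr (R : comUnitRingType) n (q A : 'M[R]_n) : q \in unitmx ->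
  q *m q = A -> invmx A = invmx q *m invmx q.
Proof.
move=> uq <-; have uqq : q *m q \in unitmx by rewrite unitmx_mul uq.
rewrite -[RHS]mulmx1 -(mulmxV uqq) mulmxA.
by rewrite -[invmx q *m _ *m _]mulmxA mulKmx// mulVmx// mul1mx.
Qed.

Lemma tensmx11 (R : realType) m n : (1%:M : 'M[R]_m) *t (1%:M : 'M[R]_n) = 1%:M.
Proof.
have h j : col j ((1%:M : 'M[R]_m) *t (1%:M : 'M[R]_n)) = col j 1%:M.
  rewrite !colE mul1mx; have [C ->] := vec_surj (delta_mx j 0 : 'cV[R]_(m * n)).
  by rewrite tens_mul_vec mul1mx trmx1 mulmx1.
by apply/matrixP => i j; have /matrixP/(_ i ord0) := h j; rewrite !mxE.
Qed.

Lemma tensmxZl (R : pzRingType) m n p q (c : R) (A : 'M[R]_(m, n)) (B : 'M[R]_(p, q)) :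
  (c *: A) *t B = c *: (A *t B).
Proof. by apply/matrixP => i j; rewrite !mxE mulrA. Qed.

(** * Bootstrap limits for a deterministic design and deterministic centered residuals *)

Section bootstrap_regression.
Context {R : realType} (r p : nat).
Variables (X : forall n, 'M[R]_(n, p)) (e : forall n, 'M[R]_(n, r)).
Variables (SigmaX : 'M[R]_p) (Sigma : 'M[R]_r).
Hypotheses (pX : posdef SigmaX) (pS : posdef Sigma).
Hypothesis X_cvg : n%:R^-1 *: ((X n)^T *m X n) @[n --> \oo] --> SigmaX.
Hypothesis X_small : forall eta : R, 0 < eta ->
  \forall n \near \oo, forall i k, X n i k ^+ 2 <= eta * n%:R.
Hypothesis e_sum0 : forall n b, \sum_j e n j b = 0.
Hypothesis e_cov : n%:R^-1 *: ((e n)^T *m e n) @[n --> \oo] --> Sigma.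
Hypothesis e_tail : forall b (eta : R), 0 < eta -> exists2 a : R, 0 < a &
  \forall n \near \oo, n%:R^-1 * \sum_j trunc2 a (e n j b) <= eta.

Let T (n : nat) : finType := {ffun 'I_n -> 'I_n}.
Let W n : T n -> R := prodw (@unifw R n).

Let W0 n s : 0 <= W (n := n) s.
Proof. exact/prodw_ge0/unifw_ge0. Qed.

Let W1 n : \sum_s W (n := n) s = 1.
Proof. exact/prodw_sum1/unifw_sum1. Qed.

#[local] Instance bootstrap_filter : Filter (prob_filter W) := prob_filter_filter W0.

Let S n := n%:R^-1 *: ((X n)^T *m X n).
(** The weights of the linear statistic: when n > 0 and X^T X is invertible, sqrt n (betahat* -
    betahat) is the transposed resampled error matrix times [v n]. *)
Let v n := (Num.sqrt n%:R)^-1 *: (X n *m invmx (S n)).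
Let em n (s : T n) : 'M[R]_(n, r) := \matrix_(i, b) e n (s i) b.

Let uSX : SigmaX \in unitmx.
Proof. exact: posdef_unitmx. Qed.

Let iS_cvg : invmx (S n) @[n --> \oo] --> invmx SigmaX.
Proof. exact: cvg_invmx. Qed.

Let natr_invE n : n%:R^-1 = (Num.sqrt n%:R)^-1 * (Num.sqrt n%:R)^-1 :> R.
Proof. by rewrite -invfM -expr2 sqr_sqrtr. Qed.

Let v_gramE n : (v n)^T *m v n = (invmx (S n))^T *m S n *m invmx (S n).
Proof.
have -> : (v n)^T = (Num.sqrt n%:R)^-1 *: ((invmx (S n))^T *m (X n)^T).
  by rewrite -trmx_mul; apply/matrixP => i j; rewrite !mxE.
rewrite -scalemxAl -scalemxAr scalerA -natr_invE.
by rewrite mulmxA -[X in _ = X *m _]scalemxAr -scalemxAl mulmxA.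
Qed.

Let v_gram : (v n)^T *m v n @[n --> \oo] --> invmx SigmaX.
Proof.
under eq_fun do rewrite v_gramE.
have -> : invmx SigmaX = (invmx SigmaX)^T *m SigmaX *m invmx SigmaX.
  by rewrite -mulmxA mulmxV// mulmx1 trmx_inv pX.1.
by apply: cvg_mulmx => //; apply: cvg_mulmx => //; exact: cvg_trmx.
Qed.

(** Design entries are at most d sqrt n by [X_small], which the factor n^(-1/2) compensates, and the
    inverse Gram matrix is bounded. *)
Let v_small (eta : R) : 0 < eta -> \forall n \near \oo, forall i k, `|v n i k| <= eta.
Proof.
move=> eta0; pose A := `|invmx SigmaX| + 1.
have A0 : 0 < A by rewrite ltr_wpDl.
pose d := eta / ((p%:R + 1) * A).
have d0 : 0 < d by rewrite divr_gt0// mulr_gt0// ltr_wpDl.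
have d20 : 0 < d ^+ 2 by rewrite exprn_gt0.
have /cvgrPdist_le/(_ 1 ltr01) hS := iS_cvg.
have n0 := nbhs_infty_gt 0.
apply: filterS3 (X_small d20) hS n0 => n hX {}hS n0 i k.
have s0 : 0 < Num.sqrt n%:R :> R by rewrite sqrtr_gt0 ltr0n.
have {}hS l : `|invmx (S n) l k| <= A.
  apply: le_trans (le_mx_norm _ _ _) _.
  rewrite -[X in `|X|](subrK (invmx SigmaX)) addrC (le_trans (ler_normD _ _))// lerD2l.
  by rewrite distrC.
have {}hX l : `|X n i l| <= d * Num.sqrt n%:R.
  rewrite -(ger0_norm (x := d * _)); last by rewrite mulr_ge0 ?(ltW d0).
  rewrite -ler_sqr ?nnegrE// !real_normK ?num_real// exprMn sqr_sqrtr//.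
rewrite !mxE normrM normfV (ger0_norm (ltW s0)) mulrC ler_pdivrMr//.
apply: le_trans (ler_norm_sum _ _ _) _.
apply: (@le_trans _ _ (\sum_(l < p) d * Num.sqrt n%:R * A)).
  by apply: ler_sum => l _; rewrite normrM ler_pM.
rewrite sumr_const card_ord -[_ *+ _]mulr_natl.
have -> : eta = (p%:R + 1) * d * A.
  by rewrite /d; field; rewrite !gt_eqF// ltr_wpDl.
have := mulr_gt0 (mulr_gt0 d0 s0) A0; lra.
Qed.

Let D n (s : T n) : 'M[R]_(r, p) := (em s)^T *m v n.

Let DE n (s : T n) b k : D s b k = \sum_i v n i k * e n (s i) b.
Proof. by rewrite mxE; apply: eq_bigr => i _; rewrite !mxE mulrC. Qed.

Let Sv (y : {n & T n}) : 'cV[R]_(p * r) := vec (D (projT2 y)).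

(** Cramer-Wold in matrix form: with t = vec tau the statistic has weights v tau^T, and the limiting
    variance tr (Sigma tau SigmaX^-1 tau^T) is the quadratic form of the Kronecker product at t. *)
Let Sv_cos th t :
  wexp (@W n) (fun s => cos (th + dotc t (Sv (existT T n s)))) @[n --> \oo] -->
  cos th * expR (- dotc t ((invmx SigmaX *t Sigma) *m t) / 2).
Proof.
have [tau ->] := vec_surj t; rewrite tens_mul_vec dotc_vec.
have -> : \sum_b \sum_a tau b a * (Sigma *m tau *m (invmx SigmaX)^T) b a =
    \tr (Sigma *m (tau *m invmx SigmaX *m tau^T)).
  rewrite trmx_inv pX.1 !mulmxA; apply: eq_bigr => b _; rewrite [RHS]mxE.
  by apply: eq_bigr => a _; rewrite [tau^T _ _]mxE mulrC.
have gram : (v n *m tau^T)^T *m (v n *m tau^T) @[n --> \oo] -->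
    tau *m invmx SigmaX *m tau^T.
  have -> : (fun n => (v n *m tau^T)^T *m (v n *m tau^T)) =
      (fun n => tau *m ((v n)^T *m v n) *m tau^T).
    by apply/funext => n; rewrite trmx_mul trmxK !mulmxA.
  by apply: cvg_mulmx; [apply: cvg_mulmx => //; exact: cvg_cst|exact: cvg_cst].
have small (eta : R) : 0 < eta -> \forall n \near \oo, forall i b,
    `|(v n *m tau^T) i b| <= eta.
  move=> eta0; pose A := (p%:R + 1) * (`|tau| + 1).
  have A0 : 0 < A by rewrite mulr_gt0// ltr_wpDl.
  apply: filterS (v_small (divr_gt0 eta0 A0)) => n hn i b.
  rewrite mxE (le_trans (ler_norm_sum _ _ _))//.
  apply: (@le_trans _ _ (\sum_(k < p) eta / A * (`|tau| + 1))).
    apply: ler_sum => k _; rewrite normrM ler_pM// mxE.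
    by rewrite (le_trans (le_mx_norm _ _ _))// lerDl.
  rewrite sumr_const card_ord -[_ *+ _]mulr_natl.
  have etaE : eta = (p%:R + 1) * (eta / A * (`|tau| + 1)).
    by rewrite /A; field; rewrite !gt_eqF// ltr_wpDl.
  rewrite [leRHS]etaE; have : 0 < eta / A * (`|tau| + 1) by rewrite mulr_gt0 ?divr_gt0// ltr_wpDl.
  lra.
apply: (eq_cvg_fun _ (resampled_cos e_sum0 e_cov e_tail small gram (th := th))) => n.
apply: eq_wexp => s.
congr (cos (th + _)); rewrite /Sv /= dotc_vec.
under [LHS]eq_bigr do under eq_bigr do rewrite mxE mulr_suml.
under [RHS]eq_bigr do under eq_bigr do rewrite DE mulr_sumr.
rewrite exchange_big; apply: eq_bigr => b _.
rewrite exchange_big; apply: eq_bigr => k _; apply: eq_bigr => i _.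
by rewrite [tau^T _ _]mxE; ring.
Qed.

Let Sig n := n%:R^-1 *: ((e n)^T *m e n).

Let D_moment n b k : wexp (@W n) (fun s => D s b k ^+ 2) =
  ((v n)^T *m v n) k k * Sig n b b.
Proof.
rewrite /Sig mxE (eq_bigr (fun i => v n i k ^+ 2)).
  rewrite -resampled_moment2//; apply: eq_wexp => s; by rewrite DE.
by move=> i _; rewrite mxE expr2.
Qed.

Let D_moment_cvg b k : wexp (@W n) (fun s => D s b k ^+ 2) @[n --> \oo] -->
  invmx SigmaX k k * Sigma b b.
Proof.
under eq_fun do rewrite D_moment.
by apply: cvgM; exact: cvg_mx_entry.
Qed.

Let Sv_moment i : exists C, \forall n \near \oo,
  wexp (@W n) (fun s => Sv (existT T n s) i ord0 ^+ 2) <= C.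
Proof.
case/mxvec_indexP: i => k b; exists (`|invmx SigmaX k k * Sigma b b| + 1).
have /cvgrPdist_le/(_ 1 ltr01) := @D_moment_cvg b k; apply: filterS => n.
under [in X in _ -> X]eq_wexp do rewrite /Sv vecE.
rewrite ler_norml => /andP[h _]; have := ler_norm (invmx SigmaX k k * Sigma b b).
lra.
Qed.

Let psdV : possemidef (invmx SigmaX *t Sigma).
Proof.
have [[sq _] qq] := sqrtmxP (posdef_possemidef pX).
have [[ss _] ss2] := sqrtmxP (posdef_possemidef pS).
pose G := invmx (sqrtmx SigmaX) *t sqrtmx Sigma.
have -> : invmx SigmaX *t Sigma = 1 *: (G^T *m G).
  rewrite scale1r /G trmx_tens tensmx_mul trmx_inv sq ss ss2; congr (_ *t _).
  exact: invmx_sqr (sqrtmx_unitmx pX) qq.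
exact: possemidef_gram.
Qed.

(** If a |e| >= 1, the square is one full term of the truncated average; otherwise it is at most
    a^(-2), which is below eta n for large n. *)
Let e_small (eta : R) : 0 < eta ->
  \forall n \near \oo, forall j b, e n j b ^+ 2 <= eta * n%:R.
Proof.
move=> eta0.
have : \forall n \near \oo, forall b j, e n j b ^+ 2 <= eta * n%:R.
  apply: filter_forall => b; have [a a0 ha] := e_tail b eta0.
  have hn : \forall n \near \oo, a ^- 2 / eta <= n%:R by exact: nbhs_infty_ger.
  apply: filterS3 ha hn (nbhs_infty_gt 0) => n ha hn n0 j.
  have {}n0 : 0 < n%:R :> R by rewrite ltr0n.
  have [h|h] := leP 1 (a * `|e n j b|).
    move: ha; rewrite mulrC ler_pdivrMr//; apply: le_trans.
    rewrite (bigD1 j)//= {1}/trunc2 (min_idPl h) mulr1 lerDl.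
    by apply: sumr_ge0 => i _; apply: trunc2_ge0; exact: ltW.
  move: hn; rewrite ler_pdivrMr// mulrC; apply: le_trans.
  have : `|e n j b| <= a^-1 by rewrite -[leRHS]mul1r ler_pdivlMr// mulrC ltW.
  rewrite -ler_sqr ?nnegrE ?invr_ge0 ?(ltW a0)// real_normK ?num_real//.
  by rewrite exprVn.
by apply: filterS => n h j b; exact: h.
Qed.

Let Sig_entry n b c : Sig n b c = n%:R^-1 * \sum_j e n j b * e n j c.
Proof. by rewrite !mxE; congr (_ * _); apply: eq_bigr => j _; rewrite mxE. Qed.

Let tagged_cvg0 (g : forall n, T n -> R) :
  wexp (@W n) (fun s => g n s ^+ 2) @[n --> \oo] --> 0 ->
  g (projT1 y) (projT2 y) @[y --> prob_filter W] --> 0.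
Proof.
move=> h0.
exact: (@chebyshev_prob_filter _ _ _ W0 (fun y => g (projT1 y) (projT2 y))).
Qed.

Let sum_dev_sqr_le n (a : 'I_n -> R) m : \sum_j a j = n%:R * m ->
  \sum_j (a j - m) ^+ 2 <= \sum_j a j ^+ 2.
Proof.
move=> am; rewrite (eq_bigr (fun j => a j ^+ 2 - (2 * m * a j - m ^+ 2))); last first.
  by move=> j _; ring.
rewrite sumrB gerBl sumrB -mulr_sumr am sumr_const card_ord -[_ *+ n]mulr_natl.
have := mulr_ge0 (ler0n R n) (sqr_ge0 m); nra.
Qed.

Let em2_entry n (s : T n) b c : (n%:R^-1 *: ((em s)^T *m em s)) b c =
  n%:R^-1 * \sum_i e n (s i) b * e n (s i) c.
Proof. by rewrite !mxE; congr (_ * _); apply: eq_bigr => j _; rewrite !mxE. Qed.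

(** The variance involves fourth-order averages of residuals. They are bounded by the largest e_b^2,
    which is o(n), times the average of e_c^2, so no fourth-moment limit for residuals is
    required. *)
Let em2_var b c : wexp (@W n)
    (fun s => ((n%:R^-1 *: ((em s)^T *m em s)) b c - Sig n b c) ^+ 2)
  @[n --> \oo] --> 0.
Proof.
apply/cvgrPdist_le => eps eps0; pose A := `|Sigma c c| + 1.
have A0 : 0 < A by rewrite ltr_wpDl.
have /cvgrPdist_le/(_ 1 ltr01) hS : Sig n c c @[n --> \oo] --> Sigma c c.
  exact: cvg_mx_entry.
apply: filterS3 (e_small (divr_gt0 eps0 A0)) hS (nbhs_infty_gt 0) => n he hS n0.
have {}n0 : n%:R != 0 :> R by rewrite pnatr_eq0 -lt0n.
rewrite sub0r normrN ger0_norm; last by apply: wexp_ge0 => // s; exact: sqr_ge0.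
pose x (j : 'I_n) := n%:R^-1 * (e n j b * e n j c - Sig n b c).
have sum_Sig : \sum_j e n j b * e n j c = n%:R * Sig n b c.
  by rewrite Sig_entry mulVKf.
have -> : wexp (@W n)
    (fun s => ((n%:R^-1 *: ((em s)^T *m em s)) b c - Sig n b c) ^+ 2) =
    \sum_j x j ^+ 2.
  transitivity (wexp (@W n) (fun s => (\sum_i x (s i)) ^+ 2)).
    apply: eq_wexp => s; congr (_ ^+ 2).
    rewrite em2_entry -mulr_sumr sumrB sumr_const card_ord mulrBr.
    by rewrite -[Sig n b c *+ n]mulr_natl mulKf.
  rewrite (wexp_sum_sqr (@unifw_sum1 R n) (x := fun _ j => x j)).
    rewrite exchange_big/=; apply: eq_bigr => j _.
    by rewrite /unifw sumr_const card_ord -[_ *+ n]mulr_natl mulVKf.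
  move=> i; rewrite -mulr_sumr -mulr_sumr sumrB sum_Sig sumr_const card_ord.
  by rewrite -[Sig n b c *+ n]mulr_natl subrr !mulr0.
have -> : \sum_j x j ^+ 2 =
    n%:R^-1 * (n%:R^-1 * \sum_j (e n j b * e n j c - Sig n b c) ^+ 2).
  by rewrite !mulr_sumr; apply: eq_bigr => j _; rewrite /x; ring.
apply: (@le_trans _ _ (n%:R^-1 * (n%:R^-1 * \sum_j (e n j b * e n j c) ^+ 2))).
  by rewrite !ler_wpM2l// ?invr_ge0//; exact: sum_dev_sqr_le.
apply: (@le_trans _ _ (eps / A * Sig n c c)).
  have np : 0 < n%:R :> R by rewrite lt0r n0 ler0n.
  rewrite Sig_entry [leRHS]mulrCA ler_wpM2l ?invr_ge0// mulrC ler_pdivrMr//.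
  rewrite mulrAC mulr_sumr; apply: ler_sum => j _.
  by rewrite exprMn -[e n j c * _]expr2 ler_wpM2r ?sqr_ge0.
have : Sig n c c <= A.
  by move: hS (ler_norm (Sigma c c)); rewrite ler_norml /A => /andP[]; lra.
move=> h; apply: (@le_trans _ _ (eps / A * A)); last by rewrite divfK ?gt_eqF.
by rewrite ler_wpM2l// ltW// divr_gt0.
Qed.

Let em2_cvg : (projT1 y)%:R^-1 *: ((em (projT2 y))^T *m em (projT2 y))
  @[y --> prob_filter W] --> Sigma.
Proof.
apply: cvg_mx => b c.
have h := tagged_cvg0 (@em2_var b c).
have h2 : Sig (projT1 y) b c @[y --> prob_filter W] --> Sigma b c.
  by apply: (@cvg_tag_prob_filter _ _ W _ (fun n => Sig n b c)); exact: cvg_mx_entry.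
have h3 := cvgD (FF := bootstrap_filter) h h2; rewrite add0r in h3; apply: eq_cvg_fun h3 => y.
exact: subrK.
Qed.

Let inv_natr_cvg0 : (n%:R^-1 : R) @[n --> \oo] --> 0.
Proof.
apply/cvgrPdist_le => eps eps0.
apply: filterS2 (nbhs_infty_ger eps^-1) (nbhs_infty_gt 0) => n hn n0.
rewrite sub0r normrN ger0_norm ?invr_ge0// -[leRHS]invrK lef_pV2// posrE ?ltr0n//.
by rewrite invr_gt0.
Qed.

Let mean_em_cvg0 : mean_obs (em (projT2 y)) @[y --> prob_filter W] --> (0 : 'cV[R]_r).
Proof.
apply: cvg_mx => b j; rewrite ord1 mxE.
apply: (@tagged_cvg0 (fun n s => mean_obs (em s) b ord0)).
have h : n%:R^-1 * Sig n b b @[n --> \oo] --> 0.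
  rewrite -(mul0r (Sigma b b)); apply: cvgM => //; exact: cvg_mx_entry.
apply: eq_cvg_fun h => n.
transitivity (wexp (@W n) (fun s => (\sum_i n%:R^-1 * e n (s i) b) ^+ 2)).
  rewrite (resampled_moment2 e_sum0 (fun=> n%:R^-1) b); congr (_ * _).
  rewrite sumr_const card_ord -[(_ ^+ 2) *+ n]mulr_natl.
  have [->|n0] := eqVneq (n%:R : R) 0; first by rewrite mul0r invr0.
  by rewrite expr2 mulVKf.
apply: eq_wexp => s; rewrite mean_obsE mulr_sumr; congr (_ ^+ 2).
by apply: eq_bigr => i _; rewrite mxE.
Qed.

Let Delta n (s : T n) := (Num.sqrt n%:R)^-1 *: D s.

Let Delta_cvg0 : Delta (projT2 y) @[y --> prob_filter W] --> (0 : 'M[R]_(r, p)).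
Proof.
apply: cvg_mx => b k; rewrite mxE.
apply: (@tagged_cvg0 (fun n s => Delta s b k)).
have h : n%:R^-1 * wexp (@W n) (fun s => D s b k ^+ 2) @[n --> \oo] --> 0.
  by rewrite -(mul0r (invmx SigmaX k k * Sigma b b)); apply: cvgM.
apply: eq_cvg_fun h => n; rewrite -wexpZl; apply: eq_wexp => s.
by rewrite [Delta s b k]mxE exprMn natr_invE -expr2.
Qed.

Let cov_star n (s : T n) :=
  cov_obs (em s - X n *m ((em s)^T *m X n *m invmx ((X n)^T *m X n))^T).

Let near_unit : \forall n \near \oo, (0 < n)%N /\ (X n)^T *m X n \in unitmx.
Proof.
by apply: filterS2 (near_gram_unitmx X_cvg uSX) (nbhs_infty_gt 0) => n.
Qed.

Let resampled_ols n (s : T n) : (0 < n)%N -> (X n)^T *m X n \in unitmx ->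
  Num.sqrt n%:R *: ((em s)^T *m X n *m invmx ((X n)^T *m X n)) = (em s)^T *m v n.
Proof.
move=> n0 uX; rewrite /v /S invmxZ; last first.
  by rewrite unitmxZ// unitfE invr_eq0 pnatr_eq0 -lt0n.
rewrite invrK -!scalemxAr scalerA mulmxA; congr (_ *: _).
have s0 : Num.sqrt n%:R != 0 :> R by rewrite sqrtr_eq0 -ltNge ltr0n.
by rewrite -[X in _ * X](sqr_sqrtr (ler0n R n)) expr2 mulKf.
Qed.

Lemma bootstrap_cov_cvg : cov_star (projT2 y) @[y --> prob_filter W] --> Sigma.
Proof.
apply: (cvg_cov_residual (nn := @projT1 nat T) (X := X) (SigmaX := SigmaX)) => //.
  exact: (@cvg_tag_prob_filter _ _ W _ S).
apply: (@near_cvg_fun _ _ _ bootstrap_filter _ _ _ _ Delta_cvg0).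
apply: prob_filter_near; apply: filterS near_unit => n [n0 uX] s /=.
rewrite /Delta /D -resampled_ols// scalerA mulVf ?scale1r//.
by rewrite sqrtr_eq0 -ltNge ltr0n.
Qed.

(** The Slutsky lemma with the constant factor 1; its moment hypothesis supplies tightness. *)
Lemma bootstrap_clt (f : 'cV[R]_(p * r) -> R) C : continuous f ->
  (forall x, `|f x| <= C) ->
  wexp (@W n) (fun s => f (Num.sqrt n%:R *:
      vec ((em s)^T *m X n *m invmx ((X n)^T *m X n)))) @[n --> \oo] -->
  \int[mvnormal 0 (invmx SigmaX *t Sigma)]_x f x.
Proof.
move=> cf fC.
have := @slutsky_levy R _ (p * r) T W W0 W1 Sv _ (fun=> 1%:M) 1%:M Sv_cos Sv_moment (cvg_cst _).
rewrite trmx1 mulmx1 mul1mx => /(_ bootstrap_filter psdV f C cf fC).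
apply: near_cvg_fun; apply: filterS near_unit => n [n0 uX]; apply: eq_wexp => s.
by rewrite mul1mx vecZ resampled_ols.
Qed.

Let sqrt_S : \forall n \near \oo,
  sqrtmx ((X n)^T *m X n) = Num.sqrt n%:R *: sqrtmx (S n).
Proof.
apply: filterS near_unit => n [n0 uX].
have pXX : possemidef ((X n)^T *m X n).
  by rewrite -[_ *m _]scale1r; exact: possemidef_gram.
have pSn : possemidef (S n) by apply: possemidef_gram; rewrite invr_ge0.
have [[sq pq] qq] := sqrtmxP pSn.
apply: sqrtmx_unique; first exact: possemidef_unit_posdef.
  split; first by apply/matrixP => i j; have /matrixP/(_ i j) := sq; rewrite !mxE => ->.
  by move=> x; rewrite -scalemxAr -scalemxAl mxE mulr_ge0// sqrtr_ge0.
rewrite -scalemxAl -scalemxAr scalerA qq -expr2 sqr_sqrtr// scalerA divff ?scale1r//.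
by rewrite pnatr_eq0 -lt0n.
Qed.

Lemma bootstrap_studentized (f : 'cV[R]_(p * r) -> R) C : continuous f ->
  (forall x, `|f x| <= C) ->
  wexp (@W n) (fun s => f
    ((sqrtmx ((X n)^T *m X n) *t invmx (sqrtmx (cov_star s))) *m
      vec ((em s)^T *m X n *m invmx ((X n)^T *m X n)))) @[n --> \oo] -->
  \int[mvnormal 0 1%:M]_x f x.
Proof.
move=> cf fC.
pose B (y : {n & T n}) := sqrtmx (S (projT1 y)) *t invmx (sqrtmx (cov_star (projT2 y))).
pose B0 := sqrtmx SigmaX *t invmx (sqrtmx Sigma).
(* Whitening: each Kronecker factor reduces to the identity separately. *)
have BV : B0 *m (invmx SigmaX *t Sigma) *m B0^T = 1%:M.
  have [[sq _] qq] := sqrtmxP (posdef_possemidef pX).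
  have [[ss _] ss2] := sqrtmxP (posdef_possemidef pS).
  rewrite /B0 trmx_tens trmx_inv !tensmx_mul sq ss.
  have uq := sqrtmx_unitmx pX; have us := sqrtmx_unitmx pS.
  rewrite (invmx_sqr uq qq) mulmxA mulmxV// mul1mx mulVmx//.
  by rewrite -{2}ss2 mulmxA mulVmx// mul1mx mulmxV// tensmx11.
have B_cvg : B y @[y --> prob_filter W] --> B0.
  apply: cvg_tensmx.
    apply: (@cvg_tag_prob_filter _ _ W _ (fun n => sqrtmx (S n))).
    by apply: cvg_sqrtmx => // n; apply: possemidef_gram; rewrite invr_ge0.
  apply: cvg_invmx; last exact: sqrtmx_unitmx.
  apply: cvg_sqrtmx => //; last exact: bootstrap_cov_cvg.
  by move=> y; exact: possemidef_cov_obs.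
have := @slutsky_levy R _ (p * r) T W W0 W1 Sv _ B B0 Sv_cos Sv_moment B_cvg.
rewrite BV => /(_ _ f C cf fC).
have psd1 : possemidef (1%:M : 'M[R]_(p * r)).
  by have := possemidef_gram (1%:M : 'M[R]_(p * r)) ler01; rewrite scale1r trmx1 mulmx1.
move=> /(_ psd1); apply: near_cvg_fun.
apply: filterS2 near_unit sqrt_S => n [n0 uX] sq; apply: eq_wexp => s.
rewrite sq /B /Sv/= /D -resampled_ols// -vecZ; congr f.
by rewrite tensmxZl -scalemxAl scalemxAr.
Qed.

End bootstrap_regression.

(** * Residuals along a sample path *)

Section averages.
Context {R : realType}.

(** A term is a difference of consecutive partial sums, each known up to d times its length, so it
    is o(n); the finitely many early terms are bounded by their sum [K]. *)
Lemma avg_cvg_small (x : nat -> R) (c : R) : (forall i, 0 <= x i) ->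
  n%:R^-1 * \sum_(i < n) x i @[n --> \oo] --> c ->
  forall eta : R, 0 < eta -> \forall n \near \oo, forall i : 'I_n, x i <= eta * n%:R.
Proof.
move=> x0 /cvgrPdist_le xc eta eta0; pose d := eta / 4.
have d0 : 0 < d by rewrite divr_gt0.
have [N _ hN] := xc _ d0.
pose K := \sum_(i < N) x i.
(* This makes K + |c| + d <= 2 d n. Late terms are at most c + d + 2 d i, hence at most 4 d n = eta
   n. *)
apply: filterS (nbhs_infty_ger ((K + `|c| + d) / (2 * d))) => n.
rewrite ler_pdivrMr ?mulr_gt0// => hn i.
have K0 : 0 <= K by apply: sumr_ge0.
have eta4 : eta = 4 * d by rewrite /d; field.
have [iN|Ni] := ltnP i N.
  have : x i <= K by rewrite /K (bigD1 (Ordinal iN))//= lerDl sumr_ge0.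
  by rewrite eta4; have := normr_ge0 c; have := mulr_ge0 (ltW d0) (ler0n R n); lra.
have avgE m : \sum_(j < m) x j = m%:R * (m%:R^-1 * \sum_(j < m) x j).
  case: m => [|m]; first by rewrite big_ord0 mul0r.
  by rewrite mulVKf// pnatr_eq0.
have xi : x i = \sum_(j < i.+1) x j - \sum_(j < i) x j by rewrite big_ord_recr/= addrAC subrr add0r.
have := hN _ Ni; have := hN i.+1 (leqW Ni); rewrite /= !ler_norml.
move=> /andP[h1 _] /andP[_ h2].
have {}h1 : i.+1%:R^-1 * \sum_(j < i.+1) x j <= c + d.
  by rewrite -lerBlDl -lerN2 opprB.
have {}h2 : c - d <= i%:R^-1 * \sum_(j < i) x j by rewrite lerBlDr -lerBlDl.
have {}h1 : \sum_(j < i.+1) x j <= i.+1%:R * (c + d) by rewrite avgE ler_wpM2l.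
have {}h2 : i%:R * (c - d) <= \sum_(j < i) x j by rewrite [leRHS]avgE ler_wpM2l.
have ni : i%:R <= n%:R :> R by rewrite ler_nat ltnW.
rewrite xi eta4; move: h1; rewrite -natr1.
have := ler_norm c; have := ler_wpM2l (ltW d0) ni; nra.
Qed.

Lemma avg_cvg_bounded (x : nat -> R) (c : R) :
  n%:R^-1 * \sum_(i < n) x i @[n --> \oo] --> c ->
  exists C : R, forall n, \sum_(i < n) x i <= C * n%:R.
Proof.
move=> xc.
have /cvg_seq_bounded [M [_ hM]] : cvgn (fun n => n%:R^-1 * \sum_(i < n) x i).
  by apply/cvg_ex; exists c.
exists (M + 1) => -[|n]; first by rewrite big_ord0 mulr0.
have := hM (M + 1); rewrite ltrDl => /(_ ltr01 n.+1 I) /= h.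
rewrite -ler_pdivrMr ?ltr0n// mulrC; exact: le_trans (ler_norm _) h.
Qed.

(** If |x| <= |y| then (x + y)^2 <= 4 y^2; otherwise |x + y| <= 2 |x|, which doubles the truncation
    parameter. *)
Lemma trunc2D (a x y : R) : 0 <= a ->
  trunc2 a (x + y) <= 4 * trunc2 (2 * a) x + 4 * y ^+ 2.
Proof.
move=> a0; rewrite /trunc2 -(real_normK (num_real (x + y))).
rewrite -(real_normK (num_real x)) -(real_normK (num_real y)).
have := ler_normD x y; move: (normr_ge0 (x + y)) (normr_ge0 x) (normr_ge0 y).
move: `|x + y| `|x| `|y| => s u v s0 u0 v0 suv.
have m1 : 0 <= Num.min 1 (a * s) <= 1 by rewrite le_min ge_min ler01 lexx mulr_ge0.
have m2 : 0 <= Num.min 1 (2 * a * u) by rewrite le_min ler01 !mulr_ge0.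
have [uv|vu] := leP u v.
  have : 0 <= 4 * (u ^+ 2 * Num.min 1 (2 * a * u)).
    by rewrite !mulr_ge0.
  have : s ^+ 2 * Num.min 1 (a * s) <= s ^+ 2 by rewrite ler_piMr ?sqr_ge0//; case/andP: m1.
  have : s ^+ 2 <= 4 * v ^+ 2 by nra.
  lra.
have : s ^+ 2 * Num.min 1 (a * s) <= 4 * u ^+ 2 * Num.min 1 (2 * a * u).
  apply: ler_pM; rewrite ?sqr_ge0//; [by case/andP: m1|nra|].
  by rewrite le_min !ge_min lexx/= orbC; apply/orP; left; nra.
have := sqr_ge0 v; lra.
Qed.

End averages.

Lemma centeredE (R : realType) n r (E : 'M[R]_(n, r)) j b :
  centered E j b ord0 = E j b - mean_obs E b ord0.
Proof. by rewrite !mxE. Qed.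

Section residual_path.
Context {R : realType} (r p : nat) (X : nat -> 'cV[R]_p) (z : nat -> 'cV[R]_r).
Variables (beta : 'M[R]_(r, p)) (Sigma : 'M[R]_r) (SigmaX : 'M[R]_p).
Hypothesis uX : SigmaX \in unitmx.
Hypothesis X_cvg : n%:R^-1 *: ((stack X n)^T *m stack X n) @[n --> \oo] --> SigmaX.
Hypothesis z_mean : forall b, n%:R^-1 * \sum_(i < n) z i b ord0 @[n --> \oo] --> 0.
Hypothesis z_cross : forall b k,
  n%:R^-1 * \sum_(i < n) X i k ord0 * z i b ord0 @[n --> \oo] --> 0.
Hypothesis z_cov : forall b c,
  n%:R^-1 * \sum_(i < n) z i b ord0 * z i c ord0 @[n --> \oo] --> Sigma b c.
Hypothesis z_tail : forall b (eta : R), 0 < eta -> exists2 a : R, 0 < a &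
  \forall n \near \oo, n%:R^-1 * \sum_(i < n) trunc2 a (z i b ord0) <= eta.

Let E n := residuals (stack X n) (stack (fun i => beta *m X i + z i) n).

Definition centered_residuals n : 'M[R]_(n, r) :=
  \matrix_(j, b) centered (E n) j b ord0.

Let centered_entry n j b : centered_residuals n j b = E n j b - mean_obs (E n) b ord0.
Proof. by rewrite mxE centeredE. Qed.

Lemma centered_residuals_sum0 n b : \sum_j centered_residuals n j b = 0.
Proof.
under eq_bigr do rewrite centered_entry.
rewrite sumrB sumr_const card_ord -mulr_natl mean_obsE; move: (E n) => A.
case: n A => [|n] A; first by rewrite big_ord0 mul0r subr0.
by rewrite mulVKf ?subrr// pnatr_eq0.
Qed.

Lemma design_small (eta : R) : 0 < eta ->
  \forall n \near \oo, forall i k, stack X n i k ^+ 2 <= eta * n%:R.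
Proof.
move=> eta0.
have h : \forall n \near \oo, forall k (i : 'I_n), X i k ord0 ^+ 2 <= eta * n%:R.
  apply: filter_forall => k.
  apply: (@avg_cvg_small _ (fun i => X i k ord0 ^+ 2) (SigmaX k k)) => // [i|].
    exact: sqr_ge0.
  apply: eq_cvg_fun (cvg_mx_entry X_cvg) => n; rewrite !mxE; congr (_ * _).
  by apply: eq_bigr => i _; rewrite !mxE expr2.
by apply: filterS h => n h i k; rewrite mxE.
Qed.

Let Z n := stack z n.
(** The estimation error betahat - beta, once the Gram matrix is invertible. *)
Let A n := (Z n)^T *m stack X n *m invmx ((stack X n)^T *m stack X n).

Let near_unit : \forall n \near \oo, (stack X n)^T *m stack X n \in unitmx.
Proof. exact: (near_gram_unitmx (nn := id) (X := stack X) X_cvg uX). Qed.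

Let E_near : \forall n \near \oo, E n = Z n - stack X n *m (A n)^T.
Proof.
apply: filterS near_unit => n un; rewrite -[RHS](residuals_affine un beta); congr residuals.
apply/matrixP => i b; rewrite [LHS]mxE [RHS]mxE [Z n i b]mxE mxE; congr (_ + _).
by rewrite !mxE; apply: eq_bigr => k _; rewrite !mxE mulrC.
Qed.

Let A_cvg0 : A n @[n --> \oo] --> (0 : 'M[R]_(r, p)).
Proof.
have h1 : n%:R^-1 *: ((Z n)^T *m stack X n) @[n --> \oo] --> (0 : 'M[R]_(r, p)).
  apply: cvg_mx => b k; rewrite mxE; apply: eq_cvg_fun (@z_cross b k) => n.
  by rewrite !mxE; congr (_ * _); apply: eq_bigr => i _; rewrite !mxE mulrC.
have h2 : n%:R^-1 *: ((Z n)^T *m stack X n) *m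
    invmx (n%:R^-1 *: ((stack X n)^T *m stack X n)) @[n --> \oo] --> (0 : 'M[R]_(r, p)).
  by have := cvg_mulmx h1 (cvg_invmx X_cvg uX); rewrite mul0mx; apply.
apply: near_cvg_fun h2; apply: filterS2 near_unit (nbhs_infty_gt 0) => n un n0.
have nn0 : n%:R^-1 != 0 :> R by rewrite invr_eq0 pnatr_eq0 -lt0n.
rewrite invmxZ; last by rewrite unitmxZ// unitfE.
by rewrite -scalemxAl -scalemxAr scalerA invrK mulVf ?scale1r// -invr_eq0.
Qed.

Let mean_cvg0 : mean_obs (Z n) @[n --> \oo] --> (0 : 'cV[R]_r).
Proof.
apply: cvg_mx => b j; rewrite ord1 mxE; apply: eq_cvg_fun (@z_mean b) => n.
by rewrite mean_obsE; congr (_ * _); apply: eq_bigr => i _; rewrite mxE.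
Qed.

Lemma centered_residuals_cov :
  n%:R^-1 *: ((centered_residuals n)^T *m centered_residuals n) @[n --> \oo] --> Sigma.
Proof.
have h : cov_obs (Z n - stack X n *m (A n)^T) @[n --> \oo] --> Sigma.
  apply: (cvg_cov_residual (nn := id) (X := stack X) (SigmaX := SigmaX)) => //.
  apply: cvg_mx => b c; apply: eq_cvg_fun (@z_cov b c) => n.
  by rewrite !mxE; congr (_ * _); apply: eq_bigr => i _; rewrite !mxE.
apply: near_cvg_fun h; apply: filterS E_near => n En.
rewrite -En cov_obs_centered.
suff -> : \matrix_(i, b) (E n i b - mean_obs (E n) b ord0) = centered_residuals n by [].
by apply/matrixP => i b; rewrite centered_entry mxE.
Qed.

Let m n := mean_obs (Z n) - A n *m mean_obs (stack X n).

Let m_cvg0 : m n @[n --> \oo] --> (0 : 'cV[R]_r).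
Proof.
have h := cvgB mean_cvg0 (cvg0_mul_mean (nn := id) (X := stack X) X_cvg A_cvg0).
by rewrite subrr in h; exact: h.
Qed.

Let S n := n%:R^-1 *: ((stack X n)^T *m stack X n).

Let ASA_cvg0 b : (A n *m S n *m (A n)^T) b b @[n --> \oo] --> 0.
Proof.
have h : A n *m S n *m (A n)^T @[n --> \oo] --> (0 : 'M[R]_r).
  have := cvg_mulmx (cvg_mulmx A_cvg0 X_cvg) (cvg_trmx A_cvg0).
  by rewrite mul0mx mul0mx; apply.
by have := cvg_mx_entry (i := b) (j := b) h; rewrite mxE; apply.
Qed.

Lemma centered_residuals_tail b (eta : R) : 0 < eta -> exists2 a : R, 0 < a &
  \forall n \near \oo, n%:R^-1 * \sum_j trunc2 a (centered_residuals n j b) <= eta.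
Proof.
(* By [trunc2D] the truncated errors contribute 4 eta/8, and the squared corrections 4 (2 eta/32 + 2
   eta/32): together eta. Halving [a] below offsets the doubling in that lemma. *)
move=> eta0; have eta8 : 0 < eta / 8 by rewrite divr_gt0.
have eta32 : 0 < eta / 32 by rewrite divr_gt0.
have [a a0 ha] := z_tail b eta8; exists (a / 2); first by rewrite divr_gt0.
have hm : m n b ord0 ^+ 2 @[n --> \oo] --> 0.
  have h := cvg_mx_entry (i := b) (j := ord0) m_cvg0; rewrite mxE in h.
  have h2 : m n b ord0 * m n b ord0 @[n --> \oo] --> 0.
    by rewrite -(mulr0 0); exact: cvgM.
  by apply: eq_cvg_fun h2 => n; rewrite expr2.
move/cvgrPdist_le/(_ _ eta32): hm => hm.
have /cvgrPdist_le/(_ _ eta32) hA := @ASA_cvg0 b.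
near=> n.
have En : E n = Z n - stack X n *m (A n)^T by near: n.
have hmn : m n b ord0 ^+ 2 <= eta / 32.
  by apply: le_trans (ler_norm _) _; rewrite -normrN -sub0r; near: n.
have hAn : (A n *m S n *m (A n)^T) b b <= eta / 32.
  by apply: le_trans (ler_norm _) _; rewrite -normrN -sub0r; near: n.
have han : n%:R^-1 * \sum_(i < n) trunc2 a (z i b ord0) <= eta / 8 by near: n.
have n0 : (0 < n)%N by near: n; exact: nbhs_infty_gt.
pose dd (j : 'I_n) := (stack X n *m (A n)^T) j b + m n b ord0.
have eE j : centered_residuals n j b = z j b ord0 - dd j.
  rewrite centered_entry En mean_obsB_mul -/(m n) /dd opprD addrA mxE.
  by congr (_ + _ - _); rewrite ?mxE.
have dd2 : n%:R^-1 * \sum_j dd j ^+ 2 <= 2 * (A n *m S n *m (A n)^T) b b + 2 * m n b ord0 ^+ 2.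
  have -> : (A n *m S n *m (A n)^T) b b =
      n%:R^-1 * \sum_j (stack X n *m (A n)^T) j b ^+ 2.
    rewrite /S -scalemxAr -scalemxAl mxE; congr (_ * _).
    have -> : A n *m ((stack X n)^T *m stack X n) *m (A n)^T =
        (stack X n *m (A n)^T)^T *m (stack X n *m (A n)^T).
      by move: (A n) => B; rewrite trmx_mul trmxK !mulmxA.
    by rewrite mxE; apply: eq_bigr => j _; rewrite mxE expr2.
  apply: (@le_trans _ _ (n%:R^-1 * \sum_(j < n) (2 * (stack X n *m (A n)^T) j b ^+ 2 +
      2 * m n b ord0 ^+ 2))).
    rewrite ler_wpM2l ?invr_ge0//; apply: ler_sum => j _; rewrite /dd.
    have := sqr_ge0 ((stack X n *m (A n)^T) j b - m n b ord0).
    move: (_ j b) (m n b ord0) => u v; nra.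
  rewrite big_split/= sumr_const card_ord -mulr_sumr mulrDr mulrCA lerD2l.
  by rewrite -[(_ * _) *+ n]mulr_natl mulKf// pnatr_eq0 -lt0n.
apply: (@le_trans _ _ (n%:R^-1 * \sum_(j < n) (4 * trunc2 a (z j b ord0) + 4 * dd j ^+ 2))).
  rewrite ler_wpM2l ?invr_ge0//; apply: ler_sum => j _; rewrite eE.
  have := trunc2D (z j b ord0) (- dd j) (ltW (divr_gt0 a0 (ltr0n R 2))).
  by rewrite sqrrN [2 * (a / 2)]mulrC divfK//.
rewrite big_split/= -!mulr_sumr mulrDr [_ * (4 * _)]mulrCA [X in _ + X]mulrCA.
lra.
Unshelve. all: by end_near. Qed.

End residual_path.

(** * Almost sure limits of error averages *)

Section error_path.
Context {R : realType} (r p : nat) d (T : measurableType d) (P : probability T R).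
Variables (eps : nat -> T -> 'cV[R]_r) (F : probability 'cV[R]_r R).
Variables (X : nat -> 'cV[R]_p) (Sigma : 'M[R]_r).
Hypothesis heps : iid P eps F.
Hypothesis hmean : forall j, ('E_F[fun z => z j ord0] = 0)%E.
Hypothesis hcov : forall j k,
  covariance F (fun z => z j ord0) (fun z => z k ord0) = (Sigma j k)%:E.
Hypothesis hmom4 : forall j, ('E_F[fun z => (z j ord0 ^+ 4)%R] < +oo)%E.

Let mcoord j : measurable_fun setT (fun z : 'cV[R]_r => z j ord0).
Proof. exact: measurable_entry. Qed.

Let int4 j : rintegrable F (fun z => z j ord0 ^+ 4).
Proof.
apply/integrableP; split; first by apply/measurable_EFinP; exact: measurable_funX.
have := hmom4 j; rewrite unlock; apply: le_lt_trans.
rewrite le_eqVlt; apply/orP; left; apply/eqP; apply: eq_integral => z _ /=.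
by rewrite ger0_norm// (exprM _ 2 2) sqr_ge0.
Qed.

Let int_le4 (g : 'cV[R]_r -> R) (C : R) j : measurable_fun setT g ->
  (forall z, `|g z| <= C * (1 + z j ord0 ^+ 4)) -> rintegrable F g.
Proof.
move=> mg hg; apply: (le_rintegrable mg hg); apply: rintegrableZ.
by apply: rintegrableD => //; exact: rintegrable_cst.
Qed.

Let int2 j : rintegrable F (fun z => z j ord0 ^+ 2).
Proof.
apply: (@int_le4 _ 1 j) => [|z]; first exact: measurable_funX.
rewrite ger0_norm ?sqr_ge0// mul1r (exprM _ 2 2).
by have := sqr_ge0 (z j ord0 ^+ 2 - 1); nra.
Qed.

Let int11 j k : rintegrable F (fun z => z j ord0 * z k ord0).
Proof. exact: rintegrableM. Qed.

Let mean0 j : \int[F]_z (z j ord0) = 0.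
Proof. by rewrite /Rintegral; have := hmean j; rewrite unlock => ->. Qed.

Let covE j k : \int[F]_z (z j ord0 * z k ord0) = Sigma j k.
Proof.
rewrite /Rintegral; have := hcov j k; rewrite unlock !hmean /=.
rewrite unlock => h.
have -> : (\int[F]_z (z j ord0 * z k ord0)%:E = (Sigma j k)%:E)%E; last by [].
rewrite -h; apply: eq_integral => z _.
by transitivity ((z j ord0 - 0) * (z k ord0 - 0))%:E; first by rewrite !subr0.
Qed.

Lemma ae_error_mean : {ae P, forall w, forall b,
  n%:R^-1 * \sum_(i < n) eps i w b ord0 @[n --> \oo] --> 0}.
Proof.
apply: filter_forall => b.
have h n : \sum_(i < n) (1 : R) ^+ 2 <= 1 * n%:R.
  by rewrite expr1n sumr_const card_ord mul1r.
have := slln_weighted heps (x := fun=> 1) (mcoord b) (int4 b) (mean0 b) h.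
apply: filterS => w; apply: eq_cvg_fun => n; congr (_ * _).
by apply: eq_bigr => i _; rewrite mul1r.
Qed.

Lemma ae_error_cross : (forall k, exists C : R, forall n,
    \sum_(i < n) X i k ord0 ^+ 2 <= C * n%:R) ->
  {ae P, forall w, forall b k,
  n%:R^-1 * \sum_(i < n) X i k ord0 * eps i w b ord0 @[n --> \oo] --> 0}.
Proof.
move=> hX; apply: filter_forall => b; apply: filter_forall => k.
have [C hC] := hX k.
exact: (slln_weighted heps (x := fun i => X i k ord0) (mcoord b) (int4 b) (mean0 b) hC).
Qed.

(** Polarization: the strong law for nonnegative functions applies to squares of coordinates and of
    their sums, and the product is half the difference. *)
Lemma ae_error_cov : {ae P, forall w, forall b c,
  n%:R^-1 * \sum_(i < n) eps i w b ord0 * eps i w c ord0 @[n --> \oo] --> Sigma b c}.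
Proof.
apply: filter_forall => b; apply: filter_forall => c.
have sq j : {ae P, forall w, n%:R^-1 * \sum_(i < n) eps i w j ord0 ^+ 2 @[n --> \oo] -->
    Sigma j j}.
  have -> : Sigma j j = \int[F]_z (z j ord0 ^+ 2).
    by rewrite -covE; apply: eq_Rintegral => z _; rewrite expr2.
  apply: (slln_nonneg heps (g := fun z => z j ord0 ^+ 2)) => [||z].
  - exact: measurable_funX.
  - by rewrite /rintegrable /comp; under eq_fun do rewrite -exprM; exact: int4.
  - exact: sqr_ge0.
have sqD : {ae P, forall w, n%:R^-1 *
    \sum_(i < n) (eps i w b ord0 + eps i w c ord0) ^+ 2 @[n --> \oo] -->
    Sigma b b + 2 * Sigma b c + Sigma c c}.
  have -> : Sigma b b + 2 * Sigma b c + Sigma c c =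
      \int[F]_z ((z b ord0 + z c ord0) ^+ 2).
    have i2 := rintegrableZ 2 (int11 b c).
    transitivity (\int[F]_z (z b ord0 * z b ord0 + 2 * (z b ord0 * z c ord0) +
        z c ord0 * z c ord0)); last by apply: eq_Rintegral => z _; ring.
    rewrite (rintegral_add (rintegrableD (int11 b b) i2) (int11 c c)).
    have E2 : \int[F]_z (2 * (z b ord0 * z c ord0)) = 2 * Sigma b c.
      by rewrite (rintegral_scale 2 (int11 b c)) covE.
    by rewrite (rintegral_add (int11 b b) i2) E2 (covE b b) (covE c c).
  apply: (slln_nonneg heps (g := fun z => (z b ord0 + z c ord0) ^+ 2)) => [||z].
  - by apply: measurable_funX; exact: measurable_funD.
  - apply: (@le_rintegrable _ _ _ _ _ (fun z : 'cV[R]_r => 8 * z b ord0 ^+ 4 + 8 * z c ord0 ^+ 4)).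
    + by do 2 apply: measurable_funX; exact: measurable_funD.
    + move=> z; rewrite ger0_norm ?sqr_ge0//; move: (z b ord0) (z c ord0) => u v.
      have h1 : (u + v) ^+ 2 <= 2 * u ^+ 2 + 2 * v ^+ 2 by have := sqr_ge0 (u - v); nra.
      have : ((u + v) ^+ 2) ^+ 2 <= (2 * u ^+ 2 + 2 * v ^+ 2) ^+ 2.
        by rewrite ler_sqr// nnegrE ?(le_trans _ h1)// sqr_ge0.
      have E4 (x : R) : x ^+ 4 = (x ^+ 2) ^+ 2 by rewrite -exprM.
      move=> h2; apply: le_trans h2 _; rewrite !E4.
      by have := sqr_ge0 (u ^+ 2 - v ^+ 2); move: (u ^+ 2) (v ^+ 2) => s t; nra.
    + by apply: rintegrableD; apply: rintegrableZ.
  - exact: sqr_ge0.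
apply: filterS3 (sq b) (sq c) sqD => w hb hc hbc.
have h : 2^-1 * (n%:R^-1 * (\sum_(i < n) (eps i w b ord0 + eps i w c ord0) ^+ 2) -
    n%:R^-1 * (\sum_(i < n) eps i w b ord0 ^+ 2) -
    n%:R^-1 * (\sum_(i < n) eps i w c ord0 ^+ 2)) @[n --> \oo] --> Sigma b c.
  have -> : Sigma b c = 2^-1 * (Sigma b b + 2 * Sigma b c + Sigma c c - Sigma b b
      - Sigma c c) by field.
  by apply: cvgM; [exact: cvg_cst|apply: cvgB => //; exact: cvgB].
apply: eq_cvg_fun h => n; rewrite -!mulrBr -!sumrB mulrCA mulr_sumr; congr (_ * _).
by apply: eq_bigr => i _; field.
Qed.

(** The strong law is applied for the countably many parameters 1/(m+1), which keeps a single null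
    set. The limits are at most K/(m+1), since |x|^3 <= 1 + x^4. *)
Lemma ae_error_tail : {ae P, forall w, forall b (eta : R), 0 < eta ->
  exists2 a : R, 0 < a & \forall n \near \oo,
    n%:R^-1 * \sum_(i < n) trunc2 a (eps i w b ord0) <= eta}.
Proof.
apply: filter_forall => b.
pose K := 1 + \int[F]_z (z b ord0 ^+ 4).
have K0 : 0 < K by rewrite ltr_pwDl// Rintegral_ge0// => z _; rewrite (exprM _ 2 2) sqr_ge0.
have mt (a : R) : measurable_fun setT (fun z : 'cV[R]_r => trunc2 a (z b ord0)).
  apply: measurable_funM; first exact: measurable_funX.
  apply: measurable_minr => //; apply: measurable_funM => //.
  exact: measurableT_comp.
have t2 (a x : R) : 0 <= a -> 0 <= trunc2 a x <= x ^+ 2.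
  move=> a0; rewrite trunc2_ge0//= /trunc2 ler_piMr ?sqr_ge0//.
  by rewrite ge_min lexx.
have h (m : nat) : {ae P, forall w, n%:R^-1 *
    \sum_(i < n) trunc2 m.+1%:R^-1 (eps i w b ord0) @[n --> \oo] -->
    \int[F]_z trunc2 m.+1%:R^-1 (z b ord0)}.
  have a0 : 0 <= m.+1%:R^-1 :> R by rewrite invr_ge0.
  apply: (slln_nonneg heps (g := fun z => trunc2 m.+1%:R^-1 (z b ord0))) => //.
  - apply: (@le_rintegrable _ _ _ _ _ (fun z : 'cV[R]_r => z b ord0 ^+ 4)) => //.
      exact: measurable_funX.
    move=> z; rewrite ger0_norm ?sqr_ge0// (exprM _ 2 2).
    have /andP[u0 u1] := t2 _ (z b ord0) a0.
    by rewrite ler_sqr ?nnegrE ?sqr_ge0.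
  - by move=> z; have /andP[] := t2 _ (z b ord0) a0.
have hK (a : R) : 0 <= a -> \int[F]_z trunc2 a (z b ord0) <= a * K.
  move=> a0.
  have -> : a * K = \int[F]_z (a * (1 + z b ord0 ^+ 4)).
    rewrite RintegralZl//; last by apply: rintegrableD => //; exact: rintegrable_cst.
    by rewrite (rintegral_add (rintegrable_cst F 1) (int4 b)) Rintegral_cst1.
  apply: le_Rintegral => //.
  - apply: (@le_rintegrable _ _ _ _ _ (fun z : 'cV[R]_r => z b ord0 ^+ 2)) => // z.
    by have /andP[u0 u1] := t2 _ (z b ord0) a0; rewrite ger0_norm.
  - by apply: rintegrableZ; apply: rintegrableD => //; exact: rintegrable_cst.
  move=> z _; rewrite /trunc2; move: (z b ord0) => x.
  apply: (@le_trans _ _ (x ^+ 2 * (a * `|x|))).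
    by rewrite ler_wpM2l ?sqr_ge0// ge_min lexx orbT.
  rewrite mulrCA ler_wpM2l// -(real_normK (num_real x)) (exprM _ 2 2).
  rewrite -(real_normK (num_real x)); have := normr_ge0 x; move: `|x| => u u0.
  have := sqr_ge0 (u ^+ 2 - u); have := sqr_ge0 (u - 1); nra.
apply: filterS (ae_foralln h) => w {}h eta eta0.
have [m hm] : exists m : nat, m.+1%:R^-1 * K <= eta / 2.
  have := archi_boundP (ltW (divr_gt0 K0 (divr_gt0 eta0 (ltr0n R 2)))).
  set m := Num.bound _ => hm; exists m.
  rewrite mulrC ler_pdivrMr// mulrC -ler_pdivrMr ?divr_gt0// (le_trans (ltW hm))//.
  by rewrite ler_nat.
exists m.+1%:R^-1; first by rewrite invr_gt0.
have e2 : 0 < eta / 2 by rewrite divr_gt0.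
have /cvgrPdist_le/(_ _ e2) := @h m; apply: filterS => n.
have := hK m.+1%:R^-1; rewrite invr_ge0 => /(_ (ler0n _ _)).
move: (\int[F]_z trunc2 _ _) (n%:R^-1 * _) (m.+1%:R^-1 * K) hm => I A c hm.
by rewrite ler_norml => h1 /andP[h2 _]; lra.
Qed.

End error_path.

(** * Transfer to an arbitrary bootstrap space *)

Section measurable_matrix_operations.
Context {R : realType} d (T : measurableType d).

Lemma measurable_mx_entry m n (f : T -> 'M[R]_(m, n)) i j :
  measurable_fun setT f -> measurable_fun setT (fun t => f t i j).
Proof. by move=> mf; exact: (measurableT_comp (measurable_entry i j) mf). Qed.

Lemma measurable_mulmx m n p (f : T -> 'M[R]_(m, n)) (g : T -> 'M[R]_(n, p)) :
  measurable_fun setT f -> measurable_fun setT g ->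
  measurable_fun setT (fun t => f t *m g t).
Proof.
move=> mf mg; apply: measurable_fun_mx => i j; under eq_fun do rewrite mxE.
by apply: measurable_sum => k; apply: measurable_funM; exact: measurable_mx_entry.
Qed.

Lemma measurable_addmx m n (f g : T -> 'M[R]_(m, n)) :
  measurable_fun setT f -> measurable_fun setT g ->
  measurable_fun setT (fun t => f t + g t).
Proof.
move=> mf mg; apply: measurable_fun_mx => i j; under eq_fun do rewrite mxE.
by apply: measurable_funD; exact: measurable_mx_entry.
Qed.

Lemma measurable_scalemx m n c (f : T -> 'M[R]_(m, n)) :
  measurable_fun setT f -> measurable_fun setT (fun t => c *: f t).
Proof.
move=> mf; apply: measurable_fun_mx => i j; under eq_fun do rewrite mxE.
by apply: measurable_funM => //; exact: measurable_mx_entry.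
Qed.

Lemma measurable_submx m n (f g : T -> 'M[R]_(m, n)) :
  measurable_fun setT f -> measurable_fun setT g ->
  measurable_fun setT (fun t => f t - g t).
Proof.
move=> mf mg; apply: measurable_addmx => //.
by under eq_fun do rewrite -scaleN1r; exact: measurable_scalemx.
Qed.

Lemma measurable_trmx m n (f : T -> 'M[R]_(m, n)) :
  measurable_fun setT f -> measurable_fun setT (fun t => (f t)^T).
Proof.
move=> mf; apply: measurable_fun_mx => i j; under eq_fun do rewrite mxE.
exact: measurable_mx_entry.
Qed.

Lemma measurable_tensmx m n p q (f : T -> 'M[R]_(m, n)) (g : T -> 'M[R]_(p, q)) :
  measurable_fun setT f -> measurable_fun setT g ->
  measurable_fun setT (fun t => f t *t g t).
Proof.
move=> mf mg; apply: measurable_fun_mx => i j; under eq_fun do rewrite mxE.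
by apply: measurable_funM; exact: measurable_mx_entry.
Qed.

Lemma measurable_vec m n (f : T -> 'M[R]_(m, n)) :
  measurable_fun setT f -> measurable_fun setT (fun t => vec (f t)).
Proof.
move=> mf; apply: measurable_fun_mx => i j; case/mxvec_indexP: i => a b.
by under eq_fun do rewrite vecE; exact: measurable_mx_entry.
Qed.

Lemma measurable_mean_obs n r (f : T -> 'M[R]_(n, r)) :
  measurable_fun setT f -> measurable_fun setT (fun t => mean_obs (f t)).
Proof.
move=> mf; under eq_fun do rewrite mean_obs_mul.
by apply: measurable_scalemx; apply: measurable_mulmx => //; exact: measurable_trmx.
Qed.

Lemma measurable_cov_obs n r (f : T -> 'M[R]_(n, r)) :
  measurable_fun setT f -> measurable_fun setT (fun t => cov_obs (f t)).
Proof.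
move=> mf; under eq_fun do rewrite cov_obsE; have mm := measurable_mean_obs mf.
apply: measurable_submx; last by apply: measurable_mulmx => //; exact: measurable_trmx.
by apply: measurable_scalemx; apply: measurable_mulmx => //; exact: measurable_trmx.
Qed.

Lemma measurable_obs_mx n r (f : T -> 'M[R]_(n, r)) :
  (forall i, measurable_fun setT (fun t => obs (f t) i)) -> measurable_fun setT f.
Proof.
move=> mf; apply: measurable_fun_mx => i j.
have := measurable_mx_entry j ord0 (mf i); apply: eq_measurable_fun => t _.
by rewrite !mxE.
Qed.

End measurable_matrix_operations.

Section bootstrap_transfer.
Context {R : realType} (r : nat) (E : forall n, 'M[R]_(n, r)).
Variables (dB : nat -> measure_display) (TB : forall n, measurableType (dB n)).
Variables (PB : forall n, probability (TB n) R) (epsB : forall n, TB n -> 'M[R]_(n, r)).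
Hypothesis hB : forall n,
  iid (PB n) (fun i t => obs (epsB t) i) (empirical_centered (E n)).

(** By [bootstrap_law] the expectation differs from the finite sum by at most 2C times the weight of
    the resamples that are not [good]. *)
Lemma bootstrap_cvg_in_distribution k (Z : forall n, TB n -> 'cV[R]_k)
    (Phi : forall n, 'M[R]_(n, r) -> 'cV[R]_k) (good : forall n, pred 'M[R]_(n, r))
    (mu : probability 'cV[R]_k R) :
  (forall n, measurable_fun setT (Z n)) ->
  (forall n t, good n (epsB t) -> Z n t = Phi n (epsB t)) ->
  wexp (prodw (@unifw R n)) (fun s => (~~ good n (resample (E n) s))%:R)
    @[n --> \oo] --> 0 ->
  (forall f C, continuous f -> (forall x, `|f x| <= C) ->
    wexp (prodw (@unifw R n)) (fun s => f (Phi n (resample (E n) s)))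
      @[n --> \oo] --> \int[mu]_x f x) ->
  cvg_in_distribution PB Z mu.
Proof.
move=> mZ ZPhi hgood hPhi f cf bf.
have [C fC] : exists C : R, forall x, `|f x| <= C.
  have [M [_ hM]] := bf; exists (M + 1) => x.
  by have := hM (M + 1); rewrite ltrDl => /(_ ltr01 x I).
have mf := continuous_bounded_measurable cf fC.
have EE d (T : measurableType d) (P : probability T R) (g : T -> R) :
    measurable_fun setT g -> (forall x, `|g x| <= C) -> ('E_P[g] = (\int[P]_x g x)%R%:E)%E.
  move=> mg gC; have ig : rintegrable P g by apply: (@bounded_integrable _ _ _ P g C).
  by rewrite unlock /Rintegral fineK//; exact: integrable_fin_num.
rewrite (EE _ _ mu f)//.
have -> : (fun n => 'E_(PB n)[fun t => f (Z n t)])%E =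
    EFin \o (fun n => \int[PB n]_t f (Z n t)).
  by apply/funext => n /=; apply: EE => //; exact: measurableT_comp.
apply: cvg_EFin; first by near=> n.
have h1 := hPhi f C cf fC.
have h2 : 2 * C * wexp (prodw (@unifw R n)) (fun s => (~~ good n (resample (E n) s))%:R)
    @[n --> \oo] --> 0.
  by rewrite -(mulr0 (2 * C)); apply: cvgM => //; exact: cvg_cst.
have h3 : \int[PB n]_t f (Z n t) -
    wexp (prodw (@unifw R n)) (fun s => f (Phi n (resample (E n) s)))
    @[n --> \oo] --> 0.
  apply/norm_cvg0P; apply: (squeeze_cvgr _ (cvg_cst 0) h2); apply: nearW => n.
  rewrite normr_ge0/=.
  apply: (@bootstrap_law R n r (E n) _ _ (PB n) (@epsB n) (hB n) (fun t => f (Z n t))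
    (fun A => f (Phi n A)) (good n) C) => // [|t gt].
    exact: measurableT_comp.
  by rewrite ZPhi.
have h4 : \int[PB n]_t f (Z n t) -
    wexp (prodw (@unifw R n)) (fun s => f (Phi n (resample (E n) s))) +
    wexp (prodw (@unifw R n)) (fun s => f (Phi n (resample (E n) s)))
    @[n --> \oo] --> \int[mu]_x f x.
  by rewrite -[X in _ --> X]add0r; exact: cvgD.
by apply: eq_cvg_fun h4 => n; rewrite subrK.
Unshelve. all: by end_near. Qed.

(** With every resample [good] the error term of [bootstrap_law] is 0, so probabilities are
    transferred exactly. *)
Lemma bootstrap_cvg_in_probability k l (Phi : forall n, 'M[R]_(n, r) -> 'M[R]_(k, l))
    (C : 'M[R]_(k, l)) :
  (forall n, measurable_fun setT (fun t => Phi n (epsB t))) ->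
  (forall e : R, 0 < e -> wexp (prodw (@unifw R n))
      (fun s => (e <= `|Phi n (resample (E n) s) - C|)%R%:R) @[n --> \oo] --> 0) ->
  cvg_in_probability PB (fun n t => Phi n (epsB t)) C.
Proof.
move=> mPhi h e e0.
have mset n : measurable [set t | e <= `|Phi n (epsB t) - C|].
  have mf : measurable_fun setT (fun t => `|Phi n (epsB t) - C|).
    by apply: (measurableT_comp (@measurable_mx_norm R k l)); exact: measurable_submx.
  rewrite -[X in measurable X]setTI.
  have := mf measurableT _ (measurable_itv `[e, +oo[).
  by congr (measurable (_ `&` _)); apply/seteqP; split => t /=; rewrite in_itv/= andbT.
have -> : (fun n => PB n [set t | e <= `|Phi n (epsB t) - C|]) =
    EFin \o (fun n => wexp (prodw (@unifw R n))
      (fun s => (e <= `|Phi n (resample (E n) s) - C|)%R%:R)).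
  apply/funext => n /=.
  have := @bootstrap_law R n r (E n) _ _ (PB n) (@epsB n) (hB n)
    (\1_[set t | e <= `|Phi n (epsB t) - C|])
    (fun A => (e <= `|Phi n A - C|)%R%:R) xpredT 1.
  have -> : wexp (prodw (@unifw R n)) (fun=> (~~ true)%:R) = 0.
    by rewrite /wexp big1// => s _; rewrite mulr0.
  rewrite mulr0 normr_le0 subr_eq0 => h1.
  have /eqP <- : \int[PB n]_t \1_[set t | e <= `|Phi n (epsB t) - C|] t ==
      wexp (prodw (@unifw R n)) (fun s => (e <= `|Phi n (resample (E n) s) - C|)%R%:R).
    apply: h1 => [|t|A|t _].
    - exact: measurable_indic.
    - by rewrite indicE; case: (_ \in _); rewrite ?normr1 ?normr0.
    - by case: (e <= _); rewrite ?normr1 ?normr0.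
    - by rewrite indicE mem_setE.
  rewrite /Rintegral integral_indic// setIT fineK//.
  exact: fin_num_measure.
apply: cvg_EFin; [by near=> n|exact: h].
Unshelve. all: by end_near. Qed.

End bootstrap_transfer.

(** The deterministic core: a fixed error sequence [z] whose averages behave as on a typical
    path. *)
Lemma residual_bootstrap_limits (R : realType) (r p : nat) (X : nat -> 'cV[R]_p)
    (beta : 'M[R]_(r, p)) (z y : nat -> 'cV[R]_r) (Sigma : 'M[R]_r) (SigmaX : 'M[R]_p)
    (dB : nat -> measure_display) (OmegaB : forall n, measurableType (dB n))
    (PB : forall n, probability (OmegaB n) R)
    (epsB : forall n, OmegaB n -> 'M[R]_(n, r)) :
  (forall i, y i = beta *m X i + z i) -> posdef Sigma -> posdef SigmaX ->
  n%:R^-1 *: ((stack X n)^T *m stack X n) @[n --> \oo] --> SigmaX ->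
  (forall b, n%:R^-1 * \sum_(i < n) z i b ord0 @[n --> \oo] --> 0) ->
  (forall b k, n%:R^-1 * \sum_(i < n) X i k ord0 * z i b ord0 @[n --> \oo] --> 0) ->
  (forall b c, n%:R^-1 * \sum_(i < n) z i b ord0 * z i c ord0 @[n --> \oo] -->
    Sigma b c) ->
  (forall b (eta : R), 0 < eta -> exists2 a : R, 0 < a & \forall n \near \oo,
    n%:R^-1 * \sum_(i < n) trunc2 a (z i b ord0) <= eta) ->
  let XX n := stack X n in
  let YY n := stack y n in
  let bhat n := ols (XX n) (YY n) in
  let bstar n t := boot_ols (XX n) (YY n) (epsB n t) in
  let Sstar n t := boot_cov (XX n) (YY n) (epsB n t) in
  (forall n, iid (PB n) (fun i t => obs (epsB n t) i)
    (empirical_centered (residuals (XX n) (YY n)))) ->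
  [/\ cvg_in_distribution PB
        (fun n t => Num.sqrt n%:R *: (vec (bstar n t) - vec (bhat n)))
        (mvnormal 0 (invmx SigmaX *t Sigma)),
      cvg_in_probability PB Sstar Sigma &
      forall SstarInvSqrt : forall n, OmegaB n -> 'M[R]_r,
        (forall n, measurable_fun [set: OmegaB n] (SstarInvSqrt n)) ->
        (forall n t, Sstar n t \in unitmx ->
           SstarInvSqrt n t = invmx (sqrtmx (Sstar n t))) ->
        cvg_in_distribution PB
          (fun n t => (sqrtmx ((XX n)^T *m XX n) *t SstarInvSqrt n t) *m
                      (vec (bstar n t) - vec (bhat n)))
          (mvnormal 0 1%:M)].
Proof.
move=> hY hSigma hSigmaX hX z_mean z_cross z_cov z_tail XX YY bhat bstar Sstar hB.
have uX := posdef_unitmx hSigmaX.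
have YYE n : YY n = stack (fun i => beta *m X i + z i) n.
  by congr (stack _ n); apply/funext => i; exact: hY.
pose e := centered_residuals X z beta.
have e_sum0 := @centered_residuals_sum0 R r p X z beta.
have e_cov := @centered_residuals_cov R r p X z beta Sigma SigmaX
  uX hX z_mean z_cross z_cov.
have e_tail := @centered_residuals_tail R r p X z beta SigmaX
  uX hX z_mean z_cross z_tail.
have X_small := @design_small R p X SigmaX hX.
have resampleE n s : resample (residuals (XX n) (YY n)) s = \matrix_(i, b) e n (s i) b.
  by apply/matrixP => i b; rewrite YYE [LHS]mxE [RHS]mxE [RHS]mxE.
have near_unit : \forall n \near \oo, (stack X n)^T *m stack X n \in unitmx.
  exact: (near_gram_unitmx (nn := id) (X := stack X) hX uX).
have bootE n (E : 'M[R]_(n, r)) : (XX n)^T *m XX n \in unitmx ->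
    vec (boot_ols (XX n) (YY n) E) - vec (bhat n) =
    vec (E^T *m XX n *m invmx ((XX n)^T *m XX n)).
  by move=> un; rewrite vecB /boot_ols /boot_response ols_affine// addrC addKr.
have covE n (E : 'M[R]_(n, r)) : (XX n)^T *m XX n \in unitmx ->
    boot_cov (XX n) (YY n) E =
    cov_obs (E - XX n *m (E^T *m XX n *m invmx ((XX n)^T *m XX n))^T).
  by move=> un; rewrite /boot_cov /boot_response residuals_affine.
have mepsB n : measurable_fun setT (epsB n).
  by apply: measurable_obs_mx; case: (hB n).
have mresp n : measurable_fun setT (fun t => boot_response (XX n) (YY n) (epsB n t)).
  exact: measurable_addmx.
have mbstar n : measurable_fun setT (fun t => bstar n t).
  apply: measurable_mulmx => //; apply: measurable_mulmx => //.
  exact: measurable_trmx.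
have mSstar n : measurable_fun setT (fun t => Sstar n t).
  apply: measurable_cov_obs; apply: measurable_submx => //.
  by apply: measurable_mulmx => //; exact: measurable_trmx.
have mdiff n : measurable_fun setT (fun t => vec (bstar n t) - vec (bhat n)).
  by apply: measurable_submx => //; exact: measurable_vec.
have W0 n (s : {ffun 'I_n -> 'I_n}) : 0 <= prodw (@unifw R n) s.
  exact/prodw_ge0/unifw_ge0.
have FF : Filter (prob_filter (T := fun n => {ffun 'I_n -> 'I_n} : finType)
    (fun n => prodw (@unifw R n))) by exact: prob_filter_filter.
have covcvg := bootstrap_cov_cvg (X := stack X) (e := e) hSigmaX hX
  e_sum0 e_cov e_tail.
split.
- apply: (bootstrap_cvg_in_distribution hB
    (Phi := fun n E => Num.sqrt n%:R *: (vec (boot_ols (XX n) (YY n) E) - vec (bhat n)))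
    (good := fun=> xpredT)) => //.
  + by move=> n; exact: measurable_scalemx.
  + apply: eq_cvg_fun (cvg_cst 0) => n.
    by rewrite /wexp big1// => s _; rewrite mulr0.
  + move=> f C cf fC.
    have h := @bootstrap_clt R r p (stack X) e SigmaX Sigma hSigmaX hSigma hX X_small
      e_sum0 e_cov e_tail f C cf fC.
    apply: near_cvg_fun h; apply: filterS near_unit => n un.
    by apply: eq_wexp => s; rewrite bootE// resampleE.
- apply: (bootstrap_cvg_in_probability hB
    (Phi := fun n E => boot_cov (XX n) (YY n) E)) => // eta eta0.
  have h := cvgr_dist_lt (FF := FF) _ _ covcvg _ eta0.
  apply: (wexp_prob_filter (b := fun n s =>
    eta <= `|boot_cov (XX n) (YY n) (resample (residuals (XX n) (YY n)) s) - Sigma|) W0 h).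
  apply: filterS near_unit => n un s /= hs.
  by rewrite -ltNge covE// resampleE distrC.
- move=> Q mQ QE.
  apply: (bootstrap_cvg_in_distribution hB
    (Phi := fun n E => (sqrtmx ((XX n)^T *m XX n) *t
         invmx (sqrtmx (boot_cov (XX n) (YY n) E))) *m
       (vec (boot_ols (XX n) (YY n) E) - vec (bhat n)))
    (good := fun n E => boot_cov (XX n) (YY n) E \in unitmx)).
  + by move=> n; apply: measurable_mulmx => //; exact: measurable_tensmx.
  + by move=> n t /= ut; rewrite (QE n t ut).
  (* The bootstrap covariance converges in probability to an invertible matrix, so the event where
     the inverse root is arbitrary has vanishing weight. *)
  + apply: (wexp_prob_filter (b := fun n s => boot_cov (XX n) (YY n)
      (resample (residuals (XX n) (YY n)) s) \notin unitmx) W0 (near_unitmx (FF := FF) covcvg (posdef_unitmx hSigma))).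
    apply: filterS near_unit => n un s /= us.
    by rewrite negbK (covE _ _ un) resampleE; exact: us.
  + move=> f C cf fC.
    have h := @bootstrap_studentized R r p (stack X) e SigmaX Sigma hSigmaX hSigma hX X_small
      e_sum0 e_cov e_tail f C cf fC.
    apply: near_cvg_fun h; apply: filterS near_unit => n un.
    by apply: eq_wexp => s; rewrite bootE// covE// resampleE.
Qed.

Theorem theorem1 (R : realType) (r p : nat) (hr : (1 < r)%N) (hp : (1 <= p)%N)
  (d : measure_display) (Omega : measurableType d) (P : probability Omega R)
  (X : nat -> 'cV[R]_p) (beta : 'M[R]_(r, p))
  (eps Y : nat -> Omega -> 'cV[R]_r) (F : probability 'cV[R]_r R)
  (Sigma : 'M[R]_r) (SigmaX : 'M[R]_p)
  (hY : forall i w, Y i w = beta *m X i + eps i w)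
  (heps : iid P eps F)
  (hmean : forall j, ('E_F[fun z => z j ord0] = 0)%E)
  (hcov : forall j k, covariance F (fun z => z j ord0) (fun z => z k ord0) =
                      (Sigma j k)%:E)
  (hSigma : posdef Sigma)
  (hmom4 : forall j, ('E_F[fun z => (z j ord0 ^+ 4)%R] < +oo)%E)
  (hSigmaX : posdef SigmaX)
  (hX : n%:R^-1 *: ((stack X n)^T *m stack X n) @[n --> \oo] --> SigmaX) :
  {ae P, forall w,
    forall (dB : nat -> measure_display)
      (OmegaB : forall n, measurableType (dB n))
      (PB : forall n, probability (OmegaB n) R)
      (epsB : forall n, OmegaB n -> 'M[R]_(n, r)),
    let XX n := stack X n in
    let YY n := stack (fun i => Y i w) n in
    let bhat n := ols (XX n) (YY n) in
    let bstar n t := boot_ols (XX n) (YY n) (epsB n t) in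
    let Sstar n t := boot_cov (XX n) (YY n) (epsB n t) in
    (forall n, iid (PB n) (fun i t => obs (epsB n t) i)
                 (empirical_centered (residuals (XX n) (YY n)))) ->
    [/\ cvg_in_distribution PB
          (fun n t => Num.sqrt n%:R *: (vec (bstar n t) - vec (bhat n)))
          (mvnormal 0 (invmx SigmaX *t Sigma)),
        cvg_in_probability PB Sstar Sigma &
        forall SstarInvSqrt : forall n, OmegaB n -> 'M[R]_r,
          (forall n, measurable_fun [set: OmegaB n] (SstarInvSqrt n)) ->
          (forall n t, Sstar n t \in unitmx ->
             SstarInvSqrt n t = invmx (sqrtmx (Sstar n t))) ->
          cvg_in_distribution PB
            (fun n t => (sqrtmx ((XX n)^T *m XX n) *t SstarInvSqrt n t) *m
                        (vec (bstar n t) - vec (bhat n)))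
            (mvnormal 0 1%:M)]}.
Proof.
have X_bound k : exists C : R, forall n, \sum_(i < n) X i k ord0 ^+ 2 <= C * n%:R.
  apply: (@avg_cvg_bounded _ (fun i => X i k ord0 ^+ 2) (SigmaX k k)).
  apply: eq_cvg_fun (cvg_mx_entry (i := k) (j := k) hX) => n.
  by rewrite !mxE; congr (_ * _); apply: eq_bigr => i _; rewrite !mxE expr2.
(* The null set is determined by the errors alone, so the bootstrap spaces can be introduced after
   the path is fixed. *)
apply: filterS3 (ae_error_mean heps hmean hmom4) (ae_error_cross heps hmean hmom4 X_bound)
  (filterI (ae_error_cov heps hmean hcov hmom4) (ae_error_tail heps hmom4)).
move=> w z_mean z_cross [z_cov z_tail] dB OmegaB PB epsB hB.
by apply: (residual_bootstrap_limits (fun i => hY i w) hSigma hSigmaX hX z_mean z_cross).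
Qed.
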